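(* There exist a polynomial-time algorithm and a constant $c>0$ such that, given any instance $(G,k)$ of Max-Bisec-ATLB (a graph $G$ and a nonnegative integer $k$), the algorithm outputs an instance $(G',k')$ of Max-Bisec-ATLB such that: $G$ has a bisection of size at least $\lceil |E(G)|/2\rceil+k$ if and only if $G'$ has a bisection of size at least $\lceil |E(G')|/2\rceil+k'$; $k'\le k$; and $G'$ has at most $c(k^2+1)$ vertices and at most $c(k^3+1)$ edges. In other words, Max-Bisec-ATLB has a kernel with $O(k^2)$ vertices and $O(k^3)$ edges.
   Context: Graphs are finite, simple and undirected. For a graph $G=(V,E)$ with $m=|E|$ edges, a bisection $(X,Y)$ of $G$ is a partition of $V$ into sets $X$ and $Y$ with $|X|\le |Y|\le |X|+1$; its size is the number of edges with one endpoint in $X$ and the other in $Y$. The parameterized problem Max Bisection above Tight Lower Bound (Max-Bisec-ATLB) is: given a graph $G=(V,E)$ and an integer $k\ge 0$ (the parameter), decide whether $G$ has a bisection of size at least $\lceil m/2\rceil+k$. A kernel for a parameterized problem is a polynomial-time algorithm mapping an instance $(x,k)$ to an equivalent instance $(x',k')$ whose parameter $k'$ and size $|x'|$ are bounded by functions of $k$ alone. *)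

(* Defs.v *)
From mathcomp Require Import all_boot.
Set Warnings "-notation-overridden".

Set Implicit Arguments. Unset Strict Implicit. Unset Printing Implicit Defensive.

Record sgraph := SGraph {
  gn : nat;
  gadj : rel 'I_gn;
  gsym : symmetric gadj;
  girr : irreflexive gadj }.

Definition edges (G : sgraph) : {set 'I_(gn G) * 'I_(gn G)} :=
  [set e : 'I_(gn G) * 'I_(gn G) | (e.1 < e.2)%N && gadj e.1 e.2].

Definition nedges (G : sgraph) : nat := #|edges G|.

Definition is_bisection (G : sgraph) (X : {set 'I_(gn G)}) : bool :=
  (#|X| <= #|~: X|) && (#|~: X| <= #|X|.+1).

Definition bis_size (G : sgraph) (X : {set 'I_(gn G)}) : nat :=
  #|[set e in edges G | (e.1 \in X) != (e.2 \in X)]|.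

Definition ceil_half (m : nat) : nat := (m.+1) %/ 2.

Definition MaxBisecATLB (G : sgraph) (k : nat) : Prop :=
  exists X : {set 'I_(gn G)},
    is_bisection X /\ ceil_half (nedges G) + k <= bis_size X.

Definition sym := option (option bool).
Definition Blank : sym := None.
Definition Sep : sym := Some None.
Definition Bit (b : bool) : sym := Some (Some b).

Inductive move := MoveL | MoveR | Stay.

Record TM := {
  tm_state : finType;
  tm_start : tm_state;
  tm_halt : pred tm_state;
  tm_delta : tm_state -> sym -> tm_state * sym * move }.

(* Tape as a zipper: reversed left part, scanned cell, right part; blanks
   beyond both ends. *)
Definition tape := (seq sym * sym * seq sym)%type.

Definition move_tape (t : tape) (m : move) : tape :=
  let: (l, c, r) := t in
  match m with
  | Stay => t
  | MoveL => match l with [::] => ([::], Blank, c :: r)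
                        | a :: l' => (l', a, c :: r) end
  | MoveR => match r with [::] => (c :: l, Blank, [::])
                        | a :: r' => (c :: l, a, r') end
  end.

Definition config (M : TM) := (tm_state M * tape)%type.

Definition step (M : TM) (cf : config M) : config M :=
  let: (q, (l, c, r)) := cf in
  if @tm_halt M q then cf else
  let: (q', c', m) := @tm_delta M q c in (q', move_tape (l, c', r) m).

Definition init_config (M : TM) (x : seq sym) : config M :=
  (@tm_start M, match x with [::] => ([::], Blank, [::])
                          | a :: x' => ([::], a, x') end).

Definition tape_output (t : tape) : seq sym :=
  let: (_, c, r) := t in let s := c :: r in take (find (pred1 Blank) s) s.

Definition runs_to (M : TM) (x : seq sym) (t : nat) (y : seq sym) : Prop :=
  let cf := iter t (@step M) (init_config M x) in
  @tm_halt M cf.1 /\ tape_output cf.2 = y.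

(* Binary, most significant bit first (0 is encoded as a single 0). *)
Definition bin (n : nat) : seq bool :=
  rev [seq odd (n %/ 2 ^ i) | i <- iota 0 (trunc_log 2 n).+1].

(* Upper triangle of the adjacency matrix, row-major. *)
Definition adj_bits (G : sgraph) : seq bool :=
  [seq gadj p.1 p.2 | p : 'I_(gn G) * 'I_(gn G) <- [seq (i, j) | i <- enum 'I_(gn G), j <- enum 'I_(gn G)]
                     & (p.1 < p.2)%N].

Definition enc_instance (G : sgraph) (k : nat) : seq sym :=
  map Bit (bin (gn G)) ++ Sep :: map Bit (adj_bits G) ++ Sep :: map Bit (bin k).

(* Main.v *)
Require Import Defs.
From mathcomp Require Import all_boot zify.
Set Implicit Arguments. Unset Strict Implicit. Unset Printing Implicit Defensive.

(** Call two vertices twins if they have the same neighbourhood.  Keep a vertex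
    [v] iff fewer than [s + (n mod 2)] of its twins precede it, where [s] is the
    number of its non-twins.  Only a majority class [R] loses vertices, an even
    number of them; since the vertices of [R] are interchangeable and
    independent, deleting one from each side of a bisection does not change
    [2 * cut - edges], and the majority forces enough vertices of [R] on each
    side.

    If more than [16 k] vertices are kept, the answer is yes.  Bisections with
    large excess [2 * cut - edges] are glued from disjoint pieces: flipping one
    piece makes at least half of the crossing edges cut, so excesses add up.  A
    matching edge is a piece of excess [1], and a vertex with [p] neighbours and
    [p - 1] non-neighbours in an independent set is a piece of excess [p].
    Exhausting first a maximal matching and then such stars centred at the
    matched vertices leaves a set of mutual twins; if the total excess is below
    [2 k] in both rounds, fewer than [8 k] vertices lie outside that set.

    The kernel is therefore computed by counting loops over positions of the
    input.  Such loops run on a Turing machine whose tape attaches to every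
    input symbol one bit per counter; a counter is stored in unary along the
    tape and every elementary operation is one sweep. *)

(** * Structured programs and their compilation to Turing machines *)

(** The parameter is given in binary and may be exponential in the input length, whereas loop
    counters are unary and at most that length. Hence [k] is only copied bit by bit, and [16 k] is
    never formed: the bit length of the number of kept vertices divided by [16] is compared with
    that of [k]. This costs a factor of about two, so an instance that is not answered at once keeps
    at most [32 (k + 1)] vertices; the quadratic and cubic bounds follow from this linear one.

    A bisection of size half of the edges, rounded up, plus [k] is one of excess at least [2 k], by
    parity. The two rounds are compared with [2 k] separately because the stars are centred at
    matched vertices, so their excess cannot be added to that of the matching. Each round accounts
    for at most [2 (2 k - 1)] vertices outside the set of mutual twins, hence [s <= 8 k - 4], and at
    most [2 s + 1] vertices are kept. The correction [n mod 2] makes the number of deleted twins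
    even. *)

(* A write-once flag, the result of the last test, and one remembered symbol. *)
Definition cmem := (bool * bool * sym)%type.

Inductive prog :=
  | Act of (cmem -> sym -> cmem * sym * move)
  | Seq of prog & prog
  | While of (cmem -> sym -> bool) & prog
  | If of (cmem -> sym -> bool) & prog & prog.

(** The step count is that of the compiled code: a test costs one step, and so does the jump back
    from a loop body or over the else branch. *)
Inductive exec : prog -> cmem -> tape -> nat -> cmem -> tape -> Prop :=
  | ExAct f m l c r m' c' mv : f m c = (m', c', mv) ->
      exec (Act f) m (l, c, r) 1 m' (move_tape (l, c', r) mv)
  | ExSeq p q m t n m1 t1 n1 m2 t2 : exec p m t n m1 t1 ->
      exec q m1 t1 n1 m2 t2 -> exec (Seq p q) m t (n + n1) m2 t2
  | ExWhileF (b : cmem -> sym -> bool) p m l c r : ~~ b m c -> exec (While b p) m (l, c, r) 1 m (l, c, r)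
  | ExWhileT (b : cmem -> sym -> bool) p m l c r n m1 t1 n1 m2 t2 : b m c ->
      exec p m (l, c, r) n m1 t1 -> exec (While b p) m1 t1 n1 m2 t2 ->
      exec (While b p) m (l, c, r) (n + n1).+2 m2 t2
  | ExIfT (b : cmem -> sym -> bool) p q m l c r n m1 t1 : b m c -> exec p m (l, c, r) n m1 t1 ->
      exec (If b p q) m (l, c, r) n.+2 m1 t1
  | ExIfF (b : cmem -> sym -> bool) p q m l c r n m1 t1 : ~~ b m c -> exec q m (l, c, r) n m1 t1 ->
      exec (If b p q) m (l, c, r) n.+1 m1 t1.

Definition instr := cmem -> sym -> cmem * sym * move * nat.

Definition jump (b : cmem -> sym -> bool) (a1 a2 : nat) : instr :=
  fun m s => ((m, s, Stay), if b m s then a1 else a2).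

Definition goto (a : nat) : instr := fun m s => ((m, s, Stay), a).

Fixpoint code_size (p : prog) : nat :=
  match p with
  | Act _ => 1
  | Seq p q => code_size p + code_size q
  | While _ p => (code_size p).+2
  | If _ p q => (code_size p + code_size q).+2
  end.

(** [o] is the absolute address of the first instruction, so jump targets are plain numbers. *)
Fixpoint compile (o : nat) (p : prog) : seq instr :=
  match p with
  | Act f => [:: fun m s => (f m s, o.+1)]
  | Seq p q => compile o p ++ compile (o + code_size p) q
  | While b p => jump b o.+1 (o + (code_size p).+2) ::
                 compile o.+1 p ++ [:: goto o]
  | If b p q => jump b o.+1 (o + (code_size p).+2) ::
                compile o.+1 p ++ goto (o + (code_size p + code_size q).+2) ::
                compile (o + (code_size p).+2) q
  end.

Lemma size_compile p o : size (compile o p) = code_size p.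
Proof.
elim: p o => [f|p IHp q IHq|b p IHp|b p IHp q IHq] o //=.
- by rewrite size_cat IHp IHq.
- by rewrite size_cat IHp /= addn1.
- by rewrite size_cat IHp /= IHq addnS.
Qed.

(** Past the end the default instruction [goto (size C)] applies, so a finished program idles there
    just as a halted machine keeps its configuration. *)
Definition jstep (C : seq instr) (cf : nat * cmem * tape) : nat * cmem * tape :=
  let: (pc, m, (l, c, r)) := cf in
  let: ((m', c', mv), pc') := nth (goto (size C)) C pc m c in
  (pc', m', move_tape (l, c', r) mv).

(** Subprograms sit inside larger code, hence the quantification over the surrounding [pre] and
    [post]: control enters at address [size pre] and leaves just after the compiled block. *)
Lemma compile_correct p m t n m' t' : exec p m t n m' t' ->
  forall C pre post, C = pre ++ compile (size pre) p ++ post ->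
  iter n (jstep C) (size pre, m, t) = (size pre + code_size p, m', t').
Proof.
elim => {p m t n m' t'}.
- move=> f m l c r m' c' mv E C pre post -> /=.
  by rewrite nth_cat ltnn subnn /= E addn1.
- move=> p q m t n m1 t1 n1 m2 t2 _ IH1 _ IH2 C pre post -> /=.
  rewrite addnC iterD (IH1 _ pre (compile (size pre + code_size p) q ++ post));
    last by rewrite -catA.
  rewrite -(size_compile p (size pre)) -size_cat.
  rewrite (IH2 _ (pre ++ compile (size pre) p) post); last by rewrite -!catA.
  by rewrite size_cat !size_compile addnA.
- move=> b p m l c r /negbTE Hb C pre post -> /=.
  by rewrite nth_cat ltnn subnn /= /jump Hb.
- move=> b p m l c r n m1 t1 n1 m2 t2 Hb _ IH1 _ IH2 C pre post EC.
  rewrite iterSr (_ : jstep C _ = ((size pre).+1, m, (l, c, r))); last first.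
    by rewrite EC /jstep nth_cat ltnn subnn /= /jump Hb.
  rewrite addnC -addSn iterD.
  pose pre1 := rcons pre (jump b (size pre).+1 (size pre + (code_size p).+2)).
  have E1 : size pre1 = (size pre).+1 by rewrite size_rcons.
  rewrite -E1 (IH1 C pre1 (goto (size pre) :: post)); last first.
    by rewrite EC /= E1 /pre1 cat_rcons /= -!catA.
  rewrite iterSr.
  have -> : jstep C (size pre1 + code_size p, m1, t1) = (size pre, m1, t1).
    case: t1 {IH1 IH2} => [[l1 c1] r1]; rewrite EC /jstep /= E1.
    rewrite addSnnS nth_cat ltnNge leq_addr /= addKn /=.
    by rewrite -catA nth_cat size_compile ltnn subnn /=.
  exact: (IH2 _ pre post).
- move=> b p q m l c r n m1 t1 Hb _ IH1 C pre post EC.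
  rewrite iterSr (_ : jstep C _ = ((size pre).+1, m, (l, c, r))); last first.
    by rewrite EC /jstep nth_cat ltnn subnn /= /jump Hb.
  pose pre1 := rcons pre (jump b (size pre).+1 (size pre + (code_size p).+2)).
  have E1 : size pre1 = (size pre).+1 by rewrite size_rcons.
  rewrite iterS -E1 (IH1 C pre1 (goto (size pre + (code_size p + code_size q).+2)
     :: compile (size pre + (code_size p).+2) q ++ post)); last first.
    by rewrite EC /= E1 /pre1 cat_rcons /= -!catA.
  case: t1 {IH1} => [[l1 c1] r1]; rewrite EC /jstep /= E1.
  rewrite addSnnS nth_cat ltnNge leq_addr /= addKn /=.
  by rewrite -catA nth_cat size_compile ltnn subnn /=.
- move=> b p q m l c r n m1 t1 Hb _ IH1 C pre post EC.
  rewrite iterSr (_ : jstep C _ = (size pre + (code_size p).+2, m, (l, c, r))); last first.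
    by rewrite EC /jstep nth_cat ltnn subnn /= /jump (negbTE Hb).
  pose pre1 := pre ++ jump b (size pre).+1 (size pre + (code_size p).+2) ::
    rcons (compile (size pre).+1 p) (goto (size pre + (code_size p + code_size q).+2)).
  have E1 : size pre1 = size pre + (code_size p).+2.
    by rewrite size_cat /= size_rcons size_compile.
  rewrite -E1 (IH1 C pre1 post); last first.
    by rewrite EC /= E1 /pre1 -[in RHS]catA /= cat_rcons -catA.
  by rewrite E1 /=; congr (_, _, _); lia.
Qed.

(** Jumps reach at most the address one past the code, so [inord] in [machine_delta] never alters a
    target. *)
Lemma compile_target p o i d m s : i < code_size p ->
  (nth d (compile o p) i m s).2 <= o + code_size p.
Proof.
elim: p o i => [f|p IHp q IHq|b p IHp|b p IHp q IHq] o i /=.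
- by case: i => //= _; rewrite addn1.
- move=> H; rewrite nth_cat size_compile; case: ltnP => lti.
    by apply: leq_trans (IHp _ _ lti) _; rewrite addnA leq_addr.
  by rewrite addnA; apply: IHq; lia.
- case: i => [|i] /=; first by rewrite /jump; case: ifP => /=; lia.
  move=> H; rewrite nth_cat size_compile; case: ltnP => lti.
    by apply: leq_trans (IHp _ _ lti) _; lia.
  have -> : i - code_size p = 0 by lia.
  by rewrite /= leq_addr.
- case: i => [|i] /=; first by rewrite /jump; case: ifP => /=; lia.
  move=> H; rewrite nth_cat size_compile; case: ltnP => lti.
    by apply: leq_trans (IHp _ _ lti) _; lia.
  case E: (i - code_size p) => [|j] //=.
  by apply: leq_trans (IHq _ _ _) _; lia.
Qed.

Definition mem0 : cmem := (false, false, Blank).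

Definition machine_delta (C : seq instr) (q : 'I_(size C).+1 * cmem) (s : sym) :
    ('I_(size C).+1 * cmem) * sym * move :=
  let: ((m', s', mv), a) := nth (goto (size C)) C q.1 q.2 s in
  ((inord a, m'), s', mv).

Definition machine (p : prog) : TM :=
  {| tm_state := ('I_(size (compile 0 p)).+1 * cmem)%type;
     tm_start := (ord0, mem0);
     tm_halt := fun q => q.1 == ord_max;
     tm_delta := @machine_delta (compile 0 p) |}.

Definition of_config p (cf : config (machine p)) : nat * cmem * tape :=
  (nat_of_ord cf.1.1, cf.1.2, cf.2).

Lemma of_config_step p (cf : config (machine p)) :
  of_config (step cf) = jstep (compile 0 p) (of_config cf).
Proof.
case: cf => [[q m] [[l c] r]] /=; case: ifP => [/eqP->|nhq].
  by rewrite /of_config /= nth_default.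
have ltq : q < size (compile 0 p).
  by rewrite ltn_neqAle -ltnS ltn_ord andbT; apply/eqP => E; move: nhq; rewrite -val_eqE /= E eqxx.
rewrite /machine_delta /=.
have := @compile_target p 0 q (goto (size (compile 0 p))) m c.
rewrite -[code_size p](size_compile p 0) add0n => /(_ ltq).
by case: (nth _ _ _ _ _) => [[[m' s'] mv] a] /= lea; rewrite /of_config /= inordK.
Qed.

Lemma machine_runs p x n m t y :
  exec p mem0 (init_config (machine p) x).2 n m t -> tape_output t = y ->
  runs_to (machine p) x n y.
Proof.
move=> /compile_correct/(_ (compile 0 p) [::] [::]); rewrite /= cats0 add0n.
move=> /(_ erefl) run <-.
have E : of_config (iter n (@step (machine p)) (init_config (machine p) x)) = (code_size p, m, t).
  by rewrite -run; elim: (n) => [|j /= <-] //; rewrite of_config_step.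
rewrite /runs_to; case: (iter _ _ _) E => [[q m'] t'] [Eq _ ->]; split=> //=.
by apply/eqP/val_inj; rewrite /= Eq size_compile.
Qed.

(** * Sweeping a tape made of blocks *)

Definition run p m t T m' t' := exists2 n, n <= T & exec p m t n m' t'.

(* The head scans the first symbol of [u]; it is on a blank cell when [u] is empty. *)
Definition tp (l u : seq sym) : tape := (l, head Blank u, behead u).

Lemma run_le p m t T T' m' t' : T <= T' -> run p m t T m' t' -> run p m t T' m' t'.
Proof. by move=> leT [n len ex]; exists n => //; apply: leq_trans leT. Qed.

Lemma run_seq p q m t T m1 t1 T1 m2 t2 :
  run p m t T m1 t1 -> run q m1 t1 T1 m2 t2 -> run (Seq p q) m t (T + T1) m2 t2.
Proof. by move=> [n ? ?] [n1 ? ?]; exists (n + n1); [apply: leq_add | apply: ExSeq; eassumption]. Qed.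

Lemma run_whileF (b : cmem -> sym -> bool) p m l u : ~~ b m (head Blank u) ->
  run (While b p) m (tp l u) 1 m (tp l u).
Proof. by exists 1 => //; apply: ExWhileF. Qed.

Lemma run_whileT (b : cmem -> sym -> bool) p m l u T m1 t1 T1 m2 t2 : b m (head Blank u) ->
  run p m (tp l u) T m1 t1 -> run (While b p) m1 t1 T1 m2 t2 ->
  run (While b p) m (tp l u) (T + T1).+2 m2 t2.
Proof.
move=> Hb [n le1 e1] [n1 le2 e2]; exists (n + n1).+2; first by rewrite !ltnS leq_add.
exact: ExWhileT e1 e2.
Qed.

Lemma run_ifT (b : cmem -> sym -> bool) p q m l u T m1 t1 : b m (head Blank u) ->
  run p m (tp l u) T m1 t1 -> run (If b p q) m (tp l u) T.+2 m1 t1.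
Proof. by move=> Hb [n le1 e1]; exists n.+2 => //; apply: ExIfT. Qed.

Lemma run_ifF (b : cmem -> sym -> bool) p q m l u T m1 t1 : ~~ b m (head Blank u) ->
  run q m (tp l u) T m1 t1 -> run (If b p q) m (tp l u) T.+2 m1 t1.
Proof. by move=> Hb [n le1 e1]; exists n.+1; [apply: leqW | apply: ExIfF]. Qed.

Definition mvR := Act (fun m s => (m, s, MoveR)).
Definition mvL := Act (fun m s => (m, s, MoveL)).
Definition skip := Act (fun m s => (m, s, Stay)).
Definition put (s : sym) := Act (fun m _ => (m, s, Stay)).
Definition setmem (m : cmem) := Act (fun _ s => (m, s, Stay)).
Definition nb (m : cmem) (s : sym) := s != Blank.
Definition nblk (s : sym) := s != Blank.

Lemma run_mvR m l c u : run mvR m (tp l (c :: u)) 1 m (tp (c :: l) u).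
Proof. exists 1 => //; have := @ExAct (fun m s => (m, s, MoveR)) m l c u m c MoveR erefl.
by case: u. Qed.

Lemma run_mvL m l c u : run mvL m (tp l (c :: u)) 1 m (tp (behead l) (head Blank l :: c :: u)).
Proof. exists 1 => //; have := @ExAct (fun m s => (m, s, MoveL)) m l c u m c MoveL erefl.
by case: l. Qed.

Lemma run_mvL_end m l : run mvL m (tp l [::]) 1 m (tp (behead l) [:: head Blank l; Blank]).
Proof. exists 1 => //; have := @ExAct (fun m s => (m, s, MoveL)) m l Blank [::] m Blank MoveL erefl.
by case: l. Qed.

Lemma run_act (f : cmem -> sym -> cmem * sym) m l u :
  run (Act (fun m s => (f m s, Stay))) m (tp l u) 1 (f m (head Blank u)).1
    (tp l ((f m (head Blank u)).2 :: behead u)).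
Proof.
exists 1 => //; have := @ExAct (fun m s => (f m s, Stay)) m l (head Blank u) (behead u).
by move=> /(_ (f m (head Blank u)).1 (f m (head Blank u)).2 Stay) /=; apply; case: (f _ _).
Qed.

Lemma run_put s m l u : run (put s) m (tp l u) 1 m (tp l (s :: behead u)).
Proof. exact: (run_act (fun m _ => (m, s))). Qed.

Lemma run_setmem m0 m l c u : run (setmem m0) m (tp l (c :: u)) 1 m0 (tp l (c :: u)).
Proof. exact: (run_act (fun _ s => (m0, s)) m l (c :: u)). Qed.

Lemma run_skip m l c u : run skip m (tp l (c :: u)) 1 m (tp l (c :: u)).
Proof. exact: (run_act (fun m s => (m, s)) m l (c :: u)). Qed.

Lemma run_skipR m l u v : all nblk u -> head Blank v = Blank ->
  run (While nb mvR) m (tp l (u ++ v)) (3 * size u + 1) m (tp (rev u ++ l) v).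
Proof.
move=> + Hv; elim: u l => [|c u IH] l /=.
  by move=> _; apply: run_whileF; rewrite Hv.
case/andP=> Hc Hu; rewrite rev_cons cat_rcons.
have := run_whileT _ (run_mvR m l c (u ++ v)) (IH (c :: l) Hu).
by move=> /(_ Hc); apply: run_le; lia.
Qed.

Lemma run_skipL m l u c v : nblk c -> all nblk u -> head Blank l = Blank ->
  run (While nb mvL) m (tp (rev u ++ l) (c :: v)) (3 * size u + 4) m
    (tp (behead l) (Blank :: u ++ c :: v)).
Proof.
move=> + + Hl; elim/last_ind: u c v => [|u a IH] c v Hc.
  move=> _; apply: (@run_le _ _ _ (1 + 1).+2) => //.
  apply: run_whileT => //=; first exact: run_mvL.
  by rewrite Hl; apply: run_whileF.
rewrite all_rcons => /andP[Ha Hu]; rewrite rev_rcons /= cat_rcons size_rcons.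
have := run_whileT _ (run_mvL m (a :: rev u ++ l) c v) (IH a (c :: v) Ha Hu).
by move=> /(_ Hc); apply: run_le; lia.
Qed.

Fixpoint rep j p := if j is j'.+1 then Seq p (rep j' p) else skip.

Lemma run_repR m l u v : v != [::] ->
  run (rep (size u) mvR) m (tp l (u ++ v)) (size u).+1 m (tp (rev u ++ l) v).
Proof.
move=> Hv; elim: u l => [|c u IH] l /=; first by case: v Hv => // c v _; apply: run_skip.
by rewrite rev_cons cat_rcons -add1n; apply: run_seq; [exact: run_mvR | exact: IH].
Qed.

Lemma run_repL m l u v : v != [::] ->
  run (rep (size u) mvL) m (tp (rev u ++ l) v) (size u).+1 m (tp l (u ++ v)).
Proof.
elim/last_ind: u v => [|u a IH] [|c v] //= _; first exact: run_skip.
rewrite rev_rcons cat_rcons size_rcons /= -add1n; apply: run_seq; first exact: run_mvL.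
exact: IH.
Qed.

Definition inplace o (f : cmem -> sym -> cmem * sym) :=
  Seq (rep o mvR) (Seq (Act (fun m s => (f m s, Stay))) (rep o mvL)).

Lemma run_inplace o f m l u v : o < size u ->
  run (inplace o f) m (tp l (u ++ v)) (2 * o + 3) (f m (nth Blank u o)).1
    (tp l (set_nth Blank u o (f m (nth Blank u o)).2 ++ v)).
Proof.
move=> ltou; have Eo : size (take o u) = o by rewrite size_takel // ltnW.
have {1}-> : u = take o u ++ nth Blank u o :: drop o.+1 u.
  by rewrite -drop_nth // cat_take_drop.
have -> x : set_nth Blank u o x = take o u ++ x :: drop o.+1 u.
  by rewrite set_nthE ltou.
rewrite -!catA !cat_cons; apply: (@run_le _ _ _ (o.+1 + (1 + o.+1))); first lia.
apply: run_seq; first by have := run_repR m l (take o u); rewrite Eo; apply.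
apply: run_seq; first exact: run_act.
by have := run_repL _ l (take o u); rewrite Eo; apply.
Qed.

(** An offset inside a block, with the action to perform there on the memory and the scanned
    symbol. *)
Definition act_t := (nat * (cmem -> sym -> cmem * sym))%type.

Fixpoint apply_acts (m : cmem) (u : seq sym) (acts : seq act_t) :=
  if acts is a :: acts' then
    apply_acts (a.2 m (nth Blank u a.1)).1
      (set_nth Blank u a.1 (a.2 m (nth Blank u a.1)).2) acts'
  else (m, u).

Definition block_prog B (acts : seq act_t) :=
  foldr (fun a => Seq (inplace a.1 a.2)) (rep B mvR) acts.

Definition block_time B (acts : seq act_t) :=
  foldr (fun a T => 2 * a.1 + 3 + T) B.+1 acts.

Lemma run_block B acts m l u v : size u = B -> v != [::] ->
  all (fun a => a.1 < B) acts ->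
  run (block_prog B acts) m (tp l (u ++ v)) (block_time B acts)
    (apply_acts m u acts).1 (tp (rev (apply_acts m u acts).2 ++ l) v).
Proof.
move=> + Hv; elim: acts m u => [|a acts IH] m u Hu /=.
  by move=> _; rewrite -Hu; apply: run_repR.
case/andP=> Ha Hacts; apply: run_seq; first by apply: run_inplace; rewrite Hu.
by apply: IH => //; rewrite size_set_nth Hu; apply/maxn_idPr.
Qed.

Definition go_home := Seq mvL (Seq (While nb mvL) mvR).

Definition sweep B m0 acts :=
  Seq (setmem m0) (Seq (While nb (block_prog B acts)) go_home).

Lemma head_nseq a : head Blank (nseq a Blank) = Blank. Proof. by case: a. Qed.

Lemma behead_nseq (T : Type) a (x : T) : behead (nseq a x) = nseq a.-1 x.
Proof. by case: a. Qed.

(** The head overshoots the leftmost symbol onto a blank and steps back. If the left padding was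
    empty this blank is new, hence [a.-1.+1], which is [1] for [a = 0] and [a] otherwise. *)
Lemma run_go_home m a u v : all nblk u -> u != [::] -> v != [::] ->
  run go_home m (tp (rev u ++ nseq a Blank) v) (3 * size u + 5) m
    (tp (nseq a.-1.+1 Blank) (u ++ v)).
Proof.
case/lastP: u v => [//|u c] [//|d v]; rewrite all_rcons => /andP[Hc Hu] _ _.
apply: (@run_le _ _ _ (1 + ((3 * size u + 4) + 1))); first by rewrite size_rcons; lia.
apply: run_seq; first exact: run_mvL.
rewrite rev_rcons /=; apply: run_seq; first by apply: run_skipL; rewrite ?head_nseq.
by rewrite behead_nseq cat_rcons; apply: run_mvR.
Qed.

(** A sweep is specified by an invariant: [mu p] is the memory on entering block [p], so that only
    the effect on a single block has to be checked. *)
Lemma run_sweep B m0 acts N (blk blk' : nat -> seq sym) (mu : nat -> cmem) m a v :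
  0 < B -> 0 < N -> all (fun a => a.1 < B) acts -> mu 0 = m0 ->
  (forall p, p < N -> size (blk p) = B /\ all nblk (blk p)) ->
  (forall p, p < N -> all nblk (blk' p) /\ size (blk' p) = B) ->
  (forall p, p < N -> apply_acts (mu p) (blk p) acts = (mu p.+1, blk' p)) ->
  run (sweep B m0 acts) m
    (tp (nseq a Blank) (flatten [seq blk p | p <- iota 0 N] ++ Blank :: v))
    (N * (block_time B acts + 2 + 3 * B) + 7) (mu N)
    (tp (nseq a.-1.+1 Blank) (flatten [seq blk' p | p <- iota 0 N] ++ Blank :: v)).
Proof.
move=> B0 N0 Hacts mu0 Hblk Hblk' Hstep.
have Hnb (f : nat -> seq sym) M : (forall p, p < M -> all nblk (f p)) ->
    all nblk (flatten [seq f p | p <- iota 0 M]).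
  move=> H; apply/allP=> x /flatten_mapP[p]; rewrite mem_iota => /andP[_ ltp].
  by move: x; apply/allP; apply: H.
have sz (f : nat -> seq sym) M : (forall p, p < M -> size (f p) = B) ->
    size (flatten [seq f p | p <- iota 0 M]) = M * B.
  elim: M => [|M IH] H; first by [].
  rewrite -addn1 iotaD map_cat flatten_cat size_cat IH => [|p ltp]; last by apply: H; lia.
  by rewrite /= cats0 H ?mulSn //; lia.
set U := flatten _; set U' := flatten _.
(* Stated for the blocks from [p] on and an arbitrary left tape, so that induction on the number [j]
   of remaining blocks applies. *)
have Hloop : forall j p l, p + j = N ->
  run (While nb (block_prog B acts)) (mu p)
    (tp l (flatten [seq blk q | q <- iota p j] ++ Blank :: v))
    (j * (block_time B acts + 2) + 1) (mu N)
    (tp (rev (flatten [seq blk' q | q <- iota p j]) ++ l) (Blank :: v)).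
  elim=> [|j IH] p l E /=; first by rewrite addn0 in E; rewrite -E; apply: run_whileF.
  have ltp : p < N by lia.
  have [szp nbp] := Hblk p ltp.
  rewrite rev_cat -!catA.
  apply: (@run_le _ _ _ (block_time B acts + (j * (block_time B acts + 2) + 1)).+2); first lia.
  apply: run_whileT.
  - by move: nbp szp B0; case: (blk p) => [|c u] /=; [lia | case/andP].
  - have := run_block (mu p) l szp _ Hacts; rewrite (Hstep p ltp) /=; apply.
    by case: (flatten _).
  by rewrite /=; apply: IH; lia.
have U0 : U <> [::] by move=> E; have := sz blk N (fun p H => proj1 (Hblk p H)); rewrite -/U E /=; lia.
have U'0 : U' != [::].
  by apply/eqP => E; have := sz blk' N (fun p H => proj2 (Hblk' p H)); rewrite -/U' E /=; lia.
have szU' : size U' = N * B by apply: sz => p /Hblk'[].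
apply: (@run_le _ _ _ (1 + ((N * (block_time B acts + 2) + 1) + (3 * size U' + 5)))).
  by rewrite szU'; lia.
apply: (@run_seq _ _ _ _ _ m0 (tp (nseq a Blank) (U ++ Blank :: v))).
  by case: (U) U0 => // c u _; apply: run_setmem.
rewrite -mu0; apply: run_seq; first exact: Hloop.
by apply: run_go_home => //; apply: Hnb => p /Hblk'[].
Qed.

(** * Registers stored along the tape *)

(* Register [v] is the number of leading blocks whose bit for it is set. *)
Definition blk (w : seq sym) (rs : seq nat) (p : nat) : seq sym :=
  nth Blank w p :: [seq Bit (p < v) | v <- rs].

Definition region w rs := flatten [seq blk w rs p | p <- iota 0 (size w)].

(* Blanks have to be tracked explicitly because [move_tape] extends the tape lazily. *)
Definition home w rs out a b : tape :=
  tp (nseq a Blank) (region w rs ++ Blank :: out ++ nseq b Blank).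

Definition wok (w : seq sym) := all nblk w && (0 < size w).

(** Memory and padding are arbitrary before the run and existential after it, so that runs compose;
    [Q] is all that is remembered of the memory, in practice the test flag. *)
Definition hrun p w rs out T rs' out' (Q : cmem -> Prop) := forall m a b,
  exists m' a' b', run p m (home w rs out a b) T m' (home w rs' out' a' b') /\ Q m'.

Lemma hrun_le p w rs out T T' rs' out' Q : T <= T' ->
  hrun p w rs out T rs' out' Q -> hrun p w rs out T' rs' out' Q.
Proof.
move=> le H m a b; have [m' [a' [b' [r HQ]]]] := H m a b.
by exists m', a', b'; split=> //; apply: run_le r.
Qed.

Lemma hrun_seq p q w rs out T rs1 out1 Q1 T1 rs2 out2 Q2 :
  hrun p w rs out T rs1 out1 Q1 -> hrun q w rs1 out1 T1 rs2 out2 Q2 ->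
  hrun (Seq p q) w rs out (T + T1) rs2 out2 Q2.
Proof.
move=> H1 H2 m a b; have [m1 [a1 [b1 [r1 _]]]] := H1 m a b.
have [m2 [a2 [b2 [r2 HQ]]]] := H2 m1 a1 b1.
by exists m2, a2, b2; split=> //; apply: run_seq r2.
Qed.

Definition flag (m : cmem) (s : sym) := m.1.2.

Lemma hrun_ifT t p q w rs out T T1 rs1 out1 rs2 out2 Q :
  hrun t w rs out T rs1 out1 (fun m => m.1.2 = true) ->
  hrun p w rs1 out1 T1 rs2 out2 Q ->
  hrun (Seq t (If flag p q)) w rs out (T + T1.+2) rs2 out2 Q.
Proof.
move=> H1 H2 m a b; have [m1 [a1 [b1 [r1 E]]]] := H1 m a b.
have [m2 [a2 [b2 [r2 HQ]]]] := H2 m1 a1 b1.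
by exists m2, a2, b2; split=> //; apply: run_seq r1 _; apply: run_ifT.
Qed.

Lemma hrun_ifF t p q w rs out T T1 rs1 out1 rs2 out2 Q :
  hrun t w rs out T rs1 out1 (fun m => m.1.2 = false) ->
  hrun q w rs1 out1 T1 rs2 out2 Q ->
  hrun (Seq t (If flag p q)) w rs out (T + T1.+2) rs2 out2 Q.
Proof.
move=> H1 H2 m a b; have [m1 [a1 [b1 [r1 E]]]] := H1 m a b.
have [m2 [a2 [b2 [r2 HQ]]]] := H2 m1 a1 b1.
by exists m2, a2, b2; split=> //; apply: run_seq r1 _; apply: run_ifF; rewrite // /flag E.
Qed.

Definition loop t p := Seq t (While flag (Seq p t)).

(** The test sets the flag anew after every round, so nothing has to survive in the memory.
    Requiring it to succeed exactly for [i < N] makes the loop a counted one. The invariant also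
    speaks about the output, which the body may extend. *)
Lemma hrun_loop t p w N T (I : nat -> seq nat -> seq sym -> Prop) rs out :
  (forall i rs out, i <= N -> I i rs out ->
     hrun t w rs out T rs out (fun m => m.1.2 = (i < N))) ->
  (forall i rs out, i < N -> I i rs out -> exists rs' out',
     I i.+1 rs' out' /\ hrun p w rs out T rs' out' (fun=> True)) ->
  I 0 rs out -> exists rs' out', I N rs' out' /\
    hrun (loop t p) w rs out (N.+1 * (T + T + 2)) rs' out' (fun=> True).
Proof.
move=> Ht Hp I0.
have : forall j i rs out, i + j = N -> I i rs out -> exists rs' out', I N rs' out' /\
    forall m a b, m.1.2 = (i < N) -> exists m' a' b',
      run (While flag (Seq p t)) m (home w rs out a b)
        (j * (T + T + 2) + 1) m' (home w rs' out' a' b').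
  elim=> [|j IH] i {I0}rs {}out Ej Ii.
    move: Ej; rewrite addn0 => Ej; exists rs, out; split; first by rewrite -Ej.
    move=> m a b E; exists m, a, b.
    by apply: run_whileF; rewrite /flag E Ej ltnn.
  have lti : i < N by lia.
  have [rs1 [out1 [I1 H1]]] := Hp i rs out lti Ii.
  have [|rs2 [out2 [I2 H2]]] := IH i.+1 rs1 out1 _ I1; first lia.
  exists rs2, out2; split=> // m a b E.
  have [m2 [a2 [b2 [r2 _]]]] := H1 m a b.
  have [m3 [a3 [b3 [r3 E3]]]] := Ht i.+1 rs1 out1 lti I1 m2 a2 b2.
  have [m4 [a4 [b4 r4]]] := H2 m3 a3 b3 E3.
  exists m4, a4, b4.
  apply: (@run_le _ _ _ (T + T + (j * (T + T + 2) + 1)).+2); first lia.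
  apply: run_whileT r4; first by rewrite /flag E.
  exact: run_seq r2 r3.
move=> /(_ N 0 rs out (add0n N) I0) [rs' [out' [IN H]]]; exists rs', out'; split=> // m a b.
have [m1 [a1 [b1 [r1 E1]]]] := Ht 0 rs out (leq0n _) I0 m a b.
have [m' [a' [b' r]]] := H m1 a1 b1 E1; exists m', a', b'; split=> //.
by apply: (@run_le _ _ _ (T + (N * (T + T + 2) + 1))); [lia | apply: run_seq r].
Qed.

Lemma blk_nb w rs p : wok w -> p < size w -> all nblk (blk w rs p).
Proof.
case/andP=> /(all_nthP Blank) Hw _ ltp; rewrite /= Hw //=.
by apply/allP=> x /mapP[v _ ->].
Qed.

Lemma region_nb w rs : wok w -> all nblk (region w rs).
Proof.
move=> Hw; apply/allP=> x /flatten_mapP[p]; rewrite mem_iota => /andP[_ ltp].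
by move: x; apply/allP; apply: blk_nb.
Qed.

Lemma size_region w rs : size (region w rs) = size w * (size rs).+1.
Proof.
rewrite size_flatten /shape -map_comp (@eq_map _ _ _ (fun=> (size rs).+1)); last first.
  by move=> p /=; rewrite size_map.
by rewrite sumnE big_map big_const_seq count_predT size_iota iter_addn_0 mulnC.
Qed.

Lemma region_neq0 w rs : wok w -> region w rs != [::].
Proof. by case/andP=> _ ?; rewrite -size_eq0 size_region; lia. Qed.

Lemma hrun_sweep R m0 acts (mu : nat -> cmem) w rs rs' out :
  wok w -> size rs = R -> size rs' = R -> all (fun a => a.1 < R.+1) acts -> mu 0 = m0 ->
  (forall p, p < size w -> apply_acts (mu p) (blk w rs p) acts = (mu p.+1, blk w rs' p)) ->
  hrun (sweep R.+1 m0 acts) w rs out ((block_time R.+1 acts + 3 * R + 20) * (size w).+1)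
    rs' out (fun m => m = mu (size w)).
Proof.
move=> Hw szr szr' Ha mu0 Hstep m a b.
exists (mu (size w)), a.-1.+1, b; split=> //.
have N0 : 0 < size w by case/andP: Hw.
have := @run_sweep R.+1 m0 acts (size w) (blk w rs) (blk w rs') mu m a
  (out ++ nseq b Blank) isT N0 Ha mu0 _ _ Hstep.
move=> H; apply: run_le (H _ _); first lia.
- by move=> p ltp; split; [rewrite /= size_map szr | apply: blk_nb].
- by move=> p ltp; split; [apply: blk_nb | rewrite /= size_map szr'].
Qed.

Lemma set_nth_blk w rs p d v : d < size rs ->
  set_nth Blank (blk w rs p) d.+1 (Bit (p < v)) = blk w (set_nth 0 rs d v) p.
Proof.
move=> ltd; rewrite /blk /=; congr (_ :: _).
by elim: rs d ltd => [|x rs IH] [|d] //= ltd; rewrite IH.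
Qed.

Lemma nth_blk w rs p d : d < size rs -> nth Blank (blk w rs p) d.+1 = Bit (p < nth 0 rs d).
Proof. by move=> ltd; rewrite /= (nth_map 0). Qed.

Lemma set_nth_id (T : Type) (x : T) s i : i < size s -> set_nth x s i (nth x s i) = s.
Proof. by elim: s i => [|y s IH] [|i] //= lti; rewrite IH. Qed.

(** * Elementary operations on unary registers *)

Definition clr_acts d : seq act_t := [:: (d.+1, fun m _ => (m, Bit false))].
Definition clr R d := sweep R.+1 mem0 (clr_acts d).

Lemma hrun_clr R d : d < R -> exists K, forall w rs out, wok w -> size rs = R ->
  hrun (clr R d) w rs out (K * (size w).+1) (set_nth 0 rs d 0) out (fun=> True).
Proof.
move=> ltd; eexists=> w rs out Hw szr.
have := @hrun_sweep R mem0 (clr_acts d) (fun=> mem0) w rs (set_nth 0 rs d 0) out Hw szr.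
have E : size (set_nth 0 rs d 0) = R by rewrite size_set_nth szr; apply/maxn_idPr.
move=> /(_ E); rewrite /= ltnS ltd => /(_ isT erefl) H m a b.
have [|m' [a' [b' [r _]]]] := H _ m a b; last by exists m', a', b'; split; first exact: r.
by move=> p _; rewrite -set_nth_blk ?szr.
Qed.

(** A unary counter grows by setting its first unset bit; the write-once flag prevents a second
    change. *)
Definition inc_acts d : seq act_t := [:: (d.+1, fun m s =>
  if ~~ m.1.1 && (s == Bit false) then ((true, m.1.2, m.2), Bit true) else (m, s))].
Definition inc R d := sweep R.+1 mem0 (inc_acts d).

Lemma hrun_inc R d : d < R -> exists K, forall w rs out, wok w -> size rs = R ->
  nth 0 rs d < size w ->
  hrun (inc R d) w rs out (K * (size w).+1) (set_nth 0 rs d (nth 0 rs d).+1) out (fun=> True).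
Proof.
move=> ltd; eexists=> w rs out Hw szr ltr.
set rs' := set_nth _ _ _ _.
have := @hrun_sweep R mem0 (inc_acts d) (fun p => (nth 0 rs d < p, false, Blank)) w rs rs' out Hw szr.
have E : size rs' = R by rewrite size_set_nth szr; apply/maxn_idPr.
move=> /(_ E); rewrite /= ltnS ltd => /(_ isT erefl) H m a b.
have [|m' [a' [b' [r _]]]] := H _ m a b; last by exists m', a', b'; split; first exact: r.
move=> p _; have := @nth_blk w rs p d; rewrite szr => /(_ ltd) /= ->.
have -> : (~~ (nth 0 rs d < p) && (Bit (p < nth 0 rs d) == Bit false)) = (p == nth 0 rs d).
  by case: ltngtP.
case: eqP => [->|/eqP ne] /=.
  by rewrite ltnSn -set_nth_blk ?szr //= ltnSn.
rewrite -set_nth_blk ?szr // (_ : (p < (nth 0 rs d).+1) = (p < nth 0 rs d)); last lia.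
by rewrite (_ : (nth 0 rs d < p.+1) = (nth 0 rs d < p)) //; lia.
Qed.

Lemma apply_acts_read o1 o2 (g1 g2 : cmem -> sym -> cmem) m u : o1 < size u -> o2 < size u ->
  apply_acts m u [:: (o1, fun m s => (g1 m s, s)); (o2, fun m s => (g2 m s, s))]
  = (g2 (g1 m (nth Blank u o1)) (nth Blank u o2), u).
Proof. by move=> H1 H2; rewrite /apply_acts /fst /snd set_nth_id // set_nth_id. Qed.

(** One counter is smaller than another exactly when some block carries the bit of the second but
    not of the first. The bit of [i] is parked in the remembered symbol until that of [j] is
    reached. *)
Definition lt_acts i j : seq act_t :=
  [:: (i.+1, fun m s => ((m.1.1, m.1.2, s), s));
      (j.+1, fun m s => ((m.1.1, m.1.2 || (m.2 == Bit false) && (s == Bit true), Blank), s))].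
Definition lt_test R i j := sweep R.+1 mem0 (lt_acts i j).

Lemma hrun_lt R i j : i < R -> j < R -> exists K, forall w rs out, wok w -> size rs = R ->
  nth 0 rs j <= size w ->
  hrun (lt_test R i j) w rs out (K * (size w).+1) rs out
    (fun m => m.1.2 = (nth 0 rs i < nth 0 rs j)).
Proof.
move=> lti ltj; eexists=> w rs out Hw szr ler m a b.
have Hacts : all (fun a => a.1 < R.+1) (lt_acts i j) by rewrite /= !ltnS lti ltj.
(* After [p] blocks, the flag compares register [i] with the part of register [j] seen so far. *)
pose mu p : cmem := (false, nth 0 rs i < minn p (nth 0 rs j), Blank).
have mu0 : mu 0 = mem0 by rewrite /mu min0n.
have Hstep p : p < size w -> apply_acts (mu p) (blk w rs p) (lt_acts i j) = (mu p.+1, blk w rs p).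
  move=> _; have Hs k : k < R -> k.+1 < size (blk w rs p) by rewrite /= size_map szr.
  rewrite apply_acts_read ?Hs // !nth_blk ?szr // /mu [RHS]/= /=; congr ((_, _, _), _).
  have -> b0 : (Bit b0 == Bit false) = ~~ b0 by case: b0.
  have -> b0 : (Bit b0 == Bit true) = b0 by case: b0.
  lia.
have [m' [a' [b' [r E]]]] := hrun_sweep out Hw szr szr Hacts mu0 Hstep m a b.
by exists m', a', b'; split; [exact: r | rewrite E /= (minn_idPr ler)].
Qed.

(** The block addressed by register [i] is the first one whose bit for [i] is unset; its symbol has
    been remembered on entering the block. *)
Definition sym_acts (P : pred sym) i : seq act_t :=
  [:: (0, fun m s => ((m.1.1, m.1.2, s), s));
      (i.+1, fun m s => (if ~~ m.1.1 && (s == Bit false) then (true, P m.2, Blank)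
                         else (m.1.1, m.1.2, Blank), s))].
Definition sym_test R P i := sweep R.+1 mem0 (sym_acts P i).

(** If the register has reached [size w], no block is selected and the flag stays false;
    [~~ P Blank] makes this agree with the default of [nth]. Loops detect the end of the input in
    this way. *)
Lemma hrun_sym R (P : pred sym) i : i < R -> ~~ P Blank ->
  exists K, forall w rs out, wok w -> size rs = R ->
  hrun (sym_test R P i) w rs out (K * (size w).+1) rs out
    (fun m => m.1.2 = P (nth Blank w (nth 0 rs i))).
Proof.
move=> lti nb0; eexists=> w rs out Hw szr m a b.
have Hacts : all (fun a => a.1 < R.+1) (sym_acts P i) by rewrite /= ltnS lti.
pose x := nth 0 rs i.
pose mu p : cmem := (x < p, (x < p) && P (nth Blank w x), Blank).
have Hstep p : p < size w -> apply_acts (mu p) (blk w rs p) (sym_acts P i) = (mu p.+1, blk w rs p).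
  move=> _; have Hs k : k < R -> k.+1 < size (blk w rs p) by rewrite /= size_map szr.
  rewrite apply_acts_read ?Hs // nth_blk ?szr // /mu -/x /=.
  have -> : (~~ (x < p) && (Bit (p < x) == Bit false)) = (p == x) by case: ltngtP.
  case: eqP => [->|ne]; first by rewrite ltnSn.
  by rewrite (_ : (x < p.+1) = (x < p)) //; lia.
have [m' [a' [b' [r E]]]] := hrun_sweep out Hw szr szr Hacts erefl Hstep m a b.
exists m', a', b'; split; [exact: r | rewrite E /= -/x].
by case: ltnP => //= lex; rewrite nth_default // (negbTE nb0).
Qed.

(** * Writing the output and preparing the tape *)

Lemma run_backL m l u c v : all nblk u -> head Blank l = Blank ->
  run (Seq mvL (While nb mvL)) m (tp (rev u ++ l) (c :: v)) (3 * size u + 2) m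
    (tp (behead l) (Blank :: u ++ c :: v)).
Proof.
move=> + Hl; case/lastP: u => [|u a]; rewrite ?all_rcons.
  move=> _; apply: (@run_le _ _ _ (1 + 1)) => //; apply: run_seq; first exact: run_mvL.
  by rewrite /= Hl; apply: run_whileF.
case/andP=> Ha Hu; rewrite rev_rcons size_rcons cat_rcons.
apply: (@run_le _ _ _ (1 + (3 * size u + 4))); first lia.
by apply: run_seq; [exact: run_mvL | exact: run_skipL].
Qed.

Definition skip_right := Seq (While nb mvR) mvR.

Lemma run_skip_right m l u v : all nblk u ->
  run skip_right m (tp l (u ++ Blank :: v)) (3 * size u + 2) m (tp (Blank :: rev u ++ l) v).
Proof.
move=> Hu; rewrite (_ : 3 * size u + 2 = (3 * size u + 1) + 1); last lia.
by apply: run_seq; [exact: run_skipR | exact: run_mvR].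
Qed.

Definition emit s :=
  Seq skip_right (Seq (While nb mvR) (Seq (put s) (Seq (Seq mvL (While nb mvL)) go_home))).

Lemma hrun_emit R s : nblk s -> exists K, forall w rs out, wok w -> size rs = R -> all nblk out ->
  hrun (emit s) w rs out (K * (size w + size out).+1) rs (rcons out s) (fun=> True).
Proof.
move=> Hs; exists (6 * R.+1 + 20) => w rs out Hw szr Hout m a b.
have Hreg := region_nb rs Hw.
exists m, a.-1.+1, b.-1; split=> //.
apply: (@run_le _ _ _ ((3 * size (region w rs) + 2) + ((3 * size out + 1) +
   (1 + ((3 * size out + 2) + (3 * size (region w rs) + 5)))))).
  by rewrite size_region szr; nia.
apply: run_seq; first exact: run_skip_right.
apply: run_seq; first by apply: run_skipR; rewrite ?head_nseq.
apply: run_seq; first exact: run_put.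
apply: run_seq; first exact: run_backL.
rewrite /= behead_nseq /home cat_rcons; apply: run_go_home => //.
exact: region_neq0.
Qed.


Lemma tape_output_tp l out b : all nblk out ->
  tape_output (tp l (out ++ nseq b Blank)) = out.
Proof.
have H u : all nblk u -> take (find (pred1 Blank) (u ++ nseq b Blank)) (u ++ nseq b Blank) = u.
  elim: u => [|c u IH] /=; first by case: b.
  by case/andP=> /negbTE Hc /IH; rewrite Hc /= => ->.
case: out => [|c u] Hu; [by case: (b) | exact: (H (c :: u))].
Qed.

Lemma run_finish m w rs out a b : wok w -> all nblk out ->
  exists m' t', run skip_right m (home w rs out a b) (3 * (size w * (size rs).+1) + 2) m' t'
   /\ tape_output t' = out.
Proof.
move=> Hw Hout; exists m; eexists; split; first by rewrite -size_region; apply/run_skip_right/region_nb.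
exact: tape_output_tp.
Qed.

Lemma region_zero w R : region w (nseq R 0) = flatten [seq s :: nseq R (Bit false) | s <- w].
Proof.
have -> : region w (nseq R 0) = flatten [seq nth Blank w p :: nseq R (Bit false) | p <- iota 0 (size w)].
  by congr flatten; apply: eq_map => p; rewrite /blk map_nseq.
by rewrite -[in RHS](mkseq_nth Blank w) /mkseq -map_comp.
Qed.

Definition stash : cmem -> sym -> cmem * sym := fun _ s => ((false, false, s), Blank).
Definition unstash : cmem -> sym -> cmem * sym := fun m _ => (m, m.2).

(** Written from right to left because the converted part of the tape grows leftwards; the symbol
    itself waits in the memory. *)
Definition write_block R := Seq (rep R (Seq (put (Bit false)) mvL)) (Act (fun m s => (unstash m s, Stay))).

Lemma run_write_block R m a v : exists a',
  run (write_block R) m (tp (nseq a Blank) (Blank :: v)) (2 * R + 2) m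
    (tp (nseq a' Blank) (m.2 :: nseq R (Bit false) ++ v)).
Proof.
have : exists a', run (rep R (Seq (put (Bit false)) mvL)) m (tp (nseq a Blank) (Blank :: v)) (2 * R + 1) m
    (tp (nseq a' Blank) (Blank :: nseq R (Bit false) ++ v)).
  elim: R a v => [|R IH] a v; first by exists a; apply: run_skip.
  have [a' r] := IH a.-1 (Bit false :: v); exists a'.
  rewrite (_ : 2 * R.+1 + 1 = (1 + 1) + (2 * R + 1)); last lia.
  apply: run_seq; first by apply: run_seq; [exact: run_put | exact: run_mvL].
  rewrite head_nseq behead_nseq; move: r.
  by have -> : nseq R.+1 (Bit false) ++ v = nseq R (Bit false) ++ Bit false :: v
    by rewrite -cat_rcons; congr cat; elim: (R) => //= j ->.
case=> a' r; exists a'; rewrite (_ : 2 * R + 2 = 2 * R + 1 + 1); last lia.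
by apply: run_seq r _; exact: (run_act unstash).
Qed.

Definition take_last := Seq (While nb mvR) (Seq mvL (Act (fun m s => (stash m s, Stay)))).

Definition move_block R := Seq take_last (Seq (Seq mvL (While nb mvL))
  (Seq (Seq mvL (While nb mvL)) (Seq (write_block R) skip_right))).

(* Input symbols are consumed from the right end and turned into blocks that grow to the left,
   so both halves stay delimited by blanks. *)
Definition prelude R := Seq mvL (Seq skip_right (Seq (While nb (move_block R)) (Seq mvL go_home))).

Lemma run_move_block R m w1 s w2 a b : all nblk (rcons w1 s) -> all nblk w2 ->
  let reg w := flatten [seq s :: nseq R (Bit false) | s <- w] in
  exists m' a' b', run (move_block R) m
    (tp (Blank :: rev (reg w2) ++ nseq a Blank) (rcons w1 s ++ nseq b Blank))
    (20 * R.+1 * (size w1 + size w2).+2) m'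
    (tp (Blank :: rev (reg (s :: w2)) ++ nseq a' Blank) (w1 ++ nseq b' Blank)).
Proof.
move=> Hw1 Hw2 reg; have [Hs Hw1'] : nblk s /\ all nblk w1 by move: Hw1; rewrite all_rcons => /andP[].
have nbreg w : all nblk w -> all nblk (reg w).
  move=> /allP Hw; apply/allP=> x /flatten_mapP[y /Hw Hy]; rewrite inE => /predU1P[->|] //.
  by rewrite mem_nseq => /andP[_ /eqP->].
have szreg w : size (reg w) = R.+1 * size w.
  elim: w => [|x w IH] /=; first by rewrite muln0.
  by rewrite size_cat size_nseq IH mulnS addSn.
have [a' rb] := run_write_block R (false, false, s) a.-1 (reg w2 ++ Blank :: w1 ++ Blank :: nseq b.-1.+1 Blank).
exists (false, false, s), a', b.-1.+2.
apply: (@run_le _ _ _ (((3 * size (rcons w1 s) + 1) + (1 + 1)) + ((3 * size w1 + 2) +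
   ((3 * size (reg w2) + 2) + ((2 * R + 2) + (3 * size (reg (s :: w2)) + 2)))))).
  by rewrite !szreg size_rcons /=; nia.
apply: run_seq.
  apply: run_seq; first by apply: run_skipR; rewrite ?head_nseq.
  rewrite rev_rcons.
  apply: (@run_seq _ _ _ _ _ m (tp (rev w1 ++ Blank :: rev (reg w2) ++ nseq a Blank) (s :: nseq b.-1.+1 Blank))).
    by case: (b) => [|b']; [exact: run_mvL_end | exact: run_mvL].
  exact: (run_act stash).
apply: run_seq; first exact: run_backL.
apply: run_seq; first by apply: run_backL; rewrite ?nbreg ?head_nseq.
rewrite behead_nseq; apply: run_seq rb _.
have -> : s :: nseq R (Bit false) ++ reg w2 ++ Blank :: w1 ++ Blank :: nseq b.-1.+1 Blank
  = reg (s :: w2) ++ Blank :: w1 ++ nseq b.-1.+2 Blank by rewrite /= -!catA.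
by apply: run_skip_right; apply: nbreg; rewrite /= Hs.
Qed.

(** Quadratic, because every input symbol is carried across the whole tape. *)
Lemma run_prelude R : exists K, forall m w, wok w -> exists m' a b,
  run (prelude R) m (tp [::] w) (K * (size w).+1 ^ 2) m' (home w (nseq R 0) [::] a b).
Proof.
exists (20 * R.+1 + 20) => m w Hw; pose reg w := flatten [seq s :: nseq R (Bit false) | s <- w].
have [nbw w0] := andP Hw.
(* [w1] is the input still to be converted, [w2] the part already turned into blocks. *)
have loopP : forall w1 w2 m a b, all nblk w1 -> all nblk w2 -> exists m' a' b',
    run (While nb (move_block R)) m
      (tp (Blank :: rev (reg w2) ++ nseq a Blank) (w1 ++ nseq b Blank))
      (size w1 * (20 * R.+1 * (size w1 + size w2).+1 + 2) + 1) m'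
      (tp (Blank :: rev (reg (w1 ++ w2)) ++ nseq a' Blank) (nseq b' Blank)).
  elim/last_ind => [|w1 s IH] w2 {}m a b Hw1 Hw2.
    by exists m, a, b; apply: run_whileF; rewrite /= head_nseq.
  have [m1 [a1 [b1 r1]]] := run_move_block R m a b Hw1 Hw2.
  have [Hs Hw1'] : nblk s /\ all nblk w1 by move: Hw1; rewrite all_rcons => /andP[].
  have [|m2 [a2 [b2 r2]]] := IH (s :: w2) m1 a1 b1 Hw1'; first by rewrite /= Hs.
  exists m2, a2, b2; rewrite size_rcons [rcons w1 s ++ w2]cat_rcons.
  apply: run_le (run_whileT _ r1 r2); last first.
    by rewrite -cats1 -catA; case: (w1) Hw1' => [|c u] //= /andP[].
  by rewrite /= addnS addSn; nia.
have [m' [a [b r]]] := loopP w [::] m 0 0 nbw isT.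
exists m', a.-1.+1, b.-1.+1; rewrite cats0 in r.
have Er : region w (nseq R 0) = reg w by rewrite region_zero.
have szr : size (reg w) = R.+1 * size w by rewrite -Er size_region size_nseq mulnC.
apply: (@run_le _ _ _ (1 + (2 + ((size w * (20 * R.+1 * (size w).+1 + 2) + 1) +
   (1 + (3 * size (reg w) + 5)))))).
  by rewrite szr; nia.
apply: run_seq.
  by case: (w) w0 => // c u _; apply: run_mvL.
apply: run_seq; first exact: (@run_skip_right _ _ [::]).
rewrite cats0 addn0 in r; apply: run_seq; first exact: r.
apply: (@run_seq _ _ _ _ _ m' (tp (rev (reg w) ++ nseq a Blank) (Blank :: nseq b.-1.+1 Blank))).
  by case: (b) => [|b']; [exact: run_mvL_end | exact: run_mvL].
by rewrite /home Er; apply: run_go_home => //; rewrite -Er ?region_nb ?region_neq0.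
Qed.

(** * Functions computable by counting loops *)

(** The normal form [a * z.+1 ^ c] is monotone and absorbs sums and products, so program
    specifications only carry two constants. *)
Definition poly (T : nat -> nat) := exists a c, forall z, T z <= a * z.+1 ^ c.

Lemma poly_const a : poly (fun=> a).
Proof. by exists a, 0 => z; rewrite muln1. Qed.

Lemma poly_pow a c : poly (fun z => a * z.+1 ^ c).
Proof. by exists a, c. Qed.

Lemma poly_lin a : poly (fun z => a * z.+1).
Proof. by exists a, 1 => z; rewrite expn1. Qed.

Lemma poly_id : poly id.
Proof. by exists 1, 1 => z; rewrite expn1 mul1n. Qed.

Lemma polyD T1 T2 : poly T1 -> poly T2 -> poly (fun z => T1 z + T2 z).
Proof.
move=> [a1 [c1 H1]] [a2 [c2 H2]]; exists (a1 + a2), (c1 + c2) => z.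
rewrite mulnDl leq_add //.
  by apply: leq_trans (H1 z) _; rewrite leq_mul2l leq_pexp2l ?leq_addr ?orbT.
by apply: leq_trans (H2 z) _; rewrite leq_mul2l leq_pexp2l ?leq_addl ?orbT.
Qed.

Lemma polyM T1 T2 : poly T1 -> poly T2 -> poly (fun z => T1 z * T2 z).
Proof.
move=> [a1 [c1 H1]] [a2 [c2 H2]]; exists (a1 * a2), (c1 + c2) => z.
by rewrite expnD mulnACA leq_mul.
Qed.

Lemma polyS T : poly T -> poly (fun z => (T z).+1).
Proof.
move=> [a [c H]]; exists a.+1, c => z.
by rewrite mulSn -add1n leq_add // expn_gt0.
Qed.

Ltac pol := repeat first
  [ exact: poly_pow | exact: poly_lin | exact: poly_id | exact: poly_const
  | apply: polyD | apply: polyS | apply: polyM ].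

Lemma pow_mono a c z z' : z <= z' -> a * z.+1 ^ c <= a * z'.+1 ^ c.
Proof. by move=> le; rewrite leq_mul2l; case: c => [|c]; rewrite ?orbT // leq_exp2r // ltnS le orbT. Qed.

Lemma nth_mid d pre v (junk : seq nat) : size pre = d -> nth 0 (pre ++ v :: junk) d = v.
Proof. by move=> <-; rewrite nth_cat ltnn subnn. Qed.

Lemma nth_mid1 d pre v v1 (junk : seq nat) : size pre = d ->
  nth 0 (pre ++ v :: v1 :: junk) d.+1 = v1.
Proof. by rewrite -cat_rcons => E; rewrite nth_mid // size_rcons E. Qed.

Lemma set_nth_mid d pre v v' (junk : seq nat) : size pre = d ->
  set_nth 0 (pre ++ v :: junk) d v' = pre ++ v' :: junk.
Proof. by move=> <-; elim: pre => //= x pre ->. Qed.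

Definition copy R d i := Seq (clr R d) (loop (lt_test R d i) (inc R d)).

Lemma hrun_copy R d i : d < R -> i < R -> i != d -> exists a c, forall w rs out, wok w ->
  size rs = R -> nth 0 rs i <= size w ->
  hrun (copy R d i) w rs out (a * (size w + size out).+1 ^ c)
    (set_nth 0 rs d (nth 0 rs i)) out (fun=> True).
Proof.
move=> ltd lti ne; have [K1 H1] := hrun_clr ltd; have [K2 H2] := hrun_inc ltd.
have [K3 H3] := hrun_lt ltd lti.
have [a [c Hac]] : poly (fun z => K1 * z.+1 + z.+1 * ((K2 + K3) * z.+1 + (K2 + K3) * z.+1 + 2)).
  by pol.
exists a, c => w rs out Hw szr le.
set N := nth 0 rs i in le *.
have szs v : size (set_nth 0 rs d v) = R by rewrite size_set_nth szr; apply/maxn_idPr.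
have Ei v : nth 0 (set_nth 0 rs d v) i = N by rewrite nth_set_nth /= (negbTE ne).
have Ed v : nth 0 (set_nth 0 rs d v) d = v by rewrite nth_set_nth /= eqxx.
pose I j rs' out' := rs' = set_nth 0 rs d j /\ out' = out.
have := @hrun_loop (lt_test R d i) (inc R d) w N ((K2 + K3) * (size w).+1) I (set_nth 0 rs d 0) out.
case=> [j rs' out' lej [-> ->]|j rs' out' ltj [-> ->]| |rs' [out' [[-> ->] Hl]]] //.
- have := H3 w (set_nth 0 rs d j) out Hw (szs _); rewrite Ei Ed => /(_ le).
  by apply: hrun_le; rewrite leq_mul2r leq_addl orbT.
- exists (set_nth 0 rs d j.+1), out; split=> //.
  have := H2 w (set_nth 0 rs d j) out Hw (szs _); rewrite Ed set_set_nth eqxx.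
  move=> /(_ (leq_trans ltj le)).
  by apply: hrun_le; rewrite leq_mul2r leq_addr orbT.
apply: hrun_le (hrun_seq (H1 w rs out Hw szr) Hl).
apply: leq_trans (Hac (size w + size out)).
by rewrite leq_add // ?leq_mul ?leq_add ?leq_mul // ltnS ?(leq_trans le) ?leq_addr.
Qed.

Lemma wok_enc G k : wok (enc_instance G k).
Proof.
rewrite /wok /enc_instance size_cat /= addnS andbT all_cat /= all_cat /=.
have H s : all nblk (map Bit s) by elim: s.
by rewrite !H.
Qed.

(* A world describes what is known about the registers: in the logical environment [x],
   satisfying [wD x], the first [wb] registers hold [wrho x], and the input encodes [wJ x]. *)
Record world := World {
  wX : Type;
  wD : wX -> Prop;
  wJ : wX -> sgraph * nat;
  wb : nat;
  wrho : wX -> seq nat;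
  wS : forall x, wD x -> size (wrho x) = wb }.

Definition word (J : sgraph * nat) := enc_instance J.1 J.2.
Definition wN (J : sgraph * nat) := size (word J).

(** The first [d] registers [pre] are protected and begin with the known ones; [junk] may be
    overwritten. No register exceeds [wN], the largest value that unary storage along the tape can
    hold. *)
Definition state (W : world) d R (x : wX W) pre junk :=
  [/\ wD x, take (wb W) pre = wrho x, size pre = d, size (pre ++ junk) = R &
      all (fun v => v <= wN (wJ x)) (pre ++ junk)].

Definition computes (W : world) d R P a c (f : wX W -> nat) :=
  forall (x : wX W) pre junk out, state d R x pre junk -> all nblk out ->
  exists2 junk', state d R x pre (f x :: junk') &
    hrun P (word (wJ x)) (pre ++ junk) out (a * (wN (wJ x) + size out).+1 ^ c)
      (pre ++ f x :: junk') out (fun=> True).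

(* The result is delivered in register [d], for every [d] beyond the known registers, so that
   code can be reused below further temporaries; the number [R] of registers is only bounded
   from below because it is fixed once, for the whole machine. *)
Definition computable (W : world) (f : wX W -> nat) :=
  (forall x, wD x -> f x <= wN (wJ x)) /\
  forall d, wb W <= d -> exists m, forall R, m <= R -> exists P a c, computes d R P a c f.

(** Time is measured against the output at the end of the run, since each emission walks over what
    has been written so far. *)
Definition emits (W : world) d R P a c (o : wX W -> seq sym) :=
  forall (x : wX W) pre junk out, state d R x pre junk -> all nblk out ->
  exists2 junk', state d R x pre junk' &
    hrun P (word (wJ x)) (pre ++ junk) out (a * (wN (wJ x) + size (out ++ o x)).+1 ^ c)
      (pre ++ junk') (out ++ o x) (fun=> True).

Definition compo (W : world) (o : wX W -> seq sym) :=
  (forall x, wD x -> all nblk (o x)) /\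
  forall d, wb W <= d -> exists m, forall R, m <= R -> exists P a c, emits d R P a c o.

Lemma comp_ext W (f g : wX W -> nat) : (forall x, wD x -> f x = g x) -> computable f -> computable g.
Proof.
move=> E [Hb Hc]; split=> [x Dx|d led]; first by rewrite -E // Hb.
have [m Hm] := Hc d led; exists m => R /Hm [P [a [c H]]]; exists P, a, c => x pre junk out S.
by have [Dx _ _ _ _] := S; rewrite -E //; apply: H.
Qed.

Lemma compo_ext W (f g : wX W -> seq sym) : (forall x, wD x -> f x = g x) -> compo f -> compo g.
Proof.
move=> E [Hb Hc]; split=> [x Dx|d led]; first by rewrite -E // Hb.
have [m Hm] := Hc d led; exists m => R /Hm [P [a [c H]]]; exists P, a, c => x pre junk out S.
by have [Dx _ _ _ _] := S; rewrite -E //; apply: H.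
Qed.

Lemma state_set W d R (x : wX W) pre v junk v' : state d R x pre (v :: junk) ->
  v' <= wN (wJ x) -> state d R x pre (v' :: junk).
Proof.
case=> Dx Ht szp szr; rewrite all_cat /= => /and3P[H1 _ H2] le.
by split=> //; [rewrite -szr !size_cat | rewrite all_cat /= H1 le].
Qed.

Lemma state_junk W d R (x : wX W) pre junk : d < R -> state d R x pre junk ->
  exists v junk', junk = v :: junk'.
Proof.
move=> ltd [_ _ szp szr _]; case: junk szr => [|v j]; last by exists v, j.
by rewrite cats0; lia.
Qed.

Lemma state_push W d R (x : wX W) pre v junk : state d R x pre (v :: junk) -> wb W <= d ->
  state d.+1 R x (rcons pre v) junk.
Proof.
case=> Dx Ht szp szr Ha led.
split=> //; rewrite ?cat_rcons ?size_rcons ?szp // -cats1 takel_cat //.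
by rewrite szp.
Qed.

Lemma state_pop W d R (x : wX W) pre v junk : state d.+1 R x (rcons pre v) junk -> wb W <= d ->
  state d R x pre (v :: junk).
Proof.
case=> Dx; rewrite -cats1 -catA /= size_cat /= addn1 => Ht [szp] szr Ha led.
by split=> //; rewrite -Ht takel_cat // szp.
Qed.

Lemma comp_zero W : computable (fun _ : wX W => 0).
Proof.
split=> // d led; exists d.+1 => R ltd; have [K H] := hrun_clr ltd.
exists (clr R d), K, 1 => x pre junk out S Ho.
have [v [j E]] := state_junk ltd S; rewrite E in S *.
exists j; first exact: state_set S _.
have [_ _ szp szr _] := S.
have := H (word (wJ x)) (pre ++ v :: j) out (wok_enc _ _) szr.
by rewrite (set_nth_mid _ _ _ szp) expn1; apply: hrun_le; rewrite leq_mul // ltnS leq_addr.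
Qed.

Lemma comp_succ W f : computable f -> (forall x, wD x -> f x < wN (wJ x)) ->
  computable (fun x : wX W => (f x).+1).
Proof.
move=> [_ Hf] lt; split=> // d led; have [m Hm] := Hf d led.
exists (maxn m d.+1) => R; rewrite geq_max => /andP[/Hm [P [a [c HP]]] ltd].
have [K HK] := hrun_inc ltd.
have [a' [c' Hac]] : poly (fun z => a * z.+1 ^ c + K * z.+1) by pol.
exists (Seq P (inc R d)), a', c' => x pre junk out S Ho.
have [j S1 H1] := HP x pre junk out S Ho; exists j.
  by apply: state_set S1 _; apply: lt; case: S.
have [Dx _ szp szr _] := S1.
have := HK (word (wJ x)) (pre ++ f x :: j) out (wok_enc _ _) szr.
rewrite (nth_mid _ _ szp) (set_nth_mid _ _ _ szp) => /(_ (lt x Dx)) H2.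
apply: hrun_le (hrun_seq H1 H2); apply: leq_trans (Hac _).
by rewrite leq_add // leq_mul // ltnS leq_addr.
Qed.

Definition setbit R d := If flag (Seq (clr R d) (inc R d)) (clr R d).

Lemma hrun_setbit R d : d < R -> exists K, forall t w rs out T b, wok w -> size rs = R ->
  hrun t w rs out T rs out (fun m => m.1.2 = b) ->
  hrun (Seq t (setbit R d)) w rs out (T + K * (size w).+1) (set_nth 0 rs d (nat_of_bool b)) out (fun=> True).
Proof.
move=> ltd; have [K1 H1] := hrun_clr ltd; have [K2 H2] := hrun_inc ltd.
exists (K1 + K2 + 2) => t w rs out T [] Hw szr Ht.
  apply: hrun_le (hrun_ifT _ Ht (hrun_seq (H1 w rs out Hw szr) _)); last first.
    have := H2 w (set_nth 0 rs d 0) out Hw.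
    rewrite nth_set_nth /= eqxx set_set_nth eqxx; apply; last by case/andP: Hw.
    by rewrite size_set_nth szr; apply/maxn_idPr.
  by rewrite leq_add2l; nia.
apply: hrun_le (hrun_ifF _ Ht (H1 w rs out Hw szr)).
by rewrite leq_add2l; nia.
Qed.

Lemma wN_gt0 J : 0 < wN J. Proof. by have /andP[] := wok_enc J.1 J.2. Qed.

Lemma comp_lt W f g : computable f -> computable g -> computable (fun x : wX W => (f x < g x : nat)).
Proof.
move=> [_ Hf] [_ Hg]; split=> [x _|d led].
  by case: (_ < _); rewrite ?wN_gt0.
have [mf Hmf] := Hf d led; have [mg Hmg] := Hg d.+1 (leqW led).
exists (maxn (maxn mf mg) d.+2) => R; rewrite !geq_max.
move=> /andP[/andP[/Hmf [P [a [c HP]]] /Hmg [Q [a1 [c1 HQ]]]] ltd].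
have ltd' : d < R by apply: ltnW.
have [K HK] := hrun_setbit ltd'; have [K1 HK1] := hrun_lt ltd' ltd.
have [a' [c' Hac]] : poly (fun z => a * z.+1 ^ c + (a1 * z.+1 ^ c1 + (K1 * z.+1 + K * z.+1))) by pol.
exists (Seq P (Seq Q (Seq (lt_test R d d.+1) (setbit R d)))), a', c' => x pre junk out S Ho.
have [j S1 H1] := HP x pre junk out S Ho.
have [j2 S2 H2] := HQ x (rcons pre (f x)) j out (state_push S1 led) Ho.
have S3 := state_pop S2 led; exists (g x :: j2).
  by apply: state_set S3 _; case: (_ < _); rewrite ?wN_gt0.
have [_ _ szp szr Ha] := S3.
rewrite !cat_rcons in H2.
have lg : g x <= size (word (wJ x)) by move: Ha; rewrite all_cat /= => /and4P[].
have := HK1 (word (wJ x)) _ out (wok_enc _ _) szr.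
rewrite (nth_mid _ _ szp) (nth_mid1 _ _ _ szp) => /(_ lg) H3.
have := HK _ _ _ out _ _ (wok_enc _ _) szr H3.
rewrite (set_nth_mid _ _ _ szp) => H4.
apply: hrun_le (hrun_seq H1 (hrun_seq H2 H4)); apply: leq_trans (Hac _).
by rewrite !leq_add // leq_mul // ltnS leq_addr.
Qed.

Lemma comp_sym W (P : pred sym) f : ~~ P Blank -> computable f ->
  computable (fun x : wX W => (P (nth Blank (word (wJ x)) (f x)) : nat)).
Proof.
move=> nP [_ Hf]; split=> [x _|d led].
  by case: (P _); rewrite ?wN_gt0.
have [mf Hmf] := Hf d led.
exists (maxn mf d.+1) => R; rewrite geq_max => /andP[/Hmf [Q [a [c HQ]]] ltd].
have [K HK] := hrun_setbit ltd; have [K1 HK1] := hrun_sym ltd nP.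
have [a' [c' Hac]] : poly (fun z => a * z.+1 ^ c + (K1 * z.+1 + K * z.+1)) by pol.
exists (Seq Q (Seq (sym_test R P d) (setbit R d))), a', c' => x pre junk out S Ho.
have [j S1 H1] := HQ x pre junk out S Ho; exists j.
  by apply: state_set S1 _; case: (P _); rewrite ?wN_gt0.
have [_ _ szp szr Ha] := S1.
have := HK1 (word (wJ x)) _ out (wok_enc _ _) szr.
rewrite (nth_mid _ _ szp) => H3.
have := HK _ _ _ out _ _ (wok_enc _ _) szr H3.
rewrite (set_nth_mid _ _ _ szp) => H4.
apply: hrun_le (hrun_seq H1 H4); apply: leq_trans (Hac _).
by rewrite !leq_add // leq_mul // ltnS leq_addr.
Qed.

Lemma comp_nth W i : i < wb W -> (forall x : wX W, wD x -> nth 0 (wrho x) i <= wN (wJ x)) ->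
  computable (fun x : wX W => nth 0 (wrho x) i).
Proof.
move=> lti Hle; split=> // d led; exists d.+1 => R ltd.
have ne : i != d by rewrite ltn_eqF // (leq_trans lti led).
have ltiR : i < R by apply: leq_ltn_trans ltd; apply: leq_trans led; apply: ltnW.
have [a [c H]] := hrun_copy ltd ltiR ne.
exists (copy R d i), a, c => x pre junk out S Ho.
have [v [j E]] := state_junk ltd S; rewrite E in S *; exists j.
  by apply: (state_set S); apply: Hle; case: S.
have [Dx Ht szp szr Ha] := S.
have Ei : nth 0 (pre ++ v :: j) i = nth 0 (wrho x) i.
  by rewrite nth_cat szp (leq_trans lti led) -Ht nth_take.
have := H (word (wJ x)) _ out (wok_enc _ _) szr.
by rewrite Ei (set_nth_mid _ _ _ szp); apply; apply: Hle.
Qed.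

(** Records a branch condition, so that the bounds needed inside a branch, as in [comp_succ], only
    have to hold where the branch is taken. *)
Definition restrict (W : world) (b : wX W -> bool) : world :=
  @World (wX W) (fun x => wD x /\ b x) (@wJ W) (wb W) (@wrho W)
    (fun x Dx => wS (proj1 Dx)).

Lemma comp_restrict W (b : wX W -> bool) (f : wX W -> nat) :
  computable f -> computable (W := restrict b) f.
Proof.
move=> [Hb Hc]; split=> [x [Dx _]|d led]; first exact: Hb.
have [m Hm] := Hc d led; exists m => R /Hm [P [a [c H]]]; exists P, a, c.
move=> x pre junk out [[Dx bx] ? ? ? ?] Ho.
have [|j [? ? ? ? ?] Hj] := H x pre junk out _ Ho; first by split.
by exists j.
Qed.

Definition decides (W : world) d R t a c (b : wX W -> bool) :=
  forall (x : wX W) pre junk out, state d R x pre junk -> all nblk out ->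
  exists2 junk', state d R x pre junk' &
    hrun t (word (wJ x)) (pre ++ junk) out (a * (wN (wJ x) + size out).+1 ^ c)
      (pre ++ junk') out (fun m => m.1.2 = b x).

Lemma comp_decides W (b : wX W -> bool) : computable (fun x => (b x : nat)) ->
  forall d, wb W <= d -> exists m, forall R, m <= R -> exists t a c, decides d R t a c b.
Proof.
move=> [_ Hf] d led; have [mf Hmf] := Hf d led.
exists (maxn mf d.+2) => R; rewrite geq_max => /andP[/Hmf [P [a [c HP]]] ltd].
have ltd' : d < R by apply: ltnW.
have [K HK] := hrun_clr ltd; have [K1 HK1] := hrun_lt ltd ltd'.
have [a' [c' Hac]] : poly (fun z => a * z.+1 ^ c + (K * z.+1 + K1 * z.+1)) by pol.
exists (Seq P (Seq (clr R d.+1) (lt_test R d.+1 d))), a', c' => x pre junk out S Ho.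
have [j S1 H1] := HP x pre junk out S Ho.
have S2 := state_push S1 led; have [v [j' Ej]] := state_junk ltd S2; rewrite Ej in S1 S2 H1.
have S3 := state_set S2 (leq0n _); have S4 := state_pop S3 led.
exists (nat_of_bool (b x) :: 0 :: j') => //.
have [_ _ szp szr Ha] := S4; have [_ _ szp' szr' _] := S2.
have := HK (word (wJ x)) _ out (wok_enc _ _) szr'.
rewrite (set_nth_mid _ _ _ szp') !cat_rcons => H2.
have := HK1 (word (wJ x)) _ out (wok_enc _ _) szr.
rewrite (nth_mid _ _ szp) (nth_mid1 _ _ _ szp).
have lb : (b x : nat) <= size (word (wJ x)) by move: Ha; rewrite all_cat /= => /and3P[].
have -> : (0 < b x) = b x by case: (b x).
move=> /(_ lb) H3; apply: hrun_le (hrun_seq H1 (hrun_seq H2 H3)); apply: leq_trans (Hac _).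
by rewrite !leq_add // leq_mul // ltnS leq_addr.
Qed.

Lemma comp_if W (b : wX W -> bool) (f g : wX W -> nat) : computable (fun x => (b x : nat)) ->
  computable (W := restrict b) f -> computable (W := restrict (fun x => ~~ b x)) g ->
  computable (fun x => if b x then f x else g x).
Proof.
move=> Hb [Hf1 Hf2] [Hg1 Hg2]; split=> [x Dx|d led].
  by case: ifPn => bx; [apply: Hf1 | apply: Hg1].
have [mb Hmb] := comp_decides Hb led.
have [mf Hmf] := Hf2 d led; have [mg Hmg] := Hg2 d led.
exists (maxn mb (maxn mf mg)) => R; rewrite !geq_max.
move=> /and3P[/Hmb [t [a [c Ht]]] /Hmf [P [a1 [c1 HP]]] /Hmg [Q [a2 [c2 HQ]]]].
have [a' [c' Hac]] : poly (fun z => a * z.+1 ^ c + (a1 * z.+1 ^ c1 + a2 * z.+1 ^ c2 + 2)) by pol.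
exists (Seq t (If flag P Q)), a', c' => x pre junk out S Ho.
have [j S1 H1] := Ht x pre junk out S Ho.
case bx: (b x) in H1 *.
- have [|j2 [[Dx _] ? ? ? ?] H2] := HP x pre j out _ Ho; first by case: S1 => *; split.
  exists j2; first by [].
  by apply: hrun_le (hrun_ifT _ H1 H2); apply: leq_trans (Hac _); rewrite leq_add2l -addn2 leq_add2r leq_addr.
have [|j2 [[Dx _] ? ? ? ?] H2] := HQ x pre j out _ Ho.
  by case: S1 => *; split=> //; split; rewrite //= bx.
exists j2; first by [].
by apply: hrun_le (hrun_ifF _ H1 H2); apply: leq_trans (Hac _); rewrite leq_add2l -addn2 leq_add2r leq_addl.
Qed.

(* Inside a loop, [y = (x, pad, i)]: the temporaries [pad] separate the registers of the
   enclosing world from the loop index [i] and the accumulator [A x i]. *)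
Definition loop_dom (W : world) q (A : wX W -> nat -> nat) (y : wX W * seq nat * nat) :=
  [/\ wD y.1.1, size y.1.2 = q, y.2 < wN (wJ y.1.1) & A y.1.1 y.2 <= wN (wJ y.1.1)].

Definition loop_rho (W : world) (A : wX W -> nat -> nat) (y : wX W * seq nat * nat) :=
  wrho y.1.1 ++ y.1.2 ++ [:: y.2; A y.1.1 y.2].

Lemma size_loop_rho W q A y : @loop_dom W q A y -> size (loop_rho A y) = wb W + q + 2.
Proof. by case=> /wS szr szq _ _; rewrite /loop_rho catA !size_cat szr szq. Qed.

Definition loopw (W : world) q (A : wX W -> nat -> nat) : world :=
  @World (wX W * seq nat * nat) (@loop_dom W q A) (fun y => wJ y.1.1) (wb W + q + 2)
    (@loop_rho W A) (@size_loop_rho W q A).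

Lemma loopw_prefix W q A (x : wX (@loopw W q A)) R d pre junk : wb W + q + 2 <= d ->
  state d R x pre junk -> state d R x.1.1 pre junk.
Proof.
move=> led [[Dx szq ltx lA] Ht szp sz Ha]; split=> //.
have -> : take (wb W) pre = take (wb W) (take (wb (loopw q A)) pre).
  by rewrite take_takel //= -addnA leq_addr.
by rewrite Ht /= /loop_rho -(wS Dx) take_size_cat.
Qed.

Lemma comp_lift W q A (f : wX W -> nat) : computable f ->
  computable (W := @loopw W q A) (fun y => f y.1.1).
Proof.
move=> [Hb Hc]; split=> [x [Dx *]|d led]; first exact: Hb.
have [|m Hm] := Hc d; first by apply: leq_trans led; rewrite /= -addnA leq_addr.
exists m => R /Hm [P [a [c H]]]; exists P, a, c => x pre junk out S Ho.
have [j S1 Hj] := H x.1.1 pre junk out (loopw_prefix led S) Ho.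
by exists j => //; case: S S1 => ? ? ? ? ? [].
Qed.

Lemma comp_idx W q A : computable (W := @loopw W q A) (fun y => y.2).
Proof.
have E (x : wX (loopw q A)) : wD x -> nth 0 (wrho x) (wb W + q) = x.2.
  move=> [/wS szr szq ltx lA] /=; rewrite /loop_rho.
  by rewrite catA nth_cat size_cat szr szq ltnn subnn.
apply: (comp_ext E); apply: comp_nth => [|x Dx] /=; first lia.
by rewrite E //; case: Dx => _ _ /ltnW.
Qed.

Lemma comp_acc W q A : computable (W := @loopw W q A) (fun y => A y.1.1 y.2).
Proof.
have E (x : wX (loopw q A)) : wD x -> nth 0 (wrho x) (wb W + q).+1 = A x.1.1 x.2.
  move=> [/wS szr szq ltx lA] /=; rewrite /loop_rho.
  by rewrite catA nth_cat size_cat szr szq ltnNge leqnSn /= subSnn.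
apply: (comp_ext E); apply: comp_nth => [|x Dx] /=; first lia.
by rewrite E //; case: Dx.
Qed.

Lemma state_loopw W d R A (x : wX W) pre i v junk : wb W <= d -> i < wN (wJ x) -> v = A x i ->
  state d R x pre (i :: v :: junk) ->
  state (W := loopw (d - wb W) A) d.+2 R (x, drop (wb W) pre, i) (pre ++ [:: i; v]) junk.
Proof.
move=> led lti -> S; have [Dx Ht szp szr Ha] := S; split.
- split=> //=; first by rewrite size_drop szp.
  by move: Ha; rewrite all_cat /= => /and4P[].
- rewrite /= /loop_rho /= catA -Ht cat_take_drop take_oversize // size_cat szp /=; lia.
- by rewrite size_cat szp /= addn2.
- by rewrite -catA.
- by rewrite -catA.
Qed.

Lemma word_idx J i : i <= wN J -> nblk (nth Blank (word J) i) = (i < wN J).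
Proof.
move=> lei; case: ltnP => [lti|gei]; last by rewrite nth_default.
by have /andP[/(all_nthP Blank) H _] := wok_enc J.1 J.2; apply: H.
Qed.

(** Register [d] holds the position, [d.+1] the accumulator [A x i], and the body delivers the next
    value in [d.+2], from where it is copied back. The loop ends when the position leaves the input,
    so [wN] itself need not be stored. The body is required for every [q] because the number of
    temporaries between the known registers and [d] is not known in advance. *)
Lemma comp_loop W (A : wX W -> nat -> nat) : computable (A^~ 0) ->
  (forall q, computable (W := loopw q A) (fun y => A y.1.1 y.2.+1)) ->
  computable (fun x => A x (wN (wJ x))).
Proof.
move=> [Hle0 H0] Hbody; split=> [x Dx|d led].
  (* Being computable includes being at most [wN]; iterating this bound for the body, with empty
     padding, bounds the accumulator. *)
  have HleA i : i <= wN (wJ x) -> A x i <= wN (wJ x).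
    elim: i => [|i IH] lti; first exact: Hle0.
    have [+ _] := Hbody 0; move=> /(_ (x, [::], i)); apply; split=> //=.
    by apply: IH; apply: ltnW.
  exact: HleA.
have [m0 Hm0] := H0 d.+1 (leqW led).
have [_ /(_ d.+2)] := Hbody (d - wb W); case=> [|m1 Hm1]; first by rewrite /=; lia.
exists (maxn (maxn m0 m1) d.+3) => R; rewrite !geq_max.
move=> /andP[/andP[/Hm0 [P0 [a0 [c0 HP0]]] /Hm1 [P1 [a1 [c1 HP1]]]] ltd].
have ltd2 : d.+1 < R by lia.
have ltd1 : d < R by lia.
have ne1 : d.+2 != d.+1 by lia.
have ne2 : d.+1 != d by lia.
have nbB : ~~ nblk Blank by [].
have [K1 HK1] := hrun_clr ltd1; have [K2 HK2] := hrun_sym ltd1 nbB.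
have [K3 HK3] := hrun_inc ltd1.
have [a4 [c4 HK4]] := hrun_copy ltd2 ltd ne1; have [a5 [c5 HK5]] := hrun_copy ltd1 ltd2 ne2.
pose T z := K2 * z.+1 + (a1 * z.+1 ^ c1 + (a4 * z.+1 ^ c4 + K3 * z.+1)).
have [a [c Hac]] : poly (fun z => K1 * z.+1 + (a0 * z.+1 ^ c0 +
    (z.+1 * (T z + T z + 2) + a5 * z.+1 ^ c5))) by rewrite /T; pol.
exists (Seq (clr R d) (Seq P0 (Seq (loop (sym_test R nblk d)
  (Seq P1 (Seq (copy R d.+1 d.+2) (inc R d)))) (copy R d d.+1)))), a, c.
move=> x pre junk out S Ho; have [v [j Ej]] := state_junk ltd1 S; rewrite {}Ej in S *.
have [Dx Ht szp szr Ha] := S.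
set w := word (wJ x); have Hw : wok w by apply: wok_enc.
have H1 := HK1 w _ out Hw szr; rewrite (set_nth_mid _ _ _ szp) in H1.
have S1 := state_push (state_set S (leq0n _)) led.
have [j2 S2 H2] := HP0 x _ _ out S1 Ho; have {}S2 := state_pop S2 led.
rewrite !cat_rcons in H2.
pose I i rs out' := out' = out /\ exists2 jk, rs = pre ++ i :: A x i :: jk &
   state d R x pre (i :: A x i :: jk).
have := @hrun_loop (sym_test R nblk d) (Seq P1 (Seq (copy R d.+1 d.+2) (inc R d))) w
  (wN (wJ x)) (T (wN (wJ x) + size out)) I (pre ++ [:: 0, A x 0 & j2]) out.
have lew : (size w).+1 <= (wN (wJ x) + size out).+1 by rewrite ltnS leq_addr.
case=> [i rs out' lei [-> [jk -> Sk]]|i rs out' lti [-> [jk -> Sk]]| |rs' [out' [[-> [jk -> Sk]] Hl]]].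
- have [_ _ _ szk Hk] := Sk.
  have := HK2 w _ out Hw szk; rewrite (nth_mid _ _ szp) word_idx //.
  by apply: hrun_le; apply: leq_trans (leq_addr _ _); rewrite leq_mul.
- have Sl := state_loopw led lti erefl Sk.
  have [jk2 Sl2 Hl2] := HP1 _ _ _ out Sl Ho; rewrite /= -!catA /= in Hl2.
  have [_ _ szp3 szr3 Ha3] := Sl2; rewrite /= -catA /= in szr3 Ha3.
  exists (pre ++ i.+1 :: A x i.+1 :: A x i.+1 :: jk2), out.
  have leA : A x i.+1 <= size w by move: Ha3; rewrite !all_cat /= => /and5P[].
  split.
    split=> //; exists (A x i.+1 :: jk2) => //.
    split=> //; first by rewrite -szr3 !size_cat.
    by move: Ha3; rewrite !all_cat /= => /and5P[-> _ _ -> ->]; rewrite lti.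
  have := HK4 w _ out Hw szr3.
  have -> : nth 0 (pre ++ [:: i, A x i, A x i.+1 & jk2]) d.+2 = A x i.+1.
    by rewrite -cat_rcons -cat_rcons nth_mid // !size_rcons szp.
  have -> : set_nth 0 (pre ++ [:: i, A x i, A x i.+1 & jk2]) d.+1 (A x i.+1) =
            pre ++ [:: i, A x i.+1, A x i.+1 & jk2].
    by rewrite -!(cat_rcons i) set_nth_mid // size_rcons szp.
  move=> /(_ leA) H4.
  have szr5 : size (pre ++ [:: i, A x i.+1, A x i.+1 & jk2]) = R by rewrite -szr3 !size_cat.
  have := HK3 w _ out Hw szr5.
  rewrite (nth_mid _ _ szp) (set_nth_mid _ _ _ szp) => /(_ lti) H5.
  apply: hrun_le (hrun_seq Hl2 (hrun_seq H4 H5)).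
  by rewrite /T; apply: leq_trans (leq_addl _ _); rewrite !leq_add // leq_mul.
- by split=> //; exists j2.
have [_ _ _ szk Hk] := Sk; exists (A x (wN (wJ x)) :: jk).
  by apply: state_set Sk _; move: Hk; rewrite all_cat /= => /and4P[].
have := HK5 w _ out Hw szk; rewrite (nth_mid1 _ _ _ szp) (set_nth_mid _ _ _ szp).
move=> H5.
apply: hrun_le (hrun_seq H1 (hrun_seq H2 (hrun_seq Hl (H5 _)))); last first.
  by move: Hk; rewrite all_cat /= => /and4P[].
by apply: leq_trans (Hac _); rewrite !leq_add // leq_mul //.
Qed.

(** * Programs that write output *)

Lemma compo_nil W : compo (fun _ : wX W => [::]).
Proof.
split=> // d led; exists d => R _; exists skip, 1, 0 => x pre junk out S Ho.
exists junk => //; rewrite cats0 => m a b; exists m, a, b; split=> //.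
rewrite /home; case: (region _ _) => [|c u]; exact: run_skip.
Qed.

Lemma compo_emit W s : nblk s -> compo (fun _ : wX W => [:: s]).
Proof.
move=> Hs; split=> [x _|d led]; first by rewrite /= Hs.
exists d => R _; have [K H] := hrun_emit R Hs.
exists (emit s), K, 1 => x pre junk out S Ho; exists junk => //.
have [_ _ _ szr _] := S; have := H (word (wJ x)) _ out (wok_enc _ _) szr Ho.
rewrite cats1 expn1; apply: hrun_le.
by rewrite size_rcons leq_mul // ltnS leq_add2l.
Qed.

Lemma compo_cat W (o1 o2 : wX W -> seq sym) : compo o1 -> compo o2 ->
  compo (fun x => o1 x ++ o2 x).
Proof.
move=> [Hn1 H1] [Hn2 H2]; split=> [x Dx|d led]; first by rewrite all_cat Hn1 // Hn2.
have [m1 Hm1] := H1 d led; have [m2 Hm2] := H2 d led.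
exists (maxn m1 m2) => R; rewrite geq_max => /andP[/Hm1 [P [a [c HP]]] /Hm2 [Q [a1 [c1 HQ]]]].
have [a' [c' Hac]] : poly (fun z => a * z.+1 ^ c + a1 * z.+1 ^ c1) by pol.
exists (Seq P Q), a', c' => x pre junk out S Ho.
have [j S1 R1] := HP x pre junk out S Ho.
have [|j2 S2 R2] := HQ x pre j (out ++ o1 x) S1.
  by rewrite all_cat Ho Hn1 //; case: S.
exists j2 => //; rewrite catA; apply: hrun_le (hrun_seq R1 R2).
apply: leq_trans (Hac _); rewrite leq_add // pow_mono // leq_add2l.
by rewrite [X in _ <= X]size_cat leq_addr.
Qed.

Lemma compo_restrict W (b : wX W -> bool) (f : wX W -> seq sym) :
  compo f -> compo (W := restrict b) f.
Proof.
move=> [Hb Hc]; split=> [x [Dx _]|d led]; first exact: Hb.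
have [m Hm] := Hc d led; exists m => R /Hm [P [a [c H]]]; exists P, a, c.
move=> x pre junk out [[Dx bx] ? ? ? ?] Ho.
have [|j [? ? ? ? ?] Hj] := H x pre junk out _ Ho; first by split.
by exists j.
Qed.

Lemma compo_if W (b : wX W -> bool) (f g : wX W -> seq sym) : computable (fun x => (b x : nat)) ->
  compo (W := restrict b) f -> compo (W := restrict (fun x => ~~ b x)) g ->
  compo (fun x => if b x then f x else g x).
Proof.
move=> Hb [Hf1 Hf2] [Hg1 Hg2]; split=> [x Dx|d led].
  by case: ifPn => bx; [apply: Hf1 | apply: Hg1].
have [mb Hmb] := comp_decides Hb led.
have [mf Hmf] := Hf2 d led; have [mg Hmg] := Hg2 d led.
exists (maxn mb (maxn mf mg)) => R; rewrite !geq_max.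
move=> /and3P[/Hmb [t [a [c Ht]]] /Hmf [P [a1 [c1 HP]]] /Hmg [Q [a2 [c2 HQ]]]].
have [a' [c' Hac]] : poly (fun z => a * z.+1 ^ c + (a1 * z.+1 ^ c1 + a2 * z.+1 ^ c2 + 2)) by pol.
exists (Seq t (If flag P Q)), a', c' => x pre junk out S Ho.
have [j S1 H1] := Ht x pre junk out S Ho.
have mono o : wN (wJ x) + size out <= wN (wJ x) + size (out ++ o).
  by rewrite size_cat leq_add2l leq_addr.
case bx: (b x) in H1 *.
- have [|j2 [[Dx _] ? ? ? ?] H2] := HP x pre j out _ Ho; first by case: S1 => *; split.
  exists j2; first by [].
  apply: hrun_le (hrun_ifT _ H1 H2); apply: leq_trans (Hac _).
  by rewrite leq_add ?pow_mono // -addn2 leq_add2r leq_addr.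
have [|j2 [[Dx _] ? ? ? ?] H2] := HQ x pre j out _ Ho.
  by case: S1 => *; split=> //; split; rewrite //= bx.
exists j2; first by [].
apply: hrun_le (hrun_ifF _ H1 H2); apply: leq_trans (Hac _).
by rewrite leq_add ?pow_mono // -addn2 leq_add2r leq_addl.
Qed.

(** A loop without accumulator: [loopw] is reused with the constant [0] in its place. *)
Lemma compo_for W (o : wX W -> nat -> seq sym) :
  (forall q, compo (W := loopw q (fun (_ : wX W) _ => 0)) (fun y => o y.1.1 y.2)) ->
  compo (fun x => flatten [seq o x i | i <- iota 0 (wN (wJ x))]).
Proof.
move=> Hbody.
have Hn x i : wD x -> i < wN (wJ x) -> all nblk (o x i).
  by move=> Dx lti; have [+ _] := Hbody 0; move=> /(_ (x, [::], i)); apply; split.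
have Hn' x i : wD x -> i <= wN (wJ x) -> all nblk (flatten [seq o x i | i <- iota 0 i]).
  move=> Dx lei; apply/allP=> s /flatten_mapP[j]; rewrite mem_iota => /andP[_ ltj].
  by move: s; apply/allP; apply: Hn => //; apply: leq_trans ltj lei.
split=> [x Dx|d led]; first exact: Hn'.
have [_ /(_ d.+2)] := Hbody (d - wb W); case=> [|m1 Hm1]; first by rewrite /=; lia.
exists (maxn m1 d.+3) => R; rewrite !geq_max.
move=> /andP[/Hm1 [P1 [a1 [c1 HP1]]] ltd].
have ltd2 : d.+1 < R by lia.
have ltd1 : d < R by lia.
have nbB : ~~ nblk Blank by [].
have [K1 HK1] := hrun_clr ltd1; have [K2 HK2] := hrun_sym ltd1 nbB.
have [K3 HK3] := hrun_inc ltd1; have [K4 HK4] := hrun_clr ltd2.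
pose T z := K2 * z.+1 + (a1 * z.+1 ^ c1 + K3 * z.+1).
have [a [c Hac]] : poly (fun z => K1 * z.+1 + (K4 * z.+1 +
    z.+1 * (T z + T z + 2))) by rewrite /T; pol.
exists (Seq (clr R d) (Seq (clr R d.+1) (loop (sym_test R nblk d)
  (Seq P1 (inc R d))))), a, c.
move=> x pre junk out S Ho; have [v [j Ej]] := state_junk ltd1 S; rewrite {}Ej in S *.
have [Dx Ht szp szr Ha] := S.
set w := word (wJ x); have Hw : wok w by apply: wok_enc.
have H1 := HK1 w _ out Hw szr; rewrite (set_nth_mid _ _ _ szp) in H1.
have S1 := state_push (state_set S (leq0n _)) led.
have [v2 [j2 Ej]] := state_junk ltd2 S1; rewrite {}Ej in S1 H1 *.
have [_ _ szp1 szr1 _] := S1.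
have H2 := HK4 w _ out Hw szr1; rewrite (set_nth_mid _ _ _ szp1) !cat_rcons in H2.
have S2 := state_pop (state_set S1 (leq0n _)) led.
pose ou i := out ++ flatten [seq o x i | i <- iota 0 i].
pose I i rs out' := out' = ou i /\ exists2 jk, rs = pre ++ i :: 0 :: jk &
   state d R x pre (i :: 0 :: jk).
set z := wN (wJ x) + size (ou (wN (wJ x))).
have := @hrun_loop (sym_test R nblk d) (Seq P1 (inc R d)) w
  (wN (wJ x)) (T z) I (pre ++ [:: 0, 0 & j2]) out.
have lew : (size w).+1 <= z.+1 by rewrite ltnS leq_addr.
case=> [i rs out' lei [-> [jk -> Sk]]|i rs out' lti [-> [jk -> Sk]]| |rs' [out' [[-> [jk -> Sk]] Hl]]].
- have [_ _ _ szk Hk] := Sk.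
  have := HK2 w _ (ou i) Hw szk; rewrite (nth_mid _ _ szp) word_idx //.
  by apply: hrun_le; apply: leq_trans (leq_addr _ _); rewrite leq_mul.
- have Sl := @state_loopw W d R (fun _ _ => 0) x pre i 0 jk led lti erefl Sk.
  have Hou : all nblk (ou i) by rewrite /ou all_cat Ho Hn' // ltnW.
  have [jk2 Sl2 Hl2] := HP1 _ _ _ (ou i) Sl Hou; rewrite /= -!catA /= in Hl2.
  have [_ _ szp3 szr3 Ha3] := Sl2; rewrite /= -catA /= in szr3 Ha3.
  have Eou : ou i.+1 = out ++ flatten [seq o x i | i <- iota 0 i] ++ o x i.
    by rewrite /ou -addn1 iotaD map_cat flatten_cat /= cats0.
  exists (pre ++ i.+1 :: 0 :: jk2), (ou i.+1).
  split.
    split=> //; exists jk2 => //.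
    split=> //; first by rewrite -szr3 !size_cat.
    by move: Ha3; rewrite !all_cat /= => /and3P[-> _ ->]; rewrite lti.
  have := HK3 w _ (ou i.+1) Hw szr3.
  rewrite (nth_mid _ _ szp) (set_nth_mid _ _ _ szp) => /(_ lti) H5.
  rewrite -Eou in Hl2; apply: hrun_le (hrun_seq Hl2 H5).
  rewrite /T; apply: leq_trans (leq_addl _ _); rewrite !leq_add //; last by rewrite leq_mul.
  apply: pow_mono; rewrite leq_add2l /ou [X in X <= _]size_cat [X in _ <= X]size_cat leq_add2l.
  have -> : iota 0 (wN (wJ x)) = iota 0 i.+1 ++ iota i.+1 (wN (wJ x) - i.+1).
    by rewrite -{1}(subnKC lti) iotaD.
  by rewrite map_cat flatten_cat [X in _ <= X]size_cat leq_addr.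
- by split; [rewrite /ou /= cats0 | exists j2].
exists [:: wN (wJ x), 0 & jk] => //.
apply: hrun_le (hrun_seq H1 (hrun_seq H2 Hl)).
by apply: leq_trans (Hac z); rewrite !leq_add // leq_mul // ltnS leq_addr.
Qed.

Definition base_world : world :=
  @World (sgraph * nat) (fun=> True) id 0 (fun=> [::]) (fun _ _ => erefl).

(** The bridge to Turing machines: tape preparation, then the program with no known register
    ([d = 0]), then a move of the head onto the output. The time still involves the output length,
    which has to be bounded separately. *)
Theorem compo_machine (o : sgraph * nat -> seq sym) : compo (W := base_world) o ->
  exists M a d, forall G k, exists2 t, t <= a * (wN (G, k) + size (o (G, k))).+1 ^ d &
    runs_to M (enc_instance G k) t (o (G, k)).
Proof.
case=> Hnb /(_ 0 (leqnn 0)) [R /(_ R (leqnn R)) [P [a [c HP]]]].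
have [K HK] := run_prelude R.
have [a' [c' Hac]] : poly (fun z => K * (z.+1 * z.+1) + (a * z.+1 ^ c + (3 * (z * R.+1) + 2))) by pol.
exists (machine (Seq (prelude R) (Seq P skip_right))), a', c' => G k.
have Hw := wok_enc G k.
have [m1 [a1 [b1 r1]]] := HK mem0 _ Hw.
have S : state (W := base_world) 0 R (G, k) [::] (nseq R 0).
  by split=> //=; [rewrite size_nseq | rewrite all_nseq orbT].
have [j [_ _ _ szj _] /(_ m1 a1 b1) [m2 [a2 [b2 [r2 _]]]]] := HP (G, k) [::] (nseq R 0) [::] S isT.
have [m3 [t3 [r3 E3]]] := run_finish m2 j a2 b2 Hw (Hnb (G, k) I).
have [n len ex] := run_seq r1 (run_seq r2 r3).
exists n; last first.
  apply: machine_runs E3; move: ex; case: (enc_instance G k) Hw => //= c0 u _; exact.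
apply: leq_trans len _; apply: leq_trans (Hac _); rewrite -/(wN (G, k)) /= in szj *.
set z := wN (G, k) + _; have lez : wN (G, k) <= z by rewrite leq_addr.
by rewrite szj !leq_add // ?leq_mul // -mulnn leq_mul.
Qed.

(** * Arithmetic and tests on computable values *)

Lemma comp_one W : computable (fun _ : wX W => 1).
Proof. by apply: comp_succ; [exact: comp_zero | move=> x _; apply: wN_gt0]. Qed.

Lemma comp_bool W (c : bool) : computable (fun _ : wX W => (c : nat)).
Proof. by case: c; [exact: comp_one | exact: comp_zero]. Qed.
Section Combinators.
Variable W : world.

Lemma comp_ifb (b b1 b2 : wX W -> bool) : computable (fun x => (b x : nat)) ->
  computable (W := restrict b) (fun x => (b1 x : nat)) ->
  computable (W := restrict (fun x => ~~ b x)) (fun x => (b2 x : nat)) ->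
  computable (fun x => ((if b x then b1 x else b2 x) : nat)).
Proof.
move=> H H1 H2; have := comp_if H H1 H2.
by apply: comp_ext => x _; case: (b x).
Qed.

Lemma comp_not (b : wX W -> bool) : computable (fun x => (b x : nat)) -> computable (fun x => (~~ b x : nat)).
Proof.
move=> H; have := comp_ifb H (comp_bool _ false) (comp_bool _ true).
by apply: comp_ext => x _; case: (b x).
Qed.

Lemma comp_and (b1 b2 : wX W -> bool) : computable (fun x => (b1 x : nat)) ->
  computable (W := restrict b1) (fun x => (b2 x : nat)) -> computable (fun x => (b1 x && b2 x : nat)).
Proof.
move=> H1 H2; have := comp_ifb H1 H2 (comp_bool _ false).
by apply: comp_ext => x _; case: (b1 x).
Qed.

Lemma comp_or (b1 b2 : wX W -> bool) : computable (fun x => (b1 x : nat)) -> computable (fun x => (b2 x : nat)) ->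
  computable (fun x => (b1 x || b2 x : nat)).
Proof.
move=> H1 H2; have := comp_ifb H1 (comp_bool _ true) (comp_restrict _ H2).
by apply: comp_ext => x _; case: (b1 x).
Qed.

Lemma comp_leq (f g : wX W -> nat) : computable f -> computable g -> computable (fun x => (f x <= g x : nat)).
Proof.
move=> Hf Hg; have := comp_not (comp_lt Hg Hf).
by apply: comp_ext => x _; rewrite -leqNgt.
Qed.

Lemma comp_eq (f g : wX W -> nat) : computable f -> computable g -> computable (fun x => (f x == g x : nat)).
Proof.
move=> Hf Hg; have := comp_and (comp_leq Hf Hg) (comp_restrict _ (comp_leq Hg Hf)).
by apply: comp_ext => x _; rewrite eqn_leq.
Qed.

(** At most the positions already passed are counted, so the successor never overflows. *)
Lemma comp_count (phi : wX W -> nat -> bool) :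
  (forall q A, computable (W := @loopw W q A) (fun y => (phi y.1.1 y.2 : nat))) ->
  computable (fun x => count (phi x) (iota 0 (wN (wJ x)))).
Proof.
move=> H; apply: (@comp_loop W (fun x i => count (phi x) (iota 0 i))).
  exact: comp_zero.
move=> q; set A := fun x i => _.
have le (x : wX W) i : A x i <= i by rewrite -{2}(size_iota 0 i) count_size.
have := comp_if (H q A) (comp_succ (comp_restrict _ (comp_acc q A)) _) (comp_restrict _ (comp_acc q A)).
have Hlt x : wD (w := restrict (fun y : wX (loopw q A) => phi y.1.1 y.2)) x ->
    A x.1.1 x.2 < wN (wJ (w := restrict (fun y : wX (loopw q A) => phi y.1.1 y.2)) x).
  by case=> [[_ _ lti _] _]; apply: leq_ltn_trans (le _ _) lti.
move=> /(_ Hlt); apply: comp_ext => y _.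
rewrite /A -[y.2.+1]addn1 iotaD count_cat /= addn0.
by case: (phi _ _); rewrite ?addn1 ?addn0.
Qed.

End Combinators.

(** There is no decrement; the difference is the number of positions [i] with [g x <= i < f x], and
    truncation at zero is automatic. *)
Lemma comp_sub W (f g : wX W -> nat) : computable f -> computable g -> computable (fun x => f x - g x).
Proof.
move=> Hf Hg.
have := @comp_count W (fun x i => (g x <= i) && (i < f x)).
set P := forall q A, _; have HP : P.
  move=> q A; cbv beta; apply: comp_and; first by apply: comp_leq; [exact: comp_lift | exact: comp_idx].
  by apply/comp_restrict/comp_lt; [exact: comp_idx | exact: comp_lift].
move=> /(_ HP); apply: comp_ext => x Dx; have [lef _] := Hf; have {}lef := lef x Dx.
have [le|lt] := leqP (f x) (g x).
  rewrite (eqP (_ : f x - g x == 0)) //; apply/eqP; rewrite -leqn0 leqNgt -has_count.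
  by apply/hasP => -[i _]; lia.
have -> : iota 0 (wN (wJ x)) = iota 0 (f x) ++ iota (f x) (wN (wJ x) - f x).
  by rewrite -{1}(subnKC lef) iotaD.
have -> : iota 0 (f x) = iota 0 (g x) ++ iota (g x) (f x - g x).
  by rewrite -{1}(subnKC (ltnW lt)) iotaD.
rewrite !count_cat.
have -> : count (fun i => (g x <= i) && (i < f x)) (iota 0 (g x)) = 0.
  by apply/eqP; rewrite -leqn0 leqNgt -has_count; apply/hasP => -[i]; rewrite mem_iota; lia.
have -> : count (fun i => (g x <= i) && (i < f x)) (iota (f x) (wN (wJ x) - f x)) = 0.
  by apply/eqP; rewrite -leqn0 leqNgt -has_count; apply/hasP => -[i]; rewrite mem_iota; lia.
rewrite addn0 add0n -[RHS](size_iota (g x)); apply/eqP; rewrite -all_count.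
by apply/allP=> i; rewrite mem_iota; lia.
Qed.
(** The loop runs over all positions but freezes the accumulator once the index reaches [f x]. The
    body may use [i < f x] and the computability of [A x i]; the accumulator [B] of the world is
    left abstract there, which hides the truncation by [minn]. *)
Lemma comp_iter W (f : wX W -> nat) (A : wX W -> nat -> nat) :
  computable f -> computable (A^~ 0) ->
  (forall q B, let W' := @restrict (@loopw W q B) (fun y => y.2 < f y.1.1) in
     computable (W := W') (fun y => A y.1.1 y.2) ->
     computable (W := W') (fun y => A y.1.1 y.2.+1)) ->
  computable (fun x => A x (f x)).
Proof.
move=> Hf H0 HS; pose B x i := A x (minn i (f x)).
have HP : computable (B^~ 0) by apply: comp_ext H0 => x _; rewrite /B min0n.
have HP2 q : computable (W := loopw q B) (fun y => B y.1.1 y.2.+1).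
  have HB : forall x i, wD x -> i < f x -> B x i = A x i.
    by move=> x i _ lti; rewrite /B (minn_idPl (ltnW lti)).
  have Hc : computable (W := @loopw W q B) (fun y => (y.2 < f y.1.1 : nat)).
    by apply: comp_lt; [exact: comp_idx | exact: comp_lift].
  have Hacc := comp_acc q B.
  have H1 : computable (W := @restrict (@loopw W q B) (fun y => y.2 < f y.1.1)) (fun y => A y.1.1 y.2).
    by apply: (comp_ext _ (comp_restrict _ Hacc)) => y [[Dy _ _ _] lty]; rewrite HB.
  have := comp_if Hc (HS q B H1) (comp_restrict _ Hacc).
  apply: comp_ext => y _; rewrite /B; case: ltnP => H; first by rewrite (minn_idPl H).
  by rewrite !(minn_idPr _) // leqW.
apply: comp_ext (comp_loop HP HP2) => x Dx; rewrite /B; congr (A x _).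
by apply/minn_idPr; have [+ _] := Hf; apply.
Qed.


Lemma comp_inner_idx W q B (c : wX (@loopw W q B) -> bool) :
  computable (W := restrict c) (fun y => y.2).
Proof. by apply/comp_restrict/comp_idx. Qed.

Lemma comp_add W (f g : wX W -> nat) : computable f -> computable g ->
  (forall x, wD x -> f x + g x <= wN (wJ x)) -> computable (fun x => f x + g x).
Proof.
move=> Hf Hg le; apply: (@comp_iter W g (fun x i => f x + i) Hg).
  by apply: comp_ext Hf => x _; rewrite addn0.
move=> q B W' H.
have lt (y : wX W') : wD y -> f y.1.1 + y.2 < wN (wJ y).
  by case=> [[Dx _ _ _] lty]; apply: leq_trans (le _ Dx); rewrite ltn_add2l.
have := comp_succ H lt.
by apply: comp_ext => y _; rewrite addnS.
Qed.

Lemma comp_odd W (f : wX W -> nat) : computable f -> computable (fun x => (odd (f x) : nat)).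
Proof.
move=> Hf; apply: (@comp_iter W f (fun x i => (odd i : nat)) Hf); first exact: comp_zero.
by move=> q B W' H; apply: comp_not.
Qed.

Lemma comp_half W (f : wX W -> nat) : computable f -> computable (fun x => (f x)./2).
Proof.
move=> Hf; apply: (@comp_iter W f (fun x i => i./2) Hf); first exact: comp_zero.
move=> q B W' H.
have lt (y : wX W') : wD y -> y.2./2 < wN (wJ y).
  by case=> [[Dx _ lty _] _]; apply: leq_ltn_trans lty; lia.
have Ho : computable (W := W') (fun y => (odd y.2 : nat)) by apply/comp_odd/comp_inner_idx.
have := comp_if Ho (comp_restrict _ (comp_succ H lt)) (comp_restrict _ H).
by apply: comp_ext => y _; case: ifP => Ey /=; lia.
Qed.

Lemma comp_shift W (f g : wX W -> nat) : computable f -> computable g ->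
  computable (fun x => f x %/ 2 ^ g x).
Proof.
move=> Hf Hg; apply: (@comp_iter W g (fun x i => f x %/ 2 ^ i) Hg).
  by apply: comp_ext Hf => x _; rewrite divn1.
move=> q B W' H; have := comp_half H.
by apply: comp_ext => y _; rewrite -divn2 -divnMA expnSr.
Qed.

Lemma size_bin m : size (bin m) = (trunc_log 2 m).+1.
Proof. by rewrite size_rev size_map size_iota. Qed.

(** The digits are counted as the [i] with [2 ^ i <= m]; position [0] always counts because zero is
    written with one digit. *)
Lemma size_bin_count m N : m <= N -> 0 < N ->
  count (fun i => (i == 0) || (0 < m %/ 2 ^ i)) (iota 0 N) = size (bin m).
Proof.
move=> lem N0; rewrite size_bin.
have lt : trunc_log 2 m < N.
  case: m lem => [|m] lem; first by rewrite trunc_log0.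
  by apply: leq_trans lem; apply: leq_trans (ltn_expl _ (isT : 1 < 2)) (trunc_logP _ _).
rewrite -(subnKC lt) iotaD count_cat.
have -> : count (fun i => (i == 0) || (0 < m %/ 2 ^ i)) (iota 0 (trunc_log 2 m).+1) = (trunc_log 2 m).+1.
  rewrite -[RHS](size_iota 0); apply/eqP; rewrite -all_count; apply/allP=> i.
  rewrite mem_iota add0n ltnS => lei; case: i lei => // i lei; rewrite divn_gt0 ?expn_gt0 //=.
  have m0 : 0 < m by case: (m) lei.
  by apply: leq_trans (trunc_logP (isT : 1 < 2) m0); rewrite leq_pexp2l.
have -> : count (fun i => (i == 0) || (0 < m %/ 2 ^ i)) (iota (0 + (trunc_log 2 m).+1) (N - (trunc_log 2 m).+1)) = 0.
  apply/eqP; rewrite -leqn0 leqNgt -has_count; apply/hasP => -[i]; rewrite mem_iota => /andP[lti _].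
  rewrite divn_gt0 ?expn_gt0 //; case: i lti => // i lti /=.
  by rewrite leqNgt; apply/negP/negPn; apply: leq_trans (trunc_log_ltn m (isT : 1 < 2)) _; rewrite leq_pexp2l.
by rewrite addn0.
Qed.

Lemma comp_size_bin W (f : wX W -> nat) : computable f -> computable (fun x => size (bin (f x))).
Proof.
move=> Hf; have := @comp_count W (fun x i => (i == 0) || (0 < f x %/ 2 ^ i)).
case=> [q A|]; last first.
  move=> H1 H2; apply: comp_ext (conj H1 H2) => x Dx; apply: size_bin_count; last exact: wN_gt0.
  by have [+ _] := Hf; apply.
apply: comp_or; first by apply: comp_eq; [exact: comp_idx | exact: comp_zero].
by apply: comp_lt; [exact: comp_zero | apply: comp_shift; [exact: comp_lift | exact: comp_idx]].
Qed.

Lemma nth_bin m i : i < size (bin m) -> nth false (bin m) i = odd (m %/ 2 ^ ((size (bin m)).-1 - i)).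
Proof.
rewrite size_bin /= => lti; rewrite /bin nth_rev ?size_map ?size_iota // (nth_map 0) ?size_iota ?subSS ?leq_subr //; last lia.
by rewrite nth_iota; last lia.
Qed.

Lemma bin_bound m : m < 2 ^ size (bin m).
Proof. by rewrite size_bin trunc_log_ltn. Qed.

Lemma bin_lower m : 0 < m -> 2 ^ (size (bin m)).-1 <= m.
Proof. by move=> m0; rewrite size_bin trunc_logP. Qed.

(** * Reading the encoded instance *)

(** Total on natural numbers and false out of range, so that it can be applied to arbitrary register
    values. *)
Definition adjn (G : sgraph) (u v : nat) : bool :=
  if insub u is Some i then if insub v is Some j then @gadj G i j else false else false.

Lemma adjn_ord (G : sgraph) (i j : 'I_(gn G)) : adjn G i j = gadj i j.
Proof. by rewrite /adjn !valK. Qed.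

Lemma adjn_sym G u v : adjn G u v = adjn G v u.
Proof. by rewrite /adjn; case: insub => [i|]; case: insub => [j|] //; apply: gsym. Qed.

Lemma adjn_irr G u : adjn G u u = false.
Proof. by rewrite /adjn; case: insub => [i|] //; apply: girr. Qed.

Lemma adjn_lt G u v : adjn G u v -> v < gn G.
Proof.
by rewrite /adjn; case: insub => [i|] //; case: insubP => [j _ <- _|] //; apply: ltn_ord.
Qed.

Lemma map_filter_pairs (S T R : Type) (F : S * T -> R) (P : pred (S * T)) (s : seq S) (t : seq T) :
  [seq F p | p <- [seq (i, j) | i <- s, j <- t] & P p] =
  flatten [seq [seq F (i, j) | j <- t & P (i, j)] | i <- s].
Proof.
elim: s => [|x s IH] //=; rewrite filter_cat map_cat IH; congr cat.
by rewrite filter_map -map_comp.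
Qed.

Lemma adj_bits_pairs G : adj_bits G =
  flatten [seq [seq adjn G u v | v <- iota 0 (gn G) & u < v] | u <- iota 0 (gn G)].
Proof.
rewrite /adj_bits map_filter_pairs -!val_enum_ord -map_comp; congr flatten.
apply: eq_map => i /=; rewrite filter_map -map_comp.
by apply: eq_map => j /=; rewrite adjn_ord.
Qed.

Lemma filter_iota_gt n u : u < n -> [seq v <- iota 0 n | u < v] = iota u.+1 (n - u.+1).
Proof.
move=> ltu; rewrite -{1}(subnKC ltu) iotaD filter_cat.
rewrite (eq_in_filter (a2 := pred0)); last by move=> v; rewrite mem_iota /=; lia.
rewrite filter_pred0 (eq_in_filter (a2 := predT)) ?filter_predT //.
by move=> v; rewrite mem_iota /=; lia.
Qed.

Lemma adj_bitsE G : adj_bits G =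
  flatten [seq [seq adjn G u v | v <- iota u.+1 (gn G - u.+1)] | u <- iota 0 (gn G)].
Proof.
rewrite adj_bits_pairs; congr flatten; apply/eq_in_map => u.
by rewrite mem_iota => /andP[_ ltu]; rewrite filter_iota_gt.
Qed.

(** The offset of row [u] in the row-major upper triangle, row [a] having [n - a.+1] entries. *)
Definition rowstart n u := sumn [seq n - a.+1 | a <- iota 0 u].

Lemma rowstartS n u : rowstart n u.+1 = rowstart n u + (n - u.+1).
Proof. by rewrite /rowstart -[in LHS]addn1 iotaD map_cat sumn_cat /= addn0. Qed.

Lemma size_rows G s : size (flatten [seq [seq adjn G u v | v <- iota u.+1 (gn G - u.+1)] | u <- s])
  = sumn [seq gn G - u.+1 | u <- s].
Proof.
rewrite size_flatten /shape -map_comp; congr sumn; apply: eq_map => u /=.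
by rewrite size_map size_iota.
Qed.

Lemma size_adj_bits G : size (adj_bits G) = rowstart (gn G) (gn G).
Proof. by rewrite adj_bitsE size_rows. Qed.

Lemma rowstart_mono n u v : u <= v -> rowstart n u <= rowstart n v.
Proof.
move=> le; rewrite -(subnKC le) /rowstart iotaD map_cat sumn_cat; exact: leq_addr.
Qed.

Lemma rowstart_lt n u v : u < v -> v < n -> rowstart n u + (v - u.+1) < rowstart n n.
Proof.
move=> ltuv ltvn; apply: leq_trans (rowstart_mono n (_ : u.+1 <= n)); last lia.
by rewrite rowstartS; lia.
Qed.

Lemma nth_adj_bits G u v : u < v -> v < gn G ->
  nth false (adj_bits G) (rowstart (gn G) u + (v - u.+1)) = adjn G u v.
Proof.
move=> ltuv ltvn; set n := gn G; have ltun : u < n by apply: ltn_trans ltvn.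
rewrite adj_bitsE -/n -{2}(subnKC (ltnW ltun)) iotaD map_cat flatten_cat nth_cat size_rows -/n.
rewrite ltnNge leq_addr /= addKn.
have -> : n - u = (n - u.+1).+1 by lia.
rewrite add0n /= nth_cat size_map size_iota ltn_sub2r //; last lia.
by rewrite (nth_map 0) ?size_iota ?ltn_sub2r ?nth_iota ?subnKC //; lia.
Qed.

(** [sep1] and [sep2] are the positions of the two separators. *)
Definition sep1 (J : sgraph * nat) := size (bin (gn J.1)).
Definition sep2 (J : sgraph * nat) := (sep1 J).+1 + size (adj_bits J.1).

Lemma wordE (J : sgraph * nat) : word J =
  map Bit (bin (gn J.1)) ++ Sep :: map Bit (adj_bits J.1) ++ Sep :: map Bit (bin J.2).
Proof. by []. Qed.

Lemma wNE J : wN J = (sep2 J).+1 + size (bin J.2).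
Proof.
rewrite /wN wordE /sep2 /sep1; set A := adj_bits _.
by rewrite size_cat /= size_cat /= !(size_map Bit) !addnS !addSn addnA.
Qed.

Lemma word_bin J i : i < sep1 J -> nth Blank (word J) i = Bit (nth false (bin (gn J.1)) i).
Proof. by move=> lti; rewrite wordE nth_cat size_map lti (nth_map false). Qed.

Lemma word_sep1 J : nth Blank (word J) (sep1 J) = Sep.
Proof. by rewrite wordE nth_cat size_map ltnn subnn. Qed.

Lemma word_adj J i : i < size (adj_bits J.1) ->
  nth Blank (word J) ((sep1 J).+1 + i) = Bit (nth false (adj_bits J.1) i).
Proof.
move=> lti; rewrite wordE nth_cat size_map ltnNge addSnnS leq_addr addKn /=.
by rewrite nth_cat size_map lti (nth_map false).
Qed.

Lemma word_tail J i :
  nth Blank (word J) (sep2 J + i) = nth Blank (Sep :: map Bit (bin J.2)) i.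
Proof.
rewrite wordE nth_cat size_map /sep2 ltnNge addSn addSnnS -addnA leq_addr addKn /=.
by rewrite addnC addSn /= nth_cat size_map ltnNge leq_addl /= addnK.
Qed.

Lemma word_sep J i : i < wN J -> (nth Blank (word J) i == Sep) = (i == sep1 J) || (i == sep2 J).
Proof.
move=> ltN; case: (ltngtP i (sep1 J)) => [lt1|gt1|->].
- by rewrite word_bin // (_ : i == sep2 J = false) //; rewrite /sep2; lia.
- case: (ltngtP i (sep2 J)) => [lt2|gt2|->].
  + rewrite -(subnKC gt1) word_adj //; rewrite /sep2 in lt2; lia.
  + rewrite -(subnKC gt2) addSnnS word_tail /= (nth_map false) //.
    by rewrite wNE in ltN; lia.
  by have := word_tail J 0; rewrite addn0 /= => ->.
by rewrite word_sep1.
Qed.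

(** For [n > 0] the first row of the triangle already has [n - 1] entries; so the number of
    vertices, unlike [k], fits into a unary register. *)
Lemma gn_lt_wN J : gn J.1 < wN J.
Proof.
rewrite wNE /sep2 /sep1 size_adj_bits !size_bin; set n := gn J.1.
case: n => [|n] //; have := rowstart_mono n.+1 (isT : 1 <= n.+1).
by rewrite rowstartS /rowstart /=; lia.
Qed.

Lemma rowstart_le_wN J : rowstart (gn J.1) (gn J.1) <= wN J.
Proof. by rewrite -size_adj_bits wNE /sep2; lia. Qed.

Lemma sep2_lt_wN J : sep2 J < wN J. Proof. by rewrite wNE; lia. Qed.
Lemma sep1_lt_sep2 J : sep1 J < sep2 J. Proof. by rewrite /sep2; lia. Qed.

(** The accumulator follows the index up to the first separator and then stays; as long as the two
    agree, no separator has occurred at an earlier position. *)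
Lemma comp_sep1 W : computable (fun x : wX W => sep1 (wJ x)).
Proof.
have := @comp_loop W (fun x i => minn i (sep1 (wJ x))).
case=> [|q|H1 H2]; last first.
- apply: comp_ext (conj H1 H2) => x _; apply/minn_idPr/ltnW.
  exact: ltn_trans (sep1_lt_sep2 _) (sep2_lt_wN _).
- set A := fun x i => _.
  have Hc : computable (W := loopw q A) (fun y => ((A y.1.1 y.2 == y.2) &&
       (nth Blank (word (wJ y)) y.2 != Sep) : nat)).
    apply: comp_and; first by apply: comp_eq; [exact: comp_acc | exact: comp_idx].
    apply/comp_restrict/comp_not.
    by apply: (@comp_sym _ (fun s => s == Sep)) => //; apply: comp_idx.
  have Hlt (y : wX (loopw q A)) : wD y -> A y.1.1 y.2 < wN (wJ y).
    by case=> _ _ lty _; apply: leq_ltn_trans lty; apply: geq_minl.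
  have := comp_if Hc (comp_restrict _ (comp_succ (comp_acc q A) Hlt)) (comp_restrict _ (comp_acc q A)).
  apply: comp_ext => y [_ _ lty _]; rewrite word_sep // /A /=.
  have := sep1_lt_sep2 (wJ y.1.1); case: ifP; lia.
by apply: comp_ext (comp_zero W) => x _; rewrite min0n.
Qed.

(** The same walk, except that it passes the first separator. *)
Lemma comp_sep2 W : computable (fun x : wX W => sep2 (wJ x)).
Proof.
have := @comp_loop W (fun x i => minn i (sep2 (wJ x))).
case=> [|q|H1 H2]; last first.
- by apply: comp_ext (conj H1 H2) => x _; apply/minn_idPr/ltnW/sep2_lt_wN.
- set A := fun x i => _.
  have Hc : computable (W := loopw q A) (fun y => ((A y.1.1 y.2 == y.2) &&
       ((y.2 == sep1 (wJ y)) || (nth Blank (word (wJ y)) y.2 != Sep)) : nat)).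
    apply: comp_and; first by apply: comp_eq; [exact: comp_acc | exact: comp_idx].
    apply/comp_restrict/comp_or; first by apply: comp_eq; [exact: comp_idx | exact: comp_sep1].
    apply/comp_not.
    by apply: (@comp_sym _ (fun s => s == Sep)) => //; apply: comp_idx.
  have Hlt (y : wX (loopw q A)) : wD y -> A y.1.1 y.2 < wN (wJ y).
    by case=> _ _ lty _; apply: leq_ltn_trans lty; apply: geq_minl.
  have := comp_if Hc (comp_restrict _ (comp_succ (comp_acc q A) Hlt)) (comp_restrict _ (comp_acc q A)).
  apply: comp_ext => y [_ _ lty _]; rewrite word_sep // /A /=.
  have := sep1_lt_sep2 (wJ y.1.1); case: ifP; lia.
by apply: comp_ext (comp_zero W) => x _; rewrite min0n.
Qed.

Lemma comp_bit W (f : wX W -> nat) : computable f ->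
  computable (fun x => (nth Blank (word (wJ x)) (f x) == Bit true : nat)).
Proof. by move=> Hf; apply: (@comp_sym _ (fun s => s == Bit true)). Qed.

(** Horner evaluation: after [i] leading digits the accumulator is the number they represent, that
    is, [n] shifted right by the number of remaining digits. *)
Lemma comp_gn W : computable (fun x : wX W => gn (wJ x).1).
Proof.
have := @comp_iter W (fun x => sep1 (wJ x)) (fun x i => gn (wJ x).1 %/ 2 ^ (sep1 (wJ x) - i)).
case=> [||q B W' H|H1 H2]; last first.
- by apply: comp_ext (conj H1 H2) => x _; rewrite subnn divn1.
- have E (y : wX W') : wD y -> gn (wJ y).1 %/ 2 ^ (sep1 (wJ y) - y.2.+1) =
     2 * (gn (wJ y).1 %/ 2 ^ (sep1 (wJ y) - y.2)) + (nth Blank (word (wJ y)) y.2 == Bit true).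
    case=> _ lty; have {}lty : y.2 < sep1 (wJ y) by [].  
    rewrite word_bin // nth_bin // -/(sep1 (wJ y)).
    have -> : sep1 (wJ y) - y.2 = (sep1 (wJ y) - y.2.+1).+1 by lia.
    have -> : (sep1 (wJ y)).-1 - y.2 = sep1 (wJ y) - y.2.+1 by lia.
    set e := _ - _; rewrite expnSr divnMA; set m := _ %/ 2 ^ e.
    rewrite divn2 mul2n (_ : (Bit (odd m) == Bit true) = odd m); last by case: odd.
    by rewrite addnC odd_double_half.
  have le (y : wX W') : wD y -> 2 * (gn (wJ y).1 %/ 2 ^ (sep1 (wJ y) - y.2)) +
       (nth Blank (word (wJ y)) y.2 == Bit true) <= wN (wJ y).
    by move=> Dy; rewrite -E //; apply: leq_trans (leq_div _ _) (ltnW (gn_lt_wN _)).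
  have H2 : computable (W := W') (fun y => gn (wJ y).1 %/ 2 ^ (sep1 (wJ y) - y.2) +
       gn (wJ y).1 %/ 2 ^ (sep1 (wJ y) - y.2)).
    apply: comp_add => // y Dy; apply: leq_trans (le y Dy).
    by rewrite mul2n -addnn leq_addr.
  have := comp_add H2 (comp_bit (comp_inner_idx _)) _.
  case=> [y Dy|H3 H4]; first by rewrite addnn -mul2n; apply: le.
  by apply: comp_ext (conj H3 H4) => y Dy; rewrite E // mul2n -addnn.
- by apply: comp_ext (comp_zero W) => x _; rewrite subn0 divn_small // bin_bound.
- exact: comp_sep1.
Qed.

Lemma comp_rowstart W (f : wX W -> nat) : computable f ->
  (forall x, wD x -> f x <= gn (wJ x).1) ->
  computable (fun x => rowstart (gn (wJ x).1) (f x)).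
Proof.
move=> Hf lef; have := @comp_iter W f (fun x i => rowstart (gn (wJ x).1) i) Hf.
case=> [|q B W' H|H1 H2]; last exact: (conj H1 H2).
  exact: comp_zero.
have Hd : computable (W := W') (fun y => gn (wJ y).1 - y.2.+1).
  apply: comp_sub; first exact: comp_gn.
  by apply: comp_succ; [exact: comp_inner_idx | case=> y i [[]]].
have := comp_add H Hd _; case=> [y [[Dy _ _ _] lty]|H3 H4].
  rewrite -rowstartS; apply: leq_trans (rowstart_mono _ (leq_trans lty (lef _ Dy))) _.
  exact: rowstart_le_wN.
by apply: comp_ext (conj H3 H4) => y _; rewrite rowstartS.
Qed.

Lemma comp_adj_lt W (f g : wX W -> nat) : computable f -> computable g ->
  (forall x, wD x -> f x < g x < gn (wJ x).1) ->
  computable (fun x => (adjn (wJ x).1 (f x) (g x) : nat)).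
Proof.
move=> Hf Hg lt.
have pos x : wD x -> rowstart (gn (wJ x).1) (f x) + (g x - (f x).+1) < size (adj_bits (wJ x).1).
  by move=> /lt/andP[? ?]; rewrite size_adj_bits rowstart_lt.
have sz (x : wX W) : (sep1 (wJ x)).+1 + size (adj_bits (wJ x).1) <= wN (wJ x).
  by rewrite wNE /sep2; lia.
have H1 : computable (fun x => rowstart (gn (wJ x).1) (f x) + (g x - (f x).+1)).
  apply: comp_add.
  - by apply: comp_rowstart => // x /lt; lia.
  - apply: comp_sub => //; apply: comp_succ => // x /lt; have := gn_lt_wN (wJ x); lia.
  by move=> x Dx; have := pos x Dx; have := sz x; lia.
have H2 : computable (fun x => (sep1 (wJ x)).+1 + (rowstart (gn (wJ x).1) (f x) + (g x - (f x).+1))).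
  apply: comp_add => //; last by move=> x Dx; have := pos x Dx; have := sz x; lia.
  apply: comp_succ; first exact: comp_sep1.
  by move=> x _; apply: ltn_trans (sep1_lt_sep2 _) (sep2_lt_wN _).
apply: comp_ext (comp_bit H2) => x Dx; rewrite word_adj ?pos //.
by have /andP[? ?] := lt x Dx; rewrite nth_adj_bits //; case: adjn.
Qed.

(** The triangle stores a pair in one order only, so both orders are tried; for equal or out of
    range arguments both guards fail, in agreement with [adjn]. *)
Lemma comp_adj W (f g : wX W -> nat) : computable f -> computable g ->
  computable (fun x => (adjn (wJ x).1 (f x) (g x) : nat)).
Proof.
move=> Hf Hg; have Hn := comp_gn W.
pose b1 x := (f x < g x) && (g x < gn (wJ x).1).
pose b2 x := (g x < f x) && (f x < gn (wJ x).1).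
have H1 : computable (fun x => (b1 x && adjn (wJ x).1 (f x) (g x) : nat)).
  apply: comp_and.
    by apply: comp_and; [exact: comp_lt | apply/comp_restrict/comp_lt].
  by apply: comp_adj_lt; [exact: comp_restrict | exact: comp_restrict | move=> x []].
have H2 : computable (fun x => (b2 x && adjn (wJ x).1 (g x) (f x) : nat)).
  apply: comp_and.
    by apply: comp_and; [exact: comp_lt | apply/comp_restrict/comp_lt].
  by apply: comp_adj_lt; [exact: comp_restrict | exact: comp_restrict | move=> x []].
apply: comp_ext (comp_or H1 H2) => x _; rewrite /b1 /b2 (adjn_sym _ (g x)).
case E: (adjn _ _ _); last by rewrite !andbF.
have ltg := adjn_lt E; have ltf : f x < gn (wJ x).1 by apply: (@adjn_lt _ (g x)); rewrite adjn_sym.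
rewrite ltf ltg; case: (ltngtP (f x) (g x)) => // Efg.
by rewrite Efg adjn_irr in E.
Qed.

(** * The kernelization program *)

Definition twinn (G : sgraph) (u v : nat) : bool :=
  all (fun z => adjn G u z == adjn G v z) (iota 0 (gn G)).

Definition keepn (G : sgraph) (v : nat) : bool :=
  count (fun y => (y < v) && twinn G y v) (iota 0 (gn G)) <
  count (fun y => ~~ twinn G y v) (iota 0 (gn G)) + odd (gn G).

Definition nkept (G : sgraph) := count (keepn G) (iota 0 (gn G)).

Lemma count_iota_guard (phi : pred nat) n N : n <= N ->
  count (fun y => (y < n) && phi y) (iota 0 N) = count phi (iota 0 n).
Proof.
move=> le; rewrite -(subnKC le) iotaD count_cat.
rewrite (eq_in_count (a2 := phi)); last by move=> y; rewrite mem_iota add0n => /= ->.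
rewrite (eq_in_count (s := iota _ (N - n)) (a2 := pred0)) ?count_pred0 ?addn0 //.
by move=> y; rewrite mem_iota add0n => /andP[ley _]; rewrite ltnNge ley.
Qed.

Lemma comp_count_gn W (phi : wX W -> nat -> bool) :
  (forall q A, computable (W := @loopw W q A) (fun y => (phi y.1.1 y.2 : nat))) ->
  computable (fun x => count (phi x) (iota 0 (gn (wJ x).1))).
Proof.
move=> H; have := @comp_count W (fun x i => (i < gn (wJ x).1) && phi x i).
case=> [q A|H1 H2].
  by apply: comp_and; [apply: comp_lt; [exact: comp_idx | exact: (comp_lift _ _ (comp_gn W))] | exact: comp_restrict].
by apply: comp_ext (conj H1 H2) => x _; rewrite count_iota_guard // ltnW // gn_lt_wN.
Qed.

Lemma comp_twin W (f g : wX W -> nat) : computable f -> computable g ->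
  computable (fun x => (twinn (wJ x).1 (f x) (g x) : nat)).
Proof.
move=> Hf Hg.
have := @comp_count_gn W (fun x z => adjn (wJ x).1 (f x) z != adjn (wJ x).1 (g x) z).
case=> [q A|H1 H2].
  have Ha := comp_adj (comp_lift q A Hf) (comp_idx q A).
  have Hb := comp_adj (comp_lift q A Hg) (comp_idx q A).
  have := comp_ifb Ha (comp_restrict _ (comp_not Hb)) (comp_restrict _ Hb).
  by apply: comp_ext => y _; case: adjn; case: adjn.
apply: comp_ext (comp_eq (conj H1 H2) (comp_zero W)) => x _; congr nat_of_bool.
by rewrite /twinn eqn0Ngt -has_count -all_predC; apply: eq_all => z /=; rewrite negbK.
Qed.

Lemma comp_keep W (f : wX W -> nat) : computable f ->
  computable (fun x => (keepn (wJ x).1 (f x) : nat)).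
Proof.
move=> Hf; apply: comp_lt.
  apply: (@comp_count_gn W (fun x y => (y < f x) && twinn (wJ x).1 y (f x))) => q A.
  have Hl := comp_lift q A Hf.
  apply: comp_and; first by apply: comp_lt; [exact: comp_idx | exact: Hl].
  by apply/comp_restrict/comp_twin; [exact: comp_idx | exact: Hl].
apply: comp_add.
- apply: (@comp_count_gn W (fun x y => ~~ twinn (wJ x).1 y (f x))) => q A.
  apply/comp_not/comp_twin; [exact: comp_idx | exact: (comp_lift q A Hf)].
- exact/comp_odd/comp_gn.
move=> x _; apply: leq_trans (gn_lt_wN (wJ x)); rewrite -addn1 leq_add ?leq_b1 //.
by rewrite -{2}(size_iota 0 (gn _)) count_size.
Qed.

Lemma comp_nkept W : computable (fun x : wX W => nkept (wJ x).1).
Proof. by apply: (@comp_count_gn W (fun x => keepn (wJ x).1)) => q A; apply/comp_keep/comp_idx. Qed.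

Lemma comp_wN W : computable (fun x : wX W => wN (wJ x)).
Proof.
apply: (@comp_loop W (fun=> id)); first exact: comp_zero.
by move=> q; apply: comp_succ; [exact: comp_idx | case=> y i []].
Qed.

Lemma comp_size_k W : computable (fun x : wX W => size (bin (wJ x).2)).
Proof.
have Hs : computable (fun x : wX W => (sep2 (wJ x)).+1).
  by apply: comp_succ; [exact: comp_sep2 | move=> x _; apply: sep2_lt_wN].
by apply: comp_ext (comp_sub (comp_wN W) Hs) => x _; rewrite wNE addKn.
Qed.

Lemma compo_bool W (b : wX W -> bool) : computable (fun x => (b x : nat)) ->
  compo (fun x => [:: Bit (b x)]).
Proof.
move=> Hb; have := compo_if Hb (@compo_emit _ (Bit true) isT) (@compo_emit _ (Bit false) isT).
by apply: compo_ext => x _; case: (b x).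
Qed.

Lemma compo_when W (b : wX W -> bool) (o : wX W -> seq sym) : computable (fun x => (b x : nat)) ->
  compo o -> compo (fun x => if b x then o x else [::]).
Proof. by move=> Hb Ho; apply: compo_if => //; [exact: compo_restrict | exact: compo_nil]. Qed.

Lemma flatten_when (T : Type) (P : pred nat) (F : nat -> T) (s : seq nat) :
  flatten [seq if P i then [:: F i] else [::] | i <- s] = [seq F i | i <- s & P i].
Proof. by elim: s => //= i s ->; case: (P i). Qed.

Lemma filter_iota_lt n N : n <= N -> [seq i <- iota 0 N | i < n] = iota 0 n.
Proof.
move=> le; rewrite -(subnKC le) iotaD filter_cat.
rewrite (eq_in_filter (a2 := predT)); last by move=> y; rewrite mem_iota add0n => /andP[_ ->].
rewrite filter_predT (eq_in_filter (s := iota _ (N - n)) (a2 := pred0)) ?filter_pred0 ?cats0 //.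
by move=> y; rewrite mem_iota add0n => /andP[ley _]; rewrite ltnNge ley.
Qed.

Lemma compo_bin W (f : wX W -> nat) : computable f -> compo (fun x => map Bit (bin (f x))).
Proof.
move=> Hf; have Hs := comp_size_bin Hf.
have := @compo_for W (fun x i => if i < size (bin (f x)) then
  [:: Bit (odd (f x %/ 2 ^ (size (bin (f x)) - i.+1)))] else [::]).
case=> [q|H1 H2].
  apply: compo_when; first by apply: comp_lt; [exact: comp_idx | exact: (comp_lift q _ Hs)].
  apply/compo_bool/comp_odd/comp_shift; first exact: (comp_lift q _ Hf).
  apply: comp_sub; first exact: (comp_lift q _ Hs).
  by apply: comp_succ; [exact: comp_idx | case=> y i []].
apply: compo_ext (conj H1 H2) => x Dx.
rewrite (flatten_when (fun i => i < size (bin (f x)))) filter_iota_lt; last first.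
  by have [+ _] := Hs; apply.
apply: (@eq_from_nth _ Blank); rewrite !size_map size_iota // => i lti.
rewrite !(nth_map 0) ?size_iota // (nth_map false) // nth_iota // nth_bin //.
by congr (Bit (odd (_ %/ 2 ^ _))); lia.
Qed.

(** [k] may exceed every register, so its digits are copied verbatim. *)
Lemma compo_k W : compo (fun x : wX W => map Bit (bin (wJ x).2)).
Proof.
have := @compo_for W (fun x i => if sep2 (wJ x) < i then
  [:: Bit (nth Blank (word (wJ x)) i == Bit true)] else [::]).
case=> [q|H1 H2].
  apply: compo_when; first by apply: comp_lt; [exact: (comp_lift q _ (comp_sep2 W)) | exact: comp_idx].
  exact/compo_bool/comp_bit/comp_idx.
apply: compo_ext (conj H1 H2) => x Dx.
rewrite (flatten_when (fun i => sep2 (wJ x) < i)) filter_iota_gt ?sep2_lt_wN //.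
have -> : wN (wJ x) - (sep2 (wJ x)).+1 = size (bin (wJ x).2) by rewrite wNE addKn.
apply: (@eq_from_nth _ Blank); rewrite !size_map size_iota // => i lti.
rewrite !(nth_map 0) ?size_iota // nth_iota // addSnnS word_tail /= (nth_map false) //.
by case: (nth false _ i).
Qed.

Definition kept_bits (G : sgraph) : seq bool :=
  flatten [seq [seq adjn G u v | v <- iota 0 (gn G) & (u < v) && keepn G v]
    | u <- iota 0 (gn G) & keepn G u].

Lemma compo_kept_bits W : compo (fun x : wX W => map Bit (kept_bits (wJ x).1)).
Proof.
pose P x u v := (u < v) && (v < gn (wJ (w := W) x).1) && (keepn (wJ x).1 u && keepn (wJ x).1 v).
have := @compo_for W (fun x u => flatten [seq if P x u v then
  [:: Bit (adjn (wJ x).1 u v)] else [::] | v <- iota 0 (wN (wJ x))]).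
case=> [q|H1 H2].
  set W1 := loopw _ _.
  apply: (@compo_for W1 (fun y v => if P y.1.1 y.2 v then [:: Bit (adjn (wJ y).1 y.2 v)] else [::])) => q1.
  set W2 := loopw _ _.
  have Hu : computable (W := W2) (fun z => z.1.1.2) by exact: (comp_lift q1 _ (comp_idx q _)).
  have Hv : computable (W := W2) (fun z => z.2) by exact: comp_idx.
  have Hn := comp_gn W2.
  apply: compo_when; last exact/compo_bool/comp_adj.
  apply: comp_and; first by apply: comp_and; [exact: comp_lt | apply/comp_restrict/comp_lt].
  by apply/comp_restrict/comp_and; [exact: comp_keep | apply/comp_restrict/comp_keep].
apply: compo_ext (conj H1 H2) => x Dx; set G := (wJ x).1; set N := wN (wJ x).
have leN : gn G <= N by apply/ltnW/gn_lt_wN.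
rewrite /kept_bits map_flatten -map_comp.
transitivity (flatten [seq [seq Bit (adjn G u v) | v <- iota 0 N & P x u v] | u <- iota 0 N]).
  by congr flatten; apply: eq_map => u; rewrite (flatten_when (P x u)).
transitivity (flatten [seq (if (u < gn G) && keepn G u then
    [seq Bit (adjn G u v) | v <- iota 0 (gn G) & (u < v) && keepn G v] else [::]) | u <- iota 0 N]).
  congr flatten; apply: eq_map => u.
  have -> : [seq v <- iota 0 N | P x u v] =
            [seq v <- iota 0 (gn G) | (u < v) && keepn G v & keepn G u].
    rewrite -(filter_iota_lt leN) -filter_predI; apply: eq_filter => v; rewrite /P /= -/G.
    by case: (u < v); case: (v < gn G); case: (keepn G u); case: (keepn G v).
  case: (keepn G u); last by rewrite andbF (eq_filter (a2 := pred0)) ?filter_pred0 // => v; rewrite andbF.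
  rewrite andbT (eq_filter (a2 := fun v => (u < v) && keepn G v)); last by move=> v; rewrite andbT.
  case: ltnP => // leu; rewrite (eq_in_filter (a2 := pred0)) ?filter_pred0 // => v.
  by rewrite mem_iota /=; lia.
have -> : forall F : nat -> seq sym, flatten [seq (if (u < gn G) && keepn G u then F u else [::]) | u <- iota 0 N]
    = flatten [seq F u | u <- iota 0 (gn G) & keepn G u].
  move=> F; have -> : iota 0 (gn G) = [seq u <- iota 0 N | u < gn G] by rewrite filter_iota_lt.
  rewrite -filter_predI.
  by elim: (iota 0 N) => //= u s ->; rewrite andbC; case: (_ && _).
by congr flatten; apply: eq_map => u /=; rewrite -map_comp.
Qed.

(** Stands in for a comparison with [16 k], which may not fit into a register. A longer bit length
    forces [nkept %/ 16 > k]; one at most that of [k] forces [nkept %/ 16 < 2 (k + 1)]. *)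
Definition kernel_small (J : sgraph * nat) : bool :=
  size (bin (nkept J.1 %/ 16)) <= size (bin J.2).

(** The fallback is the encoding of the empty graph with parameter [0], a yes-instance. *)
Definition kernel_output (J : sgraph * nat) : seq sym :=
  if kernel_small J then
    map Bit (bin (nkept J.1)) ++ Sep :: map Bit (kept_bits J.1) ++ Sep :: map Bit (bin J.2)
  else [:: Bit false; Sep; Sep; Bit false].

Lemma compo_kernel : compo (W := base_world) kernel_output.
Proof.
have Hn := comp_nkept base_world.
have E m : m./2./2./2./2 = m %/ 16 by lia.
have H16 : computable (W := base_world) (fun x => nkept x.1 %/ 16).
  by apply: comp_ext (comp_half (comp_half (comp_half (comp_half Hn)))) => x _; rewrite E.
have Hc : computable (W := base_world) (fun x => (kernel_small x : nat)).
  by apply: comp_leq; [exact: comp_size_bin | exact: (comp_size_k base_world)].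
have sep W : compo (fun _ : wX W => [:: Sep]) by apply: compo_emit.
have zero W : compo (fun _ : wX W => [:: Bit false]) by apply: compo_emit.
have H1 := compo_cat (compo_bin Hn) (compo_cat (sep _) (compo_cat (compo_kept_bits base_world)
  (compo_cat (sep _) (compo_k base_world)))).
have H2 := compo_cat (zero base_world) (compo_cat (sep _) (compo_cat (sep _) (zero _))).
have := compo_if Hc (compo_restrict _ H1) (compo_restrict _ H2).
by apply: compo_ext => x _.
Qed.

(** * Gluing bisections of large excess *)

Lemma good_arith xx yy xy pp qq pq xp yq xq yp t t' :
  xx + yy + t.*2 <= xy.*2 -> pp + qq + t'.*2 <= pq.*2 -> xp + yq <= xq + yp ->
  xx + xp + (xp + pp) + (yy + yq + (yq + qq)) + (t + t').*2 <= (xy + xq + (yp + pq)).*2.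
Proof. by lia. Qed.

Section Cuts.
Variables (T : finType) (e : rel T).
Hypotheses (esym : symmetric e) (eirr : irreflexive e).
Implicit Types (X Y U H I J C : {set T}).

(** Ordered pairs are counted: [ecut X X] is twice the number of edges inside [X], whereas for
    disjoint sets every crossing edge counts once. *)
Definition ecut (X Y : {set T}) : nat := \sum_(u in X) \sum_(v in Y) e u v.

Lemma ecutC X Y : ecut X Y = ecut Y X.
Proof.
rewrite /ecut exchange_big; apply: eq_bigr => u _; apply: eq_bigr => v _.
by rewrite esym.
Qed.

Lemma ecutUl X Y Z : [disjoint X & Y] -> ecut (X :|: Y) Z = ecut X Z + ecut Y Z.
Proof. by move=> dXY; rewrite /ecut -bigU //; apply: eq_bigl => u; rewrite !inE. Qed.

Lemma ecutUr X Y Z : [disjoint X & Y] -> ecut Z (X :|: Y) = ecut Z X + ecut Z Y.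
Proof. by move=> dXY; rewrite !(ecutC Z) ecutUl. Qed.

Lemma cardsUd X Y : [disjoint X & Y] -> #|X :|: Y| = #|X| + #|Y|.
Proof. by move=> dXY; rewrite cardsU (disjoint_setI0 dXY) cards0 subn0. Qed.

Lemma disjoint_setU X Y (P Q : {set T}) : [disjoint X & Y] -> [disjoint X & Q] ->
  [disjoint P & Y] -> [disjoint P & Q] -> [disjoint X :|: P & Y :|: Q].
Proof.
by rewrite !disjoints_subset subUset !setCU !subsetI => -> -> -> ->.
Qed.

(** As inner edges count twice, the inequality says that the cut edges in [U] outnumber the uncut
    ones by at least [t]. The tolerance [d] is [0] for pieces to be glued and [1] for a bisection;
    the sides are not ordered, so they can be flipped. *)
Definition good d U t := exists X Y, [/\ X :|: Y = U, [disjoint X & Y],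
  #|X| <= #|Y| + d, #|Y| <= #|X| + d & ecut X X + ecut Y Y + t.*2 <= (ecut X Y).*2].

Lemma goodW d U t t' : t' <= t -> good d U t -> good d U t'.
Proof.
by move=> le [X [Y [? ? ? ? ?]]]; exists X, Y; split=> //; apply: leq_trans (_ : _ <= _) _; last eassumption; rewrite leq_add2l leq_double.
Qed.

(* Flipping the sides of one part exchanges the crossing pairs that are cut with those that are not. *)
Lemma goodU d U U' t t' : [disjoint U & U'] -> good 0 U t -> good d U' t' ->
  good d (U :|: U') (t + t').
Proof.
move=> dU [X [Y [EU dXY c1 c2 le]]] [X' [Y' [EU' dXY' c1' c2' le']]].
have dis (A A' : {set T}) : A \subset U -> A' \subset U' -> [disjoint A & A'].
  by move=> sA sA'; exact: (disjointWl sA (disjointWr sA' dU)).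
have [sX sY] : X \subset U /\ Y \subset U by rewrite -EU subsetUl subsetUr.
have [sX' sY'] : X' \subset U' /\ Y' \subset U' by rewrite -EU' subsetUl subsetUr.
(* [key] covers both orientations of the second piece. The first piece is exactly balanced, so the
   tolerance does not grow. *)
have key P Q : P :|: Q = U' -> [disjoint P & Q] -> P \subset U' -> Q \subset U' ->
    #|P| <= #|Q| + d -> #|Q| <= #|P| + d -> ecut P P + ecut Q Q + t'.*2 <= (ecut P Q).*2 ->
    ecut X P + ecut Y Q <= ecut X Q + ecut Y P -> good d (U :|: U') (t + t').
  move=> EPQ dPQ sP sQ cP cQ lePQ cross.
  have [dXP dXQ dYP dYQ] : [/\ [disjoint X & P], [disjoint X & Q], [disjoint Y & P] & [disjoint Y & Q]].
    by rewrite !dis.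
  exists (X :|: P), (Y :|: Q); split.
  - by rewrite setUACA EU EPQ.
  - by apply: disjoint_setU; rewrite // disjoint_sym.
  - by rewrite (cardsUd dXP) (cardsUd dYQ) -addnA leq_add // -[#|Y|]addn0.
  - by rewrite (cardsUd dXP) (cardsUd dYQ) -addnA leq_add // -[#|X|]addn0.
  rewrite !ecutUl // !ecutUr // (ecutC P X) (ecutC Q Y) (ecutC P Y).
  exact: good_arith.
have [le1|/ltnW le2] := leqP (ecut X X' + ecut Y Y') (ecut X Y' + ecut Y X').
  exact: (key X' Y').
apply: (key Y' X') => //; first by rewrite setUC.
  by rewrite disjoint_sym.
by rewrite (ecutC Y') [ecut Y' Y' + _]addnC.
Qed.

Lemma ecut0 X Y : {in X & Y, forall u v, ~~ e u v} -> ecut X Y = 0.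
Proof.
move=> H; rewrite /ecut big1 // => u uX; rewrite big1 // => v vY.
by rewrite (negbTE (H u v uX vY)).
Qed.

Lemma good0 d : good d set0 0.
Proof.
exists set0, set0; rewrite setUid disjoints_subset sub0set cards0.
by split=> //; rewrite /ecut !big_set0.
Qed.

Lemma good2 u v : u != v -> good 0 [set u; v] (e u v).
Proof.
move=> ne; exists [set u], [set v]; rewrite disjoints1 inE ne !cards1 /ecut !big_set1.
by rewrite !eirr; split=> //; lia.
Qed.

Lemma good1 u : good 1 [set u] 0.
Proof.
exists set0, [set u]; rewrite set0U disjoints_subset sub0set cards0 cards1 /ecut !big_set0 !big_set1 eirr.
by split.
Qed.

(** The centre sides with its non-neighbours, which restores the balance. By independence only star
    edges are present, and all of them are cut. *)
Lemma good_star c (N Z : {set T}) : {in N, forall v, e c v} -> {in Z, forall v, ~~ e c v} ->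
  {in N :|: Z &, forall u v, ~~ e u v} -> c \notin N :|: Z -> [disjoint N & Z] ->
  #|N| = #|Z|.+1 -> good 0 (c |: (N :|: Z)) #|N|.
Proof.
move=> HN HZ ind; rewrite !inE negb_or => /andP[cN cZ] dNZ cd.
exists (c |: Z), N; split.
- by rewrite -setUA (setUC Z).
- by rewrite disjoints_subset subUset sub1set inE cN -disjoints_subset disjoint_sym.
- by rewrite cardsU1 cZ; lia.
- by rewrite cardsU1 cZ; lia.
rewrite (@ecut0 (c |: Z) (c |: Z)); last first.
  move=> u v; rewrite !inE => /predU1P[->|uZ] /predU1P[->|vZ]; rewrite ?eirr ?HZ //.
    by rewrite esym HZ.
  by apply: ind; rewrite inE ?uZ ?vZ orbT.
rewrite (@ecut0 N N); last by move=> u v uN vN; apply: ind; rewrite inE ?uN ?vN.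
rewrite !add0n leq_double ecutUl ?disjoints1 //.
have -> : ecut [set c] N = #|N|.
  by rewrite /ecut big_set1 -sum1_card; apply: eq_bigr => v vN; rewrite HN.
exact: leq_addr.
Qed.

(** A pair of vertices split between the sides has nonnegative excess, and a last single vertex uses
    up the tolerance. This completes any piece to a bisection of the whole graph without loss. *)
Lemma good_balanced U : good 1 U 0.
Proof.
have [m] := ubnP #|U|; elim: m U => // m IH U; rewrite ltnS => leU.
have [->|[u uU]] := set_0Vmem U; first exact: good0.
have [E|[v vU]] := set_0Vmem (U :\ u).
  by rewrite -(setD1K uU) E setU0; apply: good1.
have ne : u != v by move: vU; rewrite !inE eq_sym => /andP[].
rewrite (_ : U = [set u; v] :|: (U :\ u :\ v)); last first.
  by rewrite -setUA (setD1K vU) (setD1K uU).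
rewrite -[0]/(0 + 0); apply: goodU.
- by rewrite disjoints_subset subUset !sub1set !inE !eqxx /= !andbF.
- exact: goodW (good2 ne).
by apply: IH; apply: leq_trans leU; rewrite (cardsD1 u U) uU (cardsD1 v (U :\ u)) vU !add1n ltnS leqnSn.
Qed.

(** [C] collects the ends of [t] disjoint edges, each glued in with excess [1]; when no edge can be
    added, the rest is independent. *)
Lemma maximal_matching U : exists C I t,
  [/\ C :|: I = U, [disjoint C & I], good 0 C t, #|C| = t.*2 & {in I &, forall u v, ~~ e u v}].
Proof.
have [m] := ubnP #|U|; elim: m U => // m IH U; rewrite ltnS => leU.
case: (pickP [pred p : T * T | [&& p.1 \in U, p.2 \in U & e p.1 p.2]]) => [[u v] /= /and3P[uU vU euv]|H].
  have ne : u != v by apply/eqP => E; rewrite E eirr in euv.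
  have vU' : v \in U :\ u by rewrite !inE eq_sym ne.
  have [|C [I [t [EU dCI gC cC iI]]]] := IH (U :\ u :\ v).
    by apply: leq_trans leU; rewrite (cardsD1 u U) uU (cardsD1 v (U :\ u)) vU' !add1n ltnS leqnSn.
  have duv : [disjoint [set u; v] & U :\ u :\ v].
    by rewrite disjoints_subset subUset !sub1set !inE !eqxx /= !andbF.
  have dC : [disjoint [set u; v] & C] by apply: disjointWr duv; rewrite -EU subsetUl.
  have dI : [disjoint [set u; v] & I] by apply: disjointWr duv; rewrite -EU subsetUr.
  exists ([set u; v] :|: C), I, (1 + t); split=> //.
  - by rewrite -setUA EU -setUA (setD1K vU') (setD1K uU).
  - by rewrite disjoints_subset subUset -!disjoints_subset dI.
  - by apply: goodU => //; have := good2 ne; rewrite euv.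
  by rewrite (cardsUd dC) cards2 ne cC doubleD.
exists set0, U, 0; rewrite set0U disjoints_subset sub0set cards0; split=> //.
  exact: good0.
by move=> u v uU vU; have := H (u, v); rewrite /= uU vU /= => ->.
Qed.

Lemma subset_of_card X m : m <= #|X| -> exists2 Y : {set T}, Y \subset X & #|Y| = m.
Proof.
elim: m => [|m IH] le; first by exists set0; rewrite ?sub0set ?cards0.
have [Y sYX cY] := IH (ltnW le).
have /set0Pn[x] : X :\: Y != set0 by rewrite -card_gt0 cardsD (setIidPr sYX); lia.
rewrite inE => /andP[xY xX]; exists (x |: Y); first by rewrite subUset sub1set xX.
by rewrite cardsU1 xY cY.
Qed.

(** [J] is what is left of [I], and [H] is the union of the stars. A centre takes equally many
    neighbours and non-neighbours out of [J] until one kind is exhausted; it then no longer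
    distinguishes vertices of [J], and further shrinking of [J] preserves this. Removing [2 p]
    vertices gains excess [p], whence the bound on [I :\: J]. *)
Lemma star_packing I : {in I &, forall u v, ~~ e u v} -> forall cs, uniq cs ->
  {in cs, forall c, c \notin I} -> exists H J t,
  [/\ J \subset I, H \subset [set c in cs] :|: (I :\: J), good 0 H t, #|I :\: J| <= t.*2 &
      {in cs, forall c, {in J, forall v, e c v} \/ {in J, forall v, ~~ e c v}}].
Proof.
move=> iI; elim=> [_ _|c cs IH /= /andP[cncs ucs] Hcs].
  by exists set0, I, 0; rewrite subxx sub0set setDv cards0; split=> //; apply: good0.
have cI : c \notin I by apply: Hcs; rewrite mem_head.
have [|H [J [t [sJ sH gH cJ Hc]]]] := IH ucs.
  by move=> x xcs; apply: Hcs; rewrite inE xcs orbT.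
pose A := [set v in J | e c v]; pose B := [set v in J | ~~ e c v].
pose p := minn #|A| #|B|.
have [N sN cN] : exists2 N : {set T}, N \subset A & #|N| = p by apply: subset_of_card; apply: geq_minl.
have [Z sZ cZ] : exists2 Z : {set T}, Z \subset B & #|Z| = p by apply: subset_of_card; apply: geq_minr.
(* Balance leaves room for only [p - 1] non-neighbours in the star; the spare vertex of [Z] is
   removed from [J] as well but joins no star. *)
have [Z' sZ' cZ'] : exists2 Z' : {set T}, Z' \subset Z & #|Z'| = p.-1.
  by apply: subset_of_card; rewrite cZ leq_pred.
have sAJ : A \subset J by apply/subsetP=> x; rewrite inE => /andP[].
have sBJ : B \subset J by apply/subsetP=> x; rewrite inE => /andP[].
have sNJ := subset_trans sN sAJ; have sZJ := subset_trans sZ sBJ.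
have dAB : [disjoint A & B].
  by rewrite disjoints_subset; apply/subsetP=> x; rewrite !inE => /andP[-> ->].
have dNZ : [disjoint N & Z] by exact: (disjointWl sN (disjointWr sZ dAB)).
pose J' := J :\: (N :|: Z).
have cNZ : #|N :|: Z| = p.*2 by rewrite (cardsUd dNZ) cN cZ addnn.
have HJ' : {in J', forall v, e c v} \/ {in J', forall v, ~~ e c v}.
  case: (leqP #|A| #|B|) => cmp.
    right; have EN : N = A.
      by apply/eqP; rewrite eqEcard sN cN /p (minn_idPl cmp) leqnn.
    move=> v; rewrite !inE negb_or EN => /andP[/andP[]]; rewrite inE => + _ vJ.
    by rewrite vJ.
  left; have EZ : Z = B.
    by apply/eqP; rewrite eqEcard sZ cZ /p (minn_idPr (ltnW cmp)) leqnn.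
  move=> v; rewrite !inE negb_or EZ => /andP[/andP[_]]; rewrite inE => + vJ.
  by rewrite vJ negbK.
have EIJ : I :\: J' = (I :\: J) :|: (N :|: Z).
  apply/setP=> x; rewrite !inE negb_and !negbK.
  have /implyP := subsetP sNJ x; have /implyP := subsetP sZJ x; have /implyP := subsetP sJ x.
  by case: (x \in N); case: (x \in Z); case: (x \in J); case: (x \in I).
have cIJ : #|I :\: J'| <= (t + p).*2.
  by rewrite EIJ; apply: leq_trans (leq_card_setU _ _) _; rewrite cNZ doubleD leq_add2r.
have HJ2 : {in c :: cs, forall c, {in J', forall v, e c v} \/ {in J', forall v, ~~ e c v}}.
  move=> x; rewrite inE => /predU1P[->//|/Hc [] Hx]; [left|right] => v; rewrite inE => /andP[_ /Hx] //.
have sJ' : J' \subset I by apply: subset_trans sJ; apply: subsetDl.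
have sH0 : H \subset [set x in c :: cs] :|: (I :\: J').
  apply: subset_trans sH _; rewrite EIJ; apply/subsetP=> x; rewrite !inE.
  by case/orP=> [->|->]; rewrite ?orbT.
(* For [p = 0] the centre was already uniform on [J], and a star without leaves would not be
   balanced. *)
have [p0|p0] := posnP p.
  by exists H, J', t; split=> //; rewrite -[t]addn0 -p0.
exists (H :|: (c |: (N :|: Z'))), J', (t + p); split=> //.
- rewrite subUset sH0 subUset sub1set !inE eqxx /= EIJ.
  apply/subsetP=> x xNZ; rewrite !inE; apply/orP; right; apply/orP; right.
  by move: xNZ; rewrite inE => /orP[->//|/(subsetP sZ') ->]; rewrite orbT.
apply: goodU => //.
  rewrite disjoints_subset; apply: subset_trans sH _; apply/subsetP=> x; rewrite !inE.
  case/orP=> [xcs|/andP[xJ xI]].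
    have xI : x \notin I by apply: Hcs; rewrite inE xcs orbT.
    have xJ : x \notin J by apply: contra xI; apply: (subsetP sJ).
    rewrite !negb_or; apply/and3P; split; first by apply: contra cncs => /eqP <-.
      by apply: contra xJ; apply: (subsetP sNJ).
    by apply: contra xJ => /(subsetP sZ')/(subsetP sZJ).
  rewrite !negb_or; apply/and3P; split; first by apply: contra cI => /eqP <-.
    by apply: contra xJ; apply: (subsetP sNJ).
  by apply: contra xJ => /(subsetP sZ')/(subsetP sZJ).
have sNZI : N :|: Z' \subset I.
  by apply: subset_trans sJ; rewrite subUset sNJ (subset_trans sZ').
rewrite -cN; apply: good_star.
- by move=> v /(subsetP sN); rewrite inE => /andP[].
- by move=> v /(subsetP sZ')/(subsetP sZ); rewrite inE => /andP[].
- by move=> u v /(subsetP sNZI) uI /(subsetP sNZI) vI; apply: iI.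
- by apply: contra cI; apply: (subsetP sNZI).
- exact: disjointWr sZ' dNZ.
by rewrite cN cZ' prednK.
Qed.

Definition twin u v := [forall z, e u z == e v z].

(** A round reaching excess [2 k] is completed to the whole vertex set. Otherwise [t1] and [t2] are
    at most [2 k - 1], and at most [2 t1 + 2 t2 <= 8 k - 4] vertices lie outside [J]. Vertices of
    [J] have no neighbour in the independent set [I] and are not distinguished by any matched
    vertex, so they are twins. *)
Lemma good_or_twins k : good 1 [set: T] k.*2 \/
  (#|T| + 4 <= 8 * k \/ exists v, #|[set y | ~~ twin y v]| + 4 <= 8 * k).
Proof.
have extend H t : k.*2 <= t -> good 0 H t -> good 1 [set: T] k.*2.
  move=> le gH; rewrite -(setUCr H) -[k.*2]addn0; apply: goodU.
  - by rewrite disjoints_subset setCK.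
  - exact: goodW gH.
  exact: good_balanced.
have [C [I [t1 [EV dCI gC cC iI]]]] := maximal_matching [set: T].
have [le1|lt1] := leqP k.*2 t1; first by left; apply: extend gC.
have [|H [J [t2 [sJ sH gH cJ Hc]]]] := star_packing iI (enum_uniq C).
  by move=> c; rewrite mem_enum => cC'; rewrite (disjointFr dCI).
have [le2|lt2] := leqP k.*2 t2; first by left; apply: extend gH.
right.
have cVJ : #|~: J| <= t1.*2 + t2.*2.
  have -> : ~: J = C :|: (I :\: J).
    apply/setP=> x; rewrite !inE; have := in_setT x; rewrite -EV inE.
    have := disjointFr dCI (x := x); have /implyP := subsetP sJ x.
    by case: (x \in C); case: (x \in I); case: (x \in J) => //= _ /(_ isT).
  by apply: leq_trans (leq_card_setU _ _) _; rewrite cC leq_add2l.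
have [J0|[v vJ]] := set_0Vmem J; [left|right].
  by move: cVJ; rewrite J0 setC0 cardsT; lia.
exists v; apply: (@leq_trans (#|~: J| + 4)); last by lia.
rewrite leq_add2r; apply: subset_leq_card; apply/subsetP=> y; rewrite !inE; apply: contra => yJ.
apply/forallP=> z; apply/eqP; have := in_setT z; rewrite -EV inE => /orP[zC|zI].
  by rewrite !(esym _ z); have [|Hz|Hz] := Hc z; rewrite ?mem_enum // ?Hz // (negbTE (Hz _ _)) ?(negbTE (Hz _ _)).
by rewrite !(negbTE (iI _ _ _ zI)) // (subsetP sJ).
Qed.

End Cuts.

(** * Deleting twins *)

(** The excess depends on the numbers [xr] and [yr] of twins only through [(aX - aY) (yr - xr)], and
    [E] keeps [yr - xr] fixed. *)
Lemma twins_arith aX aY cxx cyy cxy t xr yr xr' yr' : yr' + xr = yr + xr' ->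
  cxx + cyy + (aX * xr + aY * yr).*2 + t <= (cxy + aX * yr + aY * xr).*2 ->
  cxx + cyy + (aX * xr' + aY * yr').*2 + t <= (cxy + aX * yr' + aY * xr').*2.
Proof.
move=> E; have [le|/ltnW le] := leqP xr xr'.
  have -> : xr' = xr + (xr' - xr) by lia.
  have -> : yr' = yr + (xr' - xr) by lia.
  by move: (xr' - xr) => d; rewrite !mulnDr; lia.
have -> : xr = xr' + (xr - xr') by lia.
have -> : yr = yr' + (xr - xr') by lia.
by move: (xr - xr') => d; rewrite !mulnDr; lia.
Qed.

Section Twins.
Variables (T : finType) (e : rel T).
Hypotheses (esym : symmetric e) (eirr : irreflexive e).
Variable r0 : T.
Let R := [set y | twin e y r0].

Lemma twin_deg (X Y : {set T}) : Y \subset R ->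
  ecut e X Y = (\sum_(u in X) e u r0) * #|Y|.
Proof.
move=> /subsetP sY; rewrite big_distrl /=; apply: eq_bigr => u _.
rewrite -sum1_card big_distrr /=; apply: eq_bigr => v /sY; rewrite inE => /forallP/(_ u)/eqP E.
by rewrite muln1 esym E esym.
Qed.

(** Twins share their open neighbourhoods, so an edge between two of them would force a loop. *)
Lemma twin_indep (X Y : {set T}) : X \subset R -> Y \subset R -> ecut e X Y = 0.
Proof.
move=> /subsetP sX /subsetP sY; apply: ecut0 => u v /sX + /sY; rewrite !inE.
move=> /forallP/(_ v)/eqP Eu /forallP/(_ v)/eqP Ev.
by rewrite Eu -Ev eirr.
Qed.

(** Twins enter the cut through their numbers alone: those on the two sides may be exchanged for any
    others with the same difference of sizes. [XW] and [YW] are the parts outside the class. *)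
Lemma excess_twins (XW YW XR YR XR' YR' : {set T}) t :
  [disjoint XW & R] -> [disjoint YW & R] ->
  XR \subset R -> YR \subset R -> XR' \subset R -> YR' \subset R ->
  #|YR'| + #|XR| = #|YR| + #|XR'| ->
  let exc X Y := ecut e X X + ecut e Y Y + t <= (ecut e X Y).*2 in
  exc (XW :|: XR) (YW :|: YR) -> exc (XW :|: XR') (YW :|: YR').
Proof.
move=> dX dY sX sY sX' sY' E exc.
have main (A B : {set T}) : A \subset R -> B \subset R -> exc (XW :|: A) (YW :|: B) =
  (ecut e XW XW + ecut e YW YW + ((\sum_(u in XW) e u r0) * #|A| + (\sum_(u in YW) e u r0) * #|B|).*2 + t
    <= (ecut e XW YW + (\sum_(u in XW) e u r0) * #|B| + (\sum_(u in YW) e u r0) * #|A|).*2).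
  move=> sA sB; have dXA := disjointWr sA dX; have dYB := disjointWr sB dY.
  rewrite /exc !ecutUl // !ecutUr // (twin_indep sA sA) (twin_indep sA sB) (twin_indep sB sB).
  rewrite (ecutC esym A XW) (ecutC esym B YW) (ecutC esym A YW).
  rewrite !(twin_deg _ sA) !(twin_deg _ sB); clear.
  by congr (_ <= _); lia.
by rewrite !main //; apply: twins_arith.
Qed.

Lemma good_twins (S : {set T}) t : ~: R \subset S ->
  #|S :&: R| = #|~: R| + odd #|T| -> #|~: R| + odd #|T| <= #|R| ->
  good e 1 S t <-> good e 1 [set: T] t.
Proof.
move=> sRS cK leR; set K := S :&: R in cK.
have cR : #|R| + #|~: R| = #|T| by rewrite cardsC.
pose D := R :\: S; pose j := #|D|./2.
have cD : #|D| = j.*2.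
  have : #|R :&: S| + #|D| = #|R| by rewrite cardsID.
  by rewrite setIC -/K cK /j; lia.
have cKD : #|K| + j.*2 = #|R| by rewrite -cD -(cardsID S R) setIC.
have sKR : K \subset R by apply: subsetIr.
have sDR : D \subset R by apply: subsetDl.
have split (X : {set T}) : X = (X :\: R) :|: (X :&: R) by rewrite setUC setID.
have dR (X : {set T}) : [disjoint X :\: R & R] by rewrite disjoints_subset; apply/subsetP=> x; rewrite !inE => /andP[].
have card_split (X : {set T}) : #|X| = #|X :\: R| + #|X :&: R| by rewrite addnC cardsID.
split=> -[X [Y [EU dXY c1 c2 exc]]].
- have [D1 sD1 cD1] : exists2 D1 : {set T}, D1 \subset D & #|D1| = j.
    by apply: subset_of_card; rewrite cD -addnn leq_addr.
  pose D2 := D :\: D1.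
  have cD2 : #|D2| = j by rewrite cardsD (setIidPr sD1) cD cD1 -addnn addnK.
  have sD2 : D2 \subset D by apply: subsetDl.
  have [sXS sYS] : X \subset S /\ Y \subset S by rewrite -EU subsetUl subsetUr.
  have dSD (A B : {set T}) : A \subset S -> B \subset D -> [disjoint A & B].
    move=> sA sB; apply: (disjointWl sA (disjointWr sB _)).
    by rewrite disjoint_sym disjoints_subset; apply/subsetP=> x; rewrite !inE => /andP[].
  have EX : X :|: D1 = (X :\: R) :|: ((X :&: R) :|: D1) by rewrite setUA -split.
  have EY : Y :|: D2 = (Y :\: R) :|: ((Y :&: R) :|: D2) by rewrite setUA -split.
  exists (X :|: D1), (Y :|: D2); split.
  + rewrite setUACA EU -{1}(setIidPr sD1) setID; apply/setP=> x; rewrite !inE.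
    have := subsetP sRS x; rewrite !inE.
    by case: (x \in S); case: (twin e x r0) => // /(_ isT).
  + have d12 : [disjoint D1 & D2] by rewrite disjoint_sym disjoints_subset; apply/subsetP=> x; rewrite !inE => /andP[].
    by apply: disjoint_setU => //; [apply: dSD | rewrite disjoint_sym dSD].
  + by rewrite !cardsUd ?dSD // cD1 cD2 addnAC leq_add2r.
  + by rewrite !cardsUd ?dSD // cD1 cD2 addnAC leq_add2r.
  rewrite EX EY; apply: (excess_twins (XR := X :&: R) (YR := Y :&: R)) => //; rewrite ?subsetIr //.
  - by rewrite subUset subsetIr (subset_trans sD1).
  - by rewrite subUset subsetIr (subset_trans sD2).
  - rewrite !cardsUd ?cD1 ?cD2; [by clear; lia | |]; apply: dSD => //; exact: subset_trans (subsetIl _ _) _.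
  by rewrite -!split.
have cXY : #|X| + #|Y| = #|T| by rewrite -cardsUd // EU cardsT.
have cXYR : #|X :&: R| + #|Y :&: R| = #|R|.
  rewrite -cardsUd; first by rewrite -setIUl EU setTI.
  by apply: (disjointWl (subsetIl _ _) (disjointWr (subsetIl _ _) dXY)).
have [leX leY] : #|X :&: R| <= #|X| /\ #|Y :&: R| <= #|Y| by rewrite !subset_leq_card ?subsetIl.
(* Each side has at least [#|T|./2] vertices, at most [#|~: R|] of them outside [R], and [j] is
   exactly [#|T|./2 - #|~: R|]. *)
have [jX jY] : j <= #|X :&: R| /\ j <= #|Y :&: R|.
  move: (#|X :&: R|) (#|Y :&: R|) (#|X|) (#|Y|) (#|T|) (#|R|) (#|K|) (#|~: R|) cK cR cKD c1 c2 cXY cXYR leX leY leR.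
  by clear => *; lia.
(* The twins on a side need not lie in [S], so those of [K] are redistributed in the right
   numbers. *)
have [A sA cA] : exists2 A : {set T}, A \subset K & #|A| = #|X :&: R| - j.
  by apply: subset_of_card; move: cKD cXYR jX jY; clear; lia.
have sAR := subset_trans sA sKR.
pose B := K :\: A; have cB : #|B| = #|Y :&: R| - j by rewrite cardsD (setIidPr sA) cA;
  move: cKD cXYR jX jY; clear; lia.
have sBK : B \subset K by apply: subsetDl.
have sBR := subset_trans sBK sKR.
have dAB : [disjoint A & B] by rewrite disjoint_sym disjoints_subset; apply/subsetP=> x; rewrite !inE => /andP[].
have dW (P Q : {set T}) : Q \subset R -> [disjoint P :\: R & Q].
  by move=> sQ; apply: disjointWr sQ (dR P).
exists ((X :\: R) :|: A), ((Y :\: R) :|: B); split.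
- rewrite setUACA -{1}(setIidPr sA) setID -setDUl EU; apply/setP=> x; rewrite !inE.
  have := subsetP sRS x; rewrite !inE.
  by case: (x \in S); case: (twin e x r0) => // /(_ isT).
- have dXYR : [disjoint X :\: R & Y :\: R].
    by apply: (disjointWl (subsetDl _ _) (disjointWr (subsetDl _ _) dXY)).
  by apply: disjoint_setU => //; [apply: dW | rewrite disjoint_sym dW].
- by move: c1 jX jY; rewrite !cardsUd ?dW // cA cB (card_split X) (card_split Y); clear; lia.
- by move: c2 jX jY; rewrite !cardsUd ?dW // cA cB (card_split X) (card_split Y); clear; lia.
apply: (excess_twins (XR := X :&: R) (YR := Y :&: R)) => //; rewrite ?subsetIr //.
- by rewrite cA cB; move: jX jY; clear; lia.
by rewrite -!split.
Qed.

End Twins.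

(** * The kernel *)

Lemma count_iota_card n (phi : pred nat) : count phi (iota 0 n) = #|[set i : 'I_n | phi i]|.
Proof.
rewrite -val_enum_ord count_map cardsE cardE -size_filter; congr size.
by rewrite /enum_mem -filter_predI; apply: eq_filter => i; rewrite /= andbT.
Qed.

(** In a strictly sorted list the number of smaller elements is the index; applied to a twin class,
    this counts its kept members. *)
Lemma count_rank (s : seq nat) q : sorted ltn s ->
  count (fun y => count (fun z => z < y) s < q) s = minn q (size s).
Proof.
elim/last_ind: s => [|s y IH]; first by rewrite minn0.
move=> ss; have ss' : sorted ltn s by move: ss; apply: subseq_sorted (subseq_rcons _ _); apply: ltn_trans.
have lty z : z \in s -> z < y.
  move=> zs; move: ss; rewrite sorted_pairwise; last exact: ltn_trans.
  by rewrite pairwise_rcons => /andP[/allP/(_ z zs)].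
rewrite -cats1 count_cat /= addn0 size_cat /=.
have E z : z \in s -> count (fun x => x < z) (s ++ [:: y]) = count (fun x => x < z) s.
  by move=> zs; rewrite count_cat /= addn0 ltnNge (ltnW (lty z zs)) addn0.
rewrite (eq_in_count (a2 := fun z => count (fun x => x < z) s < q)); last by move=> z zs; rewrite E.
rewrite (IH ss') count_cat /= ltnn !addn0.
have -> : count (fun z => z < y) s = size s.
  by apply/eqP; rewrite -all_count; apply/allP.
lia.
Qed.

(** Both sides express [m + 2 k <= 2 c]: for odd [m] the rounding up is absorbed, [2 c - m] being
    odd as well. *)
Lemma ceil_half_excess m k xx yy c : m.*2 = xx + yy + c.*2 ->
  (ceil_half m + k <= c) = (xx + yy + k.*2.*2 <= c.*2).
Proof. by move=> E; rewrite /ceil_half; apply/idP/idP; lia. Qed.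

Section Kernel.
Variable G : sgraph.
Notation n := (gn G).
Notation e := (@gadj G).

Definition keptset : {set 'I_n} := [set i : 'I_n | keepn G i].

Lemma twinnE (i j : 'I_n) : twinn G i j = twin e i j.
Proof.
apply/allP/forallP => [H z|H z].
  by have := H z; rewrite mem_iota ltn_ord !adjn_ord; apply.
by rewrite mem_iota => /andP[_ ltz]; have := H (Ordinal ltz); rewrite -!adjn_ord.
Qed.

Lemma twin_eq (i j : 'I_n) : twin e i j -> twin e^~ i =1 twin e^~ j.
Proof.
move=> /forallP H k; apply/forallP/forallP => H' z; have := H z; have := H' z.
  by move=> /eqP -> /eqP ->.
by move=> /eqP -> /eqP ->.
Qed.

Lemma keepnE (i v : 'I_n) : twin e i v -> keepn G i =
  (count (fun z => z < i) [seq z <- iota 0 n | twinn G z v] <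
   #|~: [set y | twin e y v]| + odd n).
Proof.
move=> tw; rewrite /keepn count_filter; congr (_ < _ + _).
  apply: eq_in_count => z; rewrite mem_iota => /andP[_ ltz] /=.
  rewrite -[z]/(nat_of_ord (Ordinal ltz)) !twinnE.
  by rewrite (twin_eq tw).
rewrite count_iota_card; apply: eq_card => z; rewrite !inE twinnE.
by rewrite (twin_eq tw).
Qed.

Lemma card_kept_class (v : 'I_n) (R := [set y | twin e y v]) :
  #|keptset :&: R| = minn (#|~: R| + odd n) #|R|.
Proof.
pose s := [seq z <- iota 0 n | twinn G z v].
have ss : sorted ltn s by apply: sorted_filter; [exact: ltn_trans | exact: iota_ltn_sorted].
have szs : size s = #|R|.
  by rewrite size_filter count_iota_card; apply: eq_card => z; rewrite !inE twinnE.
rewrite -szs -(count_rank _ ss) count_filter count_iota_card; apply: eq_card => z.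
rewrite !inE twinnE; case tw: (twin e z v); last by rewrite !andbF.
by rewrite !andbT (keepnE tw).
Qed.

Lemma card_keptset : #|keptset| = nkept G.
Proof. by rewrite /nkept count_iota_card. Qed.

(** With [s] non-twins of [v], at most [s + 1] vertices of its class are kept, and at most [s]
    others exist. *)
Lemma nkept_le (v : 'I_n) : nkept G <= (#|[set y | ~~ twin e y v]|).*2.+1.
Proof.
set R := [set y | twin e y v].
have -> : [set y | ~~ twin e y v] = ~: R by apply/setP=> y; rewrite !inE.
have cK := card_kept_class v; rewrite -/R in cK.
rewrite -card_keptset -(cardsID R keptset) cK.
have le : #|keptset :\: R| <= #|~: R| by apply: subset_leq_card; rewrite setDE subsetIr.
apply: leq_trans (leq_add (geq_minl _ _) le) _.
by rewrite addnAC addnn -addn1 leq_add2l leq_b1.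
Qed.

(** A class [R] that misses a vertex has more than [s] members, [s] being the number of its
    non-members. Any other class [Q] then has at most [s] members and more than [s] non-members, so
    it is kept whole, and [good_twins] applies to [R]. *)
Lemma good_keptset t : good e 1 keptset t <-> good e 1 [set: 'I_n] t.
Proof.
have [E|] := boolP (keptset == [set: 'I_n]); first by rewrite (eqP E).
rewrite -subTset => /subsetPn[v _ vK]; set R := [set y | twin e y v].
have vR : v \in R by rewrite inE; apply/forallP.
have cK := card_kept_class v; rewrite -/R in cK.
have lt : #|keptset :&: R| < #|R|.
  apply: proper_card; rewrite properEneq subsetIr andbT; apply/eqP => E.
  by move: vR; rewrite -E inE (negbTE vK).
have cK' : #|keptset :&: R| = #|~: R| + odd #|'I_n| by rewrite card_ord; lia.
apply: (@good_twins _ e (@gsym G) (@girr G) v) => //; last by rewrite -/R -cK' ltnW.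
apply/subsetP=> y; rewrite inE => yR; set Q := [set z | twin e z y].
have yQ : y \in Q by rewrite inE; apply/forallP.
have sQ : Q \subset ~: R.
  apply/subsetP=> z; rewrite !inE => zy; apply: contra yR => zv; rewrite inE.
  apply/forallP=> x; move: zy zv => /forallP/(_ x)/eqP <- /forallP/(_ x)/eqP ->; exact: eqxx.
have leQ := subset_leq_card sQ.
have leR : #|R| <= #|~: Q| by apply: subset_leq_card; rewrite -setCS setCK.
have cQ := card_kept_class y; rewrite -/Q in cQ.
have EQ : keptset :&: Q = Q.
  apply/eqP; rewrite eqEcard subsetIr cQ leq_min leqnn andbT /=.
  apply: leq_trans (leq_trans leQ (leq_addr (odd #|'I_n|) _)) _; rewrite -cK'.
  exact: leq_trans (ltnW lt) (leq_trans leR (leq_addr _ _)).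
by move: yQ; rewrite -EQ inE => /andP[].
Qed.

Definition keptseq := [seq v <- iota 0 n | keepn G v].

Lemma size_keptseq : size keptseq = nkept G. Proof. exact: size_filter. Qed.

Lemma sorted_keptseq : sorted ltn keptseq.
Proof. by apply: sorted_filter; [exact: ltn_trans | exact: iota_ltn_sorted]. Qed.

(** Renumbering in increasing order preserves [u < v], so the upper triangle of the kernel is a
    subsequence of that of [G], in the same order. *)
Definition kgraph : sgraph := @SGraph (nkept G)
  (fun i j => adjn G (nth 0 keptseq i) (nth 0 keptseq j))
  (fun i j => adjn_sym G _ _) (fun i => adjn_irr G _).

Lemma adj_bits_kgraph : adj_bits kgraph = kept_bits G.
Proof.
pose f := nth 0 keptseq.
have Eks : keptseq = map f (iota 0 (nkept G)) by rewrite -size_keptseq; exact/esym/mkseq_nth.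
have lef i j : i < nkept G -> j < nkept G -> (f i < f j) = (i < j).
  move=> lti ltj; have tr := ltn_trans; have H := sorted_ltn_nth tr 0 sorted_keptseq.
  case: (ltngtP i j) => [ij|ji|->]; last by rewrite ltnn.
  - by apply: H; rewrite ?inE ?size_keptseq.
  - by apply/negbTE; rewrite -leqNgt; apply/ltnW/H; rewrite ?inE ?size_keptseq.
rewrite adj_bits_pairs /kept_bits -/keptseq Eks -map_comp; congr flatten.
apply/eq_in_map => i; rewrite mem_iota add0n => /andP[_ lti] /=.
have -> : [seq v <- iota 0 n | (f i < v) && keepn G v] = [seq v <- keptseq | f i < v].
  by rewrite -filter_predI.
rewrite Eks filter_map -map_comp.
rewrite [in RHS](eq_in_filter (a2 := fun j => i < j)); last first.
  by move=> j; rewrite mem_iota add0n => /andP[_ ltj] /=; apply: lef.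
apply/eq_in_map => j; rewrite mem_filter mem_iota add0n => /and3P[_ _ ltj] /=.
by rewrite -[i]/(nat_of_ord (Ordinal lti)) -[j]/(nat_of_ord (Ordinal ltj)) adjn_ord.
Qed.

Lemma keptseq_lt (i : 'I_(nkept G)) : nth 0 keptseq i < n.
Proof.
have : nth 0 keptseq i \in keptseq by apply: mem_nth; rewrite size_keptseq.
by rewrite mem_filter mem_iota => /and3P[].
Qed.

Definition kept_emb (i : 'I_(nkept G)) : 'I_n := Ordinal (keptseq_lt i).

Lemma kept_emb_inj : injective kept_emb.
Proof.
move=> i j /(congr1 val) /= /eqP; rewrite nth_uniq ?size_keptseq // => [/eqP/val_inj//|].
exact: sorted_uniq ltn_trans ltnn _ sorted_keptseq.
Qed.

Lemma kept_emb_im : kept_emb @: [set: 'I_(nkept G)] = keptset.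
Proof.
apply/eqP; rewrite eqEcard card_imset; last exact: kept_emb_inj.
rewrite cardsT card_ord card_keptset leqnn andbT; apply/subsetP=> _ /imsetP[i _ ->].
have : nth 0 keptseq i \in keptseq by apply: mem_nth; rewrite size_keptseq.
by rewrite mem_filter inE => /andP[].
Qed.

Lemma ecut_emb (X Y : {set 'I_(nkept G)}) :
  ecut (@gadj kgraph) X Y = ecut e (kept_emb @: X) (kept_emb @: Y).
Proof.
rewrite /ecut big_imset /=; last by move=> ? ? _ _; apply: kept_emb_inj.
apply: eq_bigr => i _; rewrite big_imset /=; last by move=> ? ? _ _; apply: kept_emb_inj.
by apply: eq_bigr => j _; rewrite -adjn_ord.
Qed.

Lemma good_kgraph t : good (@gadj kgraph) 1 [set: 'I_(nkept G)] t <-> good e 1 keptset t.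
Proof.
have inj := kept_emb_inj.
split=> -[X [Y [EU dXY c1 c2 exc]]].
  exists (kept_emb @: X), (kept_emb @: Y); rewrite -imsetU EU kept_emb_im !card_imset //.
  rewrite -!ecut_emb; split=> //.
  by rewrite -setI_eq0 -imsetI ?(disjoint_setI0 dXY) ?imset0 // => ? ? _ _; apply: inj.
have pre (Z : {set 'I_n}) : Z \subset keptset -> kept_emb @: (kept_emb @^-1: Z) = Z.
  move=> /subsetP sZ; apply/setP=> z; apply/imsetP/idP => [[i + ->]|zZ]; first by rewrite inE.
  have /imsetP[i _ Ei] : z \in kept_emb @: [set: 'I_(nkept G)] by rewrite kept_emb_im sZ.
  by exists i; rewrite // inE -Ei.
have [sX sY] : X \subset keptset /\ Y \subset keptset by rewrite -EU subsetUl subsetUr.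
have EX := pre X sX; have EY := pre Y sY.
exists (kept_emb @^-1: X), (kept_emb @^-1: Y); rewrite !ecut_emb EX EY; split=> //.
- apply: (imset_inj inj); rewrite imsetU EX EY EU; exact/esym/kept_emb_im.
- by rewrite -setI_eq0 -preimsetI (disjoint_setI0 dXY) preimset0.
- by rewrite -(card_imset _ inj) EX -(card_imset _ inj) EY.
- by rewrite -(card_imset _ inj) EY -(card_imset _ inj) EX.
Qed.

(** [edges] lists each edge once, with increasing ends, while the sum sees both orientations; the
    second one is accounted for by the transpose of [P]. *)
Lemma card_arcs (P : rel 'I_n) :
  #|[set p in edges G | P p.1 p.2]| + #|[set p in edges G | P p.2 p.1]| =
  \sum_u \sum_v (e u v && P u v).
Proof.
rewrite pair_big /= -sum1_card -[X in _ + X]sum1_card big_mkcond [X in _ + X]big_mkcond /=.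
rewrite [X in _ + X](reindex_inj (h := fun p : 'I_n * 'I_n => (p.2, p.1)) _) /=; last first.
  by move=> [a b] [c d] [-> ->].
rewrite -big_split; apply: eq_bigr => -[u v] _ /=; rewrite !inE /= (gsym v u).
case: (ltngtP u v) => [_|_|E] /=.
- by case: (e u v); case: (P u v).
- by case: (e u v); case: (P u v).
by rewrite (val_inj E) girr.
Qed.

Lemma bis_sizeE (X : {set 'I_n}) : bis_size X = ecut e X (~: X).
Proof.
have := card_arcs (fun u v => (u \in X) && (v \notin X)).
have -> : \sum_u \sum_v (e u v && ((u \in X) && (v \notin X))) = ecut e X (~: X).
  rewrite /ecut [RHS]big_mkcond; apply: eq_bigr => u _.
  case: (u \in X); last by rewrite big1 // => v _; rewrite andbF.
  rewrite [RHS]big_mkcond; apply: eq_bigr => v _; rewrite inE.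
  by case: (v \in X); rewrite ?andbF ?andbT.
move=> <-; rewrite -cardsUd; first apply: eq_card => -[u v].
  by rewrite !inE /=; case: (u < v); case: (e u v); case: (u \in X); case: (v \in X).
rewrite disjoints_subset; apply/subsetP => -[u v]; rewrite !inE /=.
by case: (u < v); case: (e u v); case: (u \in X); case: (v \in X).
Qed.

Lemma nedgesE : (nedges G).*2 = ecut e [set: 'I_n] [set: 'I_n].
Proof.
have := card_arcs (fun _ _ => true).
have -> : [set p in edges G | true] = edges G by apply/setP=> p; rewrite inE andbT.
rewrite addnn => ->; rewrite /ecut; under [RHS]eq_bigl do rewrite inE.
apply: eq_bigr => u _; under [RHS]eq_bigl do rewrite inE.
by apply: eq_bigr => v _; rewrite andbT.
Qed.

Lemma MaxBisec_good k : MaxBisecATLB G k <-> good e 1 [set: 'I_n] k.*2.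
Proof.
have esym := @gsym G.
have EV (X : {set 'I_n}) : (nedges G).*2 = ecut e X X + ecut e (~: X) (~: X) + (ecut e X (~: X)).*2.
  have dX : [disjoint X & ~: X] by rewrite disjoints_subset setCK.
  rewrite nedgesE -(setUCr X) !ecutUl // !ecutUr // (ecutC esym (~: X) X) -addnn; clear; lia.
split=> [[X [/andP[c1 c2] le]]|[X [Y [EU dXY c1 c2 exc]]]].
  exists X, (~: X); rewrite setUCr disjoints_subset setCK subxx; split=> //.
  - by rewrite addn1 leqW.
  - by rewrite addn1.
  by move: le; rewrite bis_sizeE (ceil_half_excess _ (EV X)).
have EY : Y = ~: X.
  apply/setP=> z; rewrite inE; have := in_setT z; rewrite -EU inE.
  by case zX: (z \in X) => /=; [rewrite (disjointFr dXY zX) | move=> ->].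
rewrite EY in c1 c2 exc *.
(* [is_bisection] wants the smaller side first, whereas [good] does not order the sides. *)
have [le|lt] := leqP #|X| #|~: X|.
  exists X; rewrite /is_bisection le -addn1 c2; split=> //.
  by rewrite bis_sizeE (ceil_half_excess _ (EV X)).
exists (~: X); rewrite /is_bisection setCK (ltnW lt) -addn1 c1; split=> //.
by rewrite bis_sizeE setCK (ecutC esym) (ceil_half_excess _ (EV X)).
Qed.

(** If excess [2 k] is not reached, either there are at most [8 k - 4] vertices, or some class has
    at most that many non-members and at most [2 (8 k - 4) + 1] vertices are kept; both are below
    [16 k]. *)
Lemma MaxBisec_large k : 16 * k < nkept G -> MaxBisecATLB G k.
Proof.
move=> lt; apply/MaxBisec_good.
have [//|[le|[v le]]] := good_or_twins (@gsym G) (@girr G) k.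
  have : nkept G <= n by rewrite -[X in _ <= X](size_iota 0) count_size.
  by rewrite card_ord in le; lia.
by have := nkept_le v; lia.
Qed.

End Kernel.

Lemma MaxBisec_kgraph G k : MaxBisecATLB G k <-> MaxBisecATLB (kgraph G) k.
Proof.
rewrite MaxBisec_good -good_keptset -good_kgraph.
exact: iff_sym (MaxBisec_good (kgraph G) k).
Qed.

(** * Size, running time and correctness of the kernel *)

Definition empty_graph : sgraph :=
  @SGraph 0 (fun _ _ => false) (fun _ _ => erefl) (fun _ => erefl).

Lemma MaxBisec_empty : MaxBisecATLB empty_graph 0.
Proof.
exists set0; split; first by rewrite /is_bisection setC0 cardsT card_ord cards0.
have E : nedges empty_graph = 0 by apply/eqP; rewrite cards_eq0; apply/eqP/setP=> -[[]].
by rewrite E.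
Qed.

Lemma kernel_outputE G k : kernel_output (G, k) =
  if kernel_small (G, k) then enc_instance (kgraph G) k else enc_instance empty_graph 0.
Proof.
rewrite /kernel_output /enc_instance adj_bits_kgraph; case: ifP => // _.
have -> : adj_bits empty_graph = [::] by rewrite adj_bitsE.
by [].
Qed.

Lemma rowstart_leq m n : m <= n -> rowstart m m <= rowstart n n.
Proof.
move=> le; apply: leq_trans (rowstart_mono n le).
elim: (X in rowstart m X <= rowstart n X) => // u IH.
by rewrite !rowstartS leq_add // leq_sub2r.
Qed.

Lemma nkept_leq G : nkept G <= gn G.
Proof. by rewrite -[X in _ <= X](size_iota 0) count_size. Qed.

(** Running time was bounded in input plus output length, so the output must be shown to be no
    longer than the input. *)
Lemma size_enc_kgraph G k : size (enc_instance (kgraph G) k) <= size (enc_instance G k).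
Proof.
rewrite -/(wN (kgraph G, k)) -/(wN (G, k)) !wNE leq_add2r /sep2 /sep1 !size_adj_bits !size_bin /=.
by rewrite !(ltnS, addSn) leq_add ?rowstart_leq ?leq_trunc_log ?nkept_leq.
Qed.

Lemma size_enc_empty G k : size (enc_instance empty_graph 0) <= size (enc_instance G k).
Proof.
rewrite -/(wN (empty_graph, 0)) -/(wN (G, k)) !wNE /sep2 /sep1 !size_adj_bits !size_bin /=.
by rewrite trunc_log0 {1}/rowstart /= !addSn !addnS !ltnS.
Qed.

(** A positive number with [l] digits is at least [2 ^ (l - 1)], so [2 ^ size (bin k)] is at most
    [2 k] for [k > 0], and it is [2] for [k = 0]. *)
Lemma kernel_small_bound G k : kernel_small (G, k) -> nkept G <= 32 * k.+1.
Proof.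
rewrite /kernel_small /= => le.
have lt : nkept G %/ 16 < 2 * k.+1.
  apply: leq_trans (bin_bound _) _; apply: (@leq_trans (2 ^ size (bin k))).
    by rewrite leq_exp2l.
  case: k {le} => [|k]; first by rewrite size_bin trunc_log0.
  rewrite (_ : size _ = (size (bin k.+1)).-1.+1); last by rewrite size_bin.
  by rewrite expnS leq_mul2l /= ltnW // ltnS bin_lower.
lia.
Qed.

Lemma kernel_large_bound G k : ~~ kernel_small (G, k) -> 16 * k < nkept G.
Proof.
rewrite /kernel_small /= -ltnNge => lt.
have pos : 0 < nkept G %/ 16.
  by rewrite lt0n; apply/eqP => E; move: lt; rewrite E !size_bin trunc_log0.
have : k < nkept G %/ 16.
  apply: leq_trans (bin_lower pos); apply: leq_trans (bin_bound k) _.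
  by rewrite leq_exp2l //; lia.
lia.
Qed.

Lemma nedges_leq G : nedges G <= gn G * gn G.
Proof. by rewrite -[X in X * _]card_ord -[X in _ * X]card_ord -card_prod max_card. Qed.

Theorem mainTheorem1 :
  exists (M : TM) (a d c : nat), 0 < c /\
    forall (G : sgraph) (k : nat),
      exists (G' : sgraph) (k' t : nat),
        t <= a * (size (enc_instance G k)).+1 ^ d /\
        runs_to M (enc_instance G k) t (enc_instance G' k') /\
        (MaxBisecATLB G k <-> MaxBisecATLB G' k') /\
        k' <= k /\
        gn G' <= c * (k ^ 2 + 1) /\
        nedges G' <= c * (k ^ 3 + 1).
Proof.
have [M [a [d HM]]] := compo_machine compo_kernel.
(* At most [32 (k + 1)] vertices give at most [1024 (k + 1) ^ 2] edges, and
   [(k + 1) ^ 2 <= 4 (k ^ 3 + 1)]. The factor [2 ^ d] pays for the output, which is no longer than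
   the input. *)
exists M, (a * 2 ^ d), d, 4096; split=> // G k.
have [t let_ run] := HM G k; rewrite kernel_outputE in let_ run.
have time N m : m <= N -> a * (N + m).+1 ^ d <= a * 2 ^ d * N.+1 ^ d.
  move=> le; rewrite -mulnA -expnMn leq_mul2l; case: (d) => [|d']; rewrite ?orbT //.
  by rewrite leq_exp2r // orbC (_ : (N + m).+1 <= 2 * N.+1) //; lia.
case: ifPn let_ run => ks let_ run.
- exists (kgraph G), k, t; split; last split; last split; last split; last split => //.
  + exact: leq_trans let_ (time _ _ (size_enc_kgraph G k)).
  + exact: run.
  + exact: MaxBisec_kgraph.
  + by [].
  + by apply: leq_trans (kernel_small_bound ks) _; rewrite -mulnn; nia.
  have le := kernel_small_bound ks.
  apply: leq_trans (nedges_leq _) _; apply: leq_trans (leq_mul le le) _.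
  by rewrite !expnS expn0 muln1; case: (k) => // k'; nia.
exists empty_graph, 0, t; split; last split; last split; last split; last split => //.
- exact: leq_trans let_ (time _ _ (size_enc_empty G k)).
- exact: run.
- split=> _; [exact: MaxBisec_empty | exact/MaxBisec_large/kernel_large_bound].
- by [].
- by apply: leq_trans (nedges_leq _) _.
Qed.
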